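(* For each $i\in\{1,2,3,4\}$ there is a constant $C_i$ such that, for all positive integers $n$ with $n\equiv i \pmod 4$, the number of maximal sum-free subsets of $[n]$ is $(C_i+o(1))\,2^{n/4}$, where $o(1)$ denotes a quantity tending to $0$ as $n\to\infty$ (with $n\equiv i \pmod 4$).
   Context: $[n]=\{1,\dots,n\}$. A triple $x,y,z$ (not necessarily distinct) is a Schur triple if $x+y=z$. A set $S$ of integers is sum-free if it contains no Schur triple. A set $S\subseteq[n]$ is a maximal sum-free subset of $[n]$ if it is sum-free and is not properly contained in another sum-free subset of $[n]$. *)

(* Defs.v *)
From mathcomp Require Import all_boot.

Set Implicit Arguments.
Unset Strict Implicit.
Unset Printing Implicit Defensive.

Definition schur_triple (x y z : nat) : bool := x + y == z.

(* Subsets of {0, ..., n} are the elements of {set 'I_n.+1}; the addition in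
   schur_triple is that of nat, not addition modulo n.+1. *)
Definition interval1 (n : nat) : {set 'I_n.+1} := [set x : 'I_n.+1 | 0 < x].

Definition sum_free (n : nat) (S : {set 'I_n.+1}) : bool :=
  [forall x : 'I_n.+1 in S, forall y : 'I_n.+1 in S, forall z : 'I_n.+1 in S,
     ~~ schur_triple x y z].

Definition max_sum_free (n : nat) (S : {set 'I_n.+1}) : bool :=
  maxset (fun T : {set 'I_n.+1} => (T \subset interval1 n) && sum_free T) S.

Definition num_max_sum_free (n : nat) : nat :=
  #|[set S : {set 'I_n.+1} | max_sum_free S]|.

(* Main.v *)
Require Import Defs.
From mathcomp Require Import all_boot all_order all_algebra.
From mathcomp Require Import zify ring lra.
Set Implicit Arguments.
Unset Strict Implicit.
Unset Printing Implicit Defensive.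
Import Order.TTheory GRing.Theory Num.Theory.

(* Write h for n/2 rounded down and let a be the fourth root of 2. A container theorem (graph
   removal for Schur triples plus an iterated fingerprint argument) covers all sum-free sets by
   2^o(n) unions A u B with A tiny and B sum-free; given M n A, the rest of M is a maximal
   independent set of a link graph on B. If |B| < 0.47 n, Moon-Moser gives exponentially fewer
   than a^n sets. Otherwise a Freiman-type argument shows that B consists of odd numbers or has
   minimum at least about 0.41 n.
   - Odd case: up to an exponentially small error, the count is that of the sets whose even
     part is a single s, namely the sum of 2^(s/4) over even s, which satisfies F(n+4) = 2F(n) + 3.
   - High case: the link graph of M n [1, h] on (h, n] is triangle-free, and the Hujter-Tuza bound
     2^(N/2) improves whenever it contains many disjoint paths on 3 vertices or isolated points.
     A second use of containers, on the window (h - r, h], shows that sets which do not have a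
     single element m below h - r, with |4m - n| <= 4r, number at most C th^r a^n with th < 1.
     The remaining sets double in number exactly when n grows by 4: shifting m by 1 and the upper
     part by 2, 3 and 4 leaves two new points, of which a maximal set contains exactly one.
   Both main terms thus grow by a factor 2 = a^4 up to errors, so the ratios to a^n are Cauchy
   along each residue class modulo 4. *)

(** * Maximal independent sets in graphs *)

(** The obstacle is that an asymptotic count tolerates no factor [u^n]. Containers cost such a
    factor, so over all of [n] they may only discard families that are exponentially small. In the
    high case the available saving is exponential in r only. Hence the second use of containers is
    confined to a window of length r: its cost is a power of u with exponent O(r), which a gain
    [g^(r/9)] pays for, and the bound [C th^r a^n] holds uniformly in n, so that r can be fixed
    before n grows. The constant of the theorem is never computed; it is the limit of a sequence
    shown to be Cauchy. The threshold 0.47 lies just below the value 0.473 at which the Moon-Moser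
    bound [3^(k/3)] reaches [2^(n/4)]. Most of the work takes place in an archimedean field, so real
    roots are replaced by bases v > 1 with [v^j <= u] and by rational bounds: 1.443 for the cube
    root of 3, and 7/5 as a branching base below the square root of 2. *)

Section Mis.
Variables (T : finType) (e : rel T).
Implicit Types (V I W U X : {set T}).

Definition mis V I :=
  [&& I \subset V, [forall x in I, forall y in I, ~~ e x y]
    & [forall x in V :\: I, exists y in I, e x y]].

Definition nmis V := #|[set I | mis V I]|.

Definition nbhd W := [set x | [exists w in W, e w x]].

Lemma misP V I : reflect [/\ I \subset V, {in I &, forall x y, ~~ e x y}
    & forall x, x \in V -> x \notin I -> exists2 y, y \in I & e x y] (mis V I).
Proof.
apply: (iffP and3P) => [[s1 s2 s3]|[s1 s2 s3]]; split => //.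
- by move=> x y xI yI; move/'forall_implyP: s2 => /(_ x xI) /'forall_implyP /(_ y yI).
- move=> x xV xI; move/'forall_implyP: s3 => /(_ x).
  by rewrite inE xV xI => /(_ isT) /exists_inP.
- by apply/'forall_implyP => x xI; apply/'forall_implyP => y yI; apply: s2.
- apply/'forall_implyP => x; rewrite inE => /andP[xI xV].
  by apply/exists_inP; apply: s3.
Qed.

Hypothesis esym : symmetric e.

(** Prescribing [W] inside and [U] outside [I] settles the points of [W], [nbhd W] and [U]. The rest
    of [I] still dominates the other points, because none of those has a neighbour in [W]. *)
Lemma nmis_restrict V W U : W \subset V ->
  #|[set I | [&& mis V I, W \subset I & [disjoint I & U]]]|
    <= nmis (V :\: (W :|: nbhd W :|: U)).
Proof.
move=> WV; rewrite /nmis.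
rewrite -(@card_in_imset _ _ (fun I => I :\: W)).
  apply/subset_leq_card/subsetP => J /imsetP[I]; rewrite !inE => /and3P[+ WI dIU] ->.
  move=> /misP[IV Iind Idom]; apply/misP; split.
  - apply/subsetP => x; rewrite !inE => /andP[xW xI].
    rewrite (subsetP IV) // andbT !negb_or xW /=; apply/andP; split.
      by apply/existsP => -[w /andP[wW]]; apply/negP/Iind => //; apply: (subsetP WI).
    by move/disjointFr: dIU => ->.
  - by move=> x y; rewrite !inE => /andP[_ xI] /andP[_ yI]; apply: Iind.
  - move=> x; rewrite !inE !negb_or -!andbA => /and4P[xW xN xU xV].
    rewrite xW /= => xI; have [y yI exy] := Idom _ xV xI.
    exists y => //; rewrite !inE yI andbT; apply: contra xN => yW.
    by apply/existsP; exists y; rewrite yW esym.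
move=> I J; rewrite !inE => /and3P[_ WI _] /and3P[_ WJ _] eq.
by rewrite -(setID I W) -(setID J W) eq (setIidPr WI) (setIidPr WJ).
Qed.

Lemma nbhd1 v : nbhd [set v] = [set x | e v x].
Proof.
apply/setP => x; rewrite !inE; apply/existsP/idP => [[w]|evx].
  by rewrite inE => /andP[/eqP->].
by exists v; rewrite inE eqxx.
Qed.

Definition cnb V v := V :&: (v |: [set x | e v x]).

Lemma mis_cnb V I v : mis V I -> v \in V -> exists2 w, w \in cnb V v & w \in I.
Proof.
move=> /misP[IV Iind Idom] vV; have [vI|vI] := boolP (v \in I).
  by exists v => //; rewrite !inE vV eqxx.
have [y yI evy] := Idom _ vV vI.
by exists y => //; rewrite !inE evy orbT (subsetP IV).
Qed.

Lemma nmis_in V w U : w \in V ->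
  #|[set I | [&& mis V I, w \in I & [disjoint I & U]]]|
    <= nmis (V :\: (cnb V w :|: U)).
Proof.
move=> wV; have := @nmis_restrict V [set w] U; rewrite sub1set => /(_ wV).
rewrite nbhd1.
have -> : V :\: ([set w] :|: [set x | e w x] :|: U) = V :\: (cnb V w :|: U).
  by apply/setP => x; rewrite !inE; case: (x \in V); rewrite ?andbF.
by under eq_finset do rewrite sub1set.
Qed.

Lemma nmis0 : nmis set0 <= 1.
Proof.
rewrite -(cards1 (set0 : {set T})); apply/subset_leq_card/subsetP => I.
by rewrite !inE => /misP[]; rewrite subset0.
Qed.

End Mis.

Local Open Scope ring_scope.

Section MoonMoser.
Variables (R : realFieldType) (c : R).
Hypothesis hc : forall k, (0 < k)%N -> k%:R <= c ^+ k.
Variables (T : finType) (e : rel T).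
Hypotheses (esym : symmetric e) (eirr : irreflexive e).

(** Every maximal independent set meets the closed neighbourhood of a vertex [v] of minimum degree.
    Branching over which of its [d] points is chosen gives [d] subproblems, each with at least [d]
    fewer vertices, and [d <= c ^+ d]. The hypothesis on [c] amounts to being at least the cube root
    of 3. *)
Lemma moon_moser (V : {set T}) : (nmis e V)%:R <= c ^+ #|V|.
Proof.
have c1 : 1 <= c by have := @hc 1 isT; rewrite expr1.
move: {2}#|V|.+1 (ltnSn #|V|) => k; elim: k V => // k IH V Vk.
have [->|/set0Pn[v0 v0V]] := eqVneq V set0.
  by rewrite cards0 expr0 lern1 nmis0.
case: (arg_minnP (fun v => #|cnb e V v|) v0V) => v vV' vmin; have {vV'} vV : v \in V by [].
set d := #|cnb e V v| in vmin.
have d0 : (0 < d)%N by apply/card_gt0P; exists v; rewrite !inE vV eqxx.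
have dV : (d <= #|V|)%N by apply/subset_leq_card/subsetIl.
have : (nmis e V <= \sum_(w in cnb e V v) nmis e (V :\: cnb e V w))%N.
  apply: (@leq_trans (\sum_(w in cnb e V v) #|[set I | mis e V I & w \in I]|)).
    rewrite /nmis -sum1_card.
    apply: (@leq_trans (\sum_(I | mis e V I) \sum_(w in cnb e V v | w \in I) 1)%N).
      rewrite big_mkcond /= [X in (_ <= X)%N]big_mkcond /=; apply: leq_sum => I _.
      rewrite inE; case: ifP => // Im.
      by have [w w1 w2] := mis_cnb Im vV; rewrite (bigD1 w) ?w1 //=.
    rewrite (exchange_big_dep (mem (cnb e V v))) /=; last by move=> ? ? _ /andP[].
    apply: leq_sum => w wc; rewrite -sum1_card.
    rewrite (eq_bigl (fun I => mis e V I && (w \in I))); last by move=> I; rewrite wc.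
    by under [X in (_ <= X)%N]eq_bigl do rewrite inE.
  apply: leq_sum => w; rewrite inE => /andP[wV _].
  have := @nmis_in _ _ esym V w set0 wV; rewrite setU0 => /(leq_trans _) -> //.
  apply/subset_leq_card/subsetP => I; rewrite !inE => /andP[-> ->] /=.
  by rewrite disjoint_sym -setI_eq0 set0I.
rewrite -(ler_nat R) => /le_trans; apply; rewrite natr_sum.
apply: (@le_trans _ _ (\sum_(w in cnb e V v) c ^+ (#|V| - d))).
  apply: ler_sum => w wc; have wV : w \in V by move: wc; rewrite inE => /andP[].
  have wd : (d <= #|cnb e V w|)%N by apply: vmin.
  have cV : (#|V :\: cnb e V w| = #|V| - #|cnb e V w|)%N.
    by rewrite cardsD; congr subn; apply: eq_card => x; rewrite !inE andbA andbb.
  apply: (le_trans (IH _ _)); rewrite cV.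
    by move: (subset_leq_card (subsetIl V (w |: [set x | e w x]))) wd d0 Vk;
       rewrite -/(cnb e V w); lia.
  by apply: ler_weXn2l => //; lia.
rewrite sumr_const -/d -[in leRHS](subnK dV) exprD -mulr_natr.
by apply: ler_wpM2l; [apply: exprn_ge0; apply: le_trans c1 | apply: hc].
Qed.

End MoonMoser.

(** * Packings of paths on 3 vertices and the Hujter-Tuza bound *)

Section Pack.
Variables (T : finType) (e : rel T).
Implicit Types (V I W U X B : {set T}).

Definition is_p3 B := [exists v, exists u, exists w,
  [&& B == [set v; u; w], u != w, e v u & e v w]].

Definition pack V q := exists P : {set {set T}},
  [/\ trivIset P, (q <= #|P|)%N & forall B, B \in P -> B \subset V /\ is_p3 B].

Lemma pack_le V q r : (r <= q)%N -> pack V q -> pack V r.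
Proof. by move=> rq [P [P1 P2 P3]]; exists P; split => //; apply: leq_trans P2. Qed.

(** The members are disjoint, so a deleted point destroys at most one of them; [f] picks such a
    point for each destroyed member. *)
Lemma pack_del V X q : pack V q -> pack (V :\: X) (q - #|X|).
Proof.
move=> [P [tP Pq Pp]]; exists [set B in P | [disjoint B & X]]; split.
- by apply: trivIsetS tP; apply/subsetP => B; rewrite inE => /andP[].
- rewrite -[X in (_ <= X)%N](addnK #|X|); apply: leq_sub2r; apply: (leq_trans Pq).
  set Q := [set B in P | _].
  have -> : #|P| = #|(P :&: Q) :|: (P :\: Q)| by rewrite setID.
  apply: (leq_trans (leq_card_setU _ _)); apply: leq_add.
    by apply/subset_leq_card/subsetIr.
  have ch B : B \in P :\: Q -> exists x, x \in B :&: X.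
    rewrite !inE => /andP[+ BP]; rewrite BP /= -setI_eq0 => /set0Pn[x xBX].
    by exists x.
  have [->|[B0 B0P]] := set_0Vmem (P :\: Q); first by rewrite cards0.
  have [x0 _] := ch _ B0P.
  pose f B := odflt x0 [pick x in B :&: X].
  have fP B : B \in P :\: Q -> f B \in B :&: X.
    move=> /ch[x xB]; rewrite /f; case: pickP => [//|/(_ x)]; by rewrite /= xB.
  rewrite -(@card_in_imset _ _ f).
    by apply/subset_leq_card/subsetP => z /imsetP[B /fP + ->]; rewrite inE => /andP[].
  move=> B C BP CP eqf; apply/eqP; apply: contraT => BC.
  have BP' : B \in P by move: BP; rewrite inE => /andP[].
  have CP' : C \in P by move: CP; rewrite inE => /andP[].
  move/trivIsetP: tP => /(_ _ _ BP' CP' BC) dBC.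
  have := fP _ BP; have := fP _ CP; rewrite -eqf !inE => /andP[fC _] /andP[fB _].
  by rewrite (disjointFr dBC fB) in fC.
- move=> B; rewrite inE => /andP[BP dB]; have [BV Bp] := Pp _ BP; split => //.
  by rewrite subsetD BV.
Qed.

Hypotheses (esy : symmetric e) (eirr : irreflexive e).

(** A path meeting [X] would have its centre in [X], hence two neighbours there. Isolated vertices
    and isolated edges can thus be split off without losing a path. *)
Lemma pack_del_isolated V X q :
    (forall x y z, x \in X -> y \in V -> z \in V -> e x y -> e x z -> y = z) ->
    (forall x y, x \in X -> y \in V -> e x y -> y \in X) ->
  pack V q -> pack (V :\: X) q.
Proof.
move=> deg1 cl [P [tP Pq Pp]]; exists P; split => // B BP.
have [BV Bp3] := Pp _ BP; split => //; rewrite subsetD BV /=.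
rewrite -setI_eq0; apply/negPn/negP => /set0Pn[x]; rewrite inE => /andP[xB xX].
move: Bp3 => /existsP[v /existsP[u /existsP[w /and4P[/eqP BE uw evu evw]]]].
have [vV uV wV] : [/\ v \in V, u \in V & w \in V].
  by split; apply: (subsetP BV); rewrite BE !inE eqxx ?orbT.
have vX : v \in X.
  move: xB; rewrite BE !inE => /orP[/orP[]|] /eqP xE; rewrite xE in xX => //.
    by apply: (cl u) => //; rewrite esy.
  by apply: (cl w) => //; rewrite esy.
by move: uw; rewrite (deg1 _ _ _ vX uV wV evu evw) eqxx.
Qed.

(* Greedy selection: each of the three points of a chosen star lies in at most three stars of the family. *)
Lemma pack_stars (J : finType) (X : {set J}) (V : {set T}) (a b c : J -> T) :
    {in X &, injective a} -> {in X &, injective b} -> {in X &, injective c} ->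
    (forall x, x \in X -> [/\ a x \in V, b x \in V, c x \in V & b x != c x]) ->
    (forall x, x \in X -> e (a x) (b x) && e (a x) (c x)) ->
  forall q, (9 * q <= #|X|)%N -> pack V q.
Proof.
move=> ia ib ic iV iE q Xq.
pose t x := [set a x; b x; c x].
pose good (Y : {set J}) := (Y \subset X) &&
   [forall x in Y, forall y in Y, (x != y) ==> [disjoint t x & t y]].
have g0 : good set0.
  by rewrite /good sub0set /=; apply/'forall_implyP => x; rewrite inE.
have [Y /maxsetP[/andP[YX /'forall_implyP Yd] Ymax] _] := maxset_exists g0.
have Yd' x y : x \in Y -> y \in Y -> x != y -> [disjoint t x & t y].
  by move=> xY yY xy; move/'forall_implyP: (Yd x xY) => /(_ y yY); rewrite xy.
exists (t @: Y); split.
- apply/trivIsetP => A B /imsetP[x xY ->] /imsetP[y yY ->] txy.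
  by apply: Yd' => //; apply: contraNneq txy => ->.
- rewrite card_in_imset; last first.
    move=> x y xY yY txy; apply/eqP; apply: contraT => xy.
    have := Yd' _ _ xY yY xy; rewrite -txy -setI_eq0 setIid => /eqP/setP/(_ (a x)).
    by rewrite !inE eqxx.
  have XU : X \subset [set x in X | a x \in cover (t @: Y)]
     :|: [set x in X | b x \in cover (t @: Y)] :|: [set x in X | c x \in cover (t @: Y)].
    apply/subsetP => x xX; rewrite !inE xX /=; apply: contraT.
    rewrite !negb_or -andbA => /and3P[na nb nc].
    have xY : x \notin Y.
      apply: contra na => xY; apply/bigcupP; exists (t x); rewrite ?imset_f //.
      by rewrite !inE eqxx.
    have dis y : y \in Y -> [disjoint t x & t y].
      move=> yY; rewrite -setI_eq0; apply/eqP/setP => z; rewrite !inE.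
      apply/negP => /andP[zx zy].
      have : z \in cover (t @: Y).
        by apply/bigcupP; exists (t y); rewrite ?imset_f // !inE.
      by case/orP: zx => [/orP[]|] /eqP ->; apply/negP.
    have gY : good (x |: Y).
      apply/andP; split; first by rewrite subUset sub1set xX.
      apply/'forall_implyP => y; rewrite !inE => yY.
      apply/'forall_implyP => z; rewrite !inE => zY; apply/implyP => yz.
      case/orP: yY => [/eqP yx|yY]; case/orP: zY => [/eqP zx|zY].
      - by rewrite yx zx eqxx in yz.
      - by rewrite yx dis.
      - by rewrite zx disjoint_sym dis.
      - exact: Yd'.
    have := Ymax _ gY (subsetUr _ _) => YE.
    by rewrite -YE !inE eqxx in xY.
  have cov : (#|cover (t @: Y)| <= 3 * #|Y|)%N.
    rewrite (leq_trans (leq_card_cover _)) //.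
    apply: (@leq_trans (\sum_(B in t @: Y) 3)%N).
      apply: leq_sum => B /imsetP[x _ ->]; apply: (leq_trans (leq_card_setU _ _)).
      by rewrite cards1 cards2; case: (_ == _).
    by rewrite sum_nat_const mulnC leq_mul2l leq_imset_card orbT.
  have bnd (f : J -> T) : {in X &, injective f} ->
     (#|[set x in X | f x \in cover (t @: Y)]| <= 3 * #|Y|)%N.
    move=> fi; apply: leq_trans cov; rewrite -(@card_in_imset _ _ f).
      by apply/subset_leq_card/subsetP => z /imsetP[x]; rewrite inE => /andP[_ ?] ->.
    by move=> x y; rewrite !inE => /andP[xX _] /andP[yX _]; apply: fi.
  move: (subset_leq_card XU) (bnd _ ia) (bnd _ ib) (bnd _ ic) Xq.
  set A1 := [set x in X | a x \in _]; set A2 := [set x in X | b x \in _].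
  set A3 := [set x in X | c x \in _].
  have := (leq_card_setU (A1 :|: A2) A3).1; have := (leq_card_setU A1 A2).1.
  by lia.
- move=> B /imsetP[x xY ->]; have xX := subsetP YX _ xY.
  have [aV bV cV bc] := iV _ xX; have /andP[ab ac] := iE _ xX.
  split; first by rewrite /t !subUset !sub1set aV bV cV.
  by apply/existsP; exists (a x); apply/existsP; exists (b x); apply/existsP;
    exists (c x); rewrite eqxx bc ab ac.
Qed.

Definition triangle_free V := forall x y z, x \in V -> y \in V -> z \in V ->
  e x y -> e y z -> e x z -> False.

Lemma triangle_freeS V X : X \subset V -> triangle_free V -> triangle_free X.
Proof. by move=> /subsetP XV tV x y z /XV xV /XV yV /XV zV; apply: tV. Qed.

Local Open Scope ring_scope.
Variables (R : realFieldType) (s g : R).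
Hypotheses (s0 : 0 < s) (s2 : s ^+ 2 = 2) (sg : s * g = 7 / 5).

Let s_lb : 7 / 5 <= s.
Proof.
rewrite leNgt; apply/negP => lt; have : 0 < (7 / 5 - s) * s by (apply: mulr_gt0 => //; lra).
move: s2; rewrite expr2; lra.
Qed.

Let g0 : 0 < g.
Proof. by have : 0 < s * g by [rewrite sg; lra]; rewrite pmulr_rgt0. Qed.

(** Deleting [x] vertices costs at most [x] paths, and a vertex lost together with a path is worth
    [s * g = 7 / 5]. When [x] exceeds [q], the remaining vertices are worth [s >= 7 / 5] each. *)
Let branch N q x : (x <= N)%N ->
  s ^+ (N - x) * g ^+ (q - x) <= s ^+ N * g ^+ q * (5 / 7) ^+ x.
Proof.
move=> xN; rewrite -[in leRHS](subnK xN) [s ^+ (N - x + x)]exprD -!mulrA.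
apply: ler_wpM2l; first exact/exprn_ge0/ltW.
have [xq|qx] := leqP x q.
  rewrite -[in leRHS](subnK xq) exprD.
  have -> : s ^+ x * (g ^+ (q - x) * g ^+ x * (5 / 7) ^+ x) =
     g ^+ (q - x) * (s * g * (5 / 7)) ^+ x by rewrite !exprMn; ring.
  by rewrite sg (_ : 7 / 5 * (5 / 7) = 1) ?expr1n ?mulr1 //; field.
have -> : (q - x = 0)%N by lia.
rewrite expr0 -(subnK (ltnW qx)) !exprD.
have -> : s ^+ (x - q) * s ^+ q * (g ^+ q * ((5 / 7) ^+ (x - q) * (5 / 7) ^+ q)) =
   (s * (5 / 7)) ^+ (x - q) * (s * g * (5 / 7)) ^+ q by rewrite !exprMn; ring.
rewrite sg (_ : 7 / 5 * (5 / 7) = 1 :> R) ?expr1n ?mulr1; last by field.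
by apply: exprn_ege1; have := s_lb; lra.
Qed.

(* Branching at the centre of a path on 3 vertices beats the growth rate [s] by the factor
   [g] = 7/5 / [s], once for each path of the packing. *)
Theorem hujter_tuza V q : triangle_free V -> pack V q ->
  (nmis e V)%:R <= s ^+ #|V| * g ^+ q.
Proof.
move: {2}#|V|.+1 (ltnSn #|V|) => k; elim: k V q => // k IH V q Vk tV pV.
have slb := s_lb; have g1 : g <= 1.
  rewrite leNgt; apply/negP => g1; have : 0 < s * (g - 1) by rewrite mulr_gt0 ?subr_gt0.
  by rewrite mulrBr sg; lra.
set bnd := s ^+ #|V| * g ^+ q.
have bnd0 : 0 <= bnd by apply: mulr_ge0; apply/exprn_ge0/ltW.
have cD X : X \subset V -> (#|V :\: X| = #|V| - #|X|)%N.
  by move=> XV; rewrite cardsD (setIidPr XV).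
have step (j : nat) X : X \subset V -> (0 < j <= #|X|)%N ->
    (nmis e (V :\: X))%:R <= bnd * (5 / 7) ^+ j.
  move=> XV /andP[j0 jX]; have XN := subset_leq_card XV.
  apply: (le_trans (IH _ (q - #|X|)%N _ _ _)).
  - by rewrite cD //; lia.
  - exact: triangle_freeS (subsetDl _ _) tV.
  - exact: pack_del.
  rewrite cD //; apply: (le_trans (branch q XN)).
  apply: ler_wpM2l => //; apply: ler_wiXn2l => //; lra.
have [V0|/set0Pn[v0 v0V]] := eqVneq V set0.
  rewrite /bnd; case: q pV {bnd bnd0 step} => [_|q [P [_ Pq PV]]].
    by rewrite V0 cards0 !expr0 mulr1 lern1 nmis0.
  have /card_gt0P[B BP] : (0 < #|P|)%N by apply: leq_trans Pq.
  have [BV] := PV _ BP; rewrite V0 in BV.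
  move=> /existsP[x /existsP[y /existsP[z /and4P[/eqP BE _ _ _]]]].
  have : x \in B by rewrite BE !inE eqxx.
  by move/(subsetP BV); rewrite inE.
case: (arg_minnP (fun v => #|cnb e V v|) v0V) => v vV' vmin.
have {vV'} vV : v \in V by [].
have cV x : cnb e V x \subset V by apply: subsetIl.
have cI x : x \in V -> x \in cnb e V x by move=> xV; rewrite !inE xV eqxx.
have inb w U : w \in V ->
    (#|[set I | [&& mis e V I, w \in I & [disjoint I & U]]]|
      <= nmis e (V :\: (cnb e V w :|: U)))%N by move=> wV; apply: nmis_in.
have in0 w : w \in V ->
    (#|[set I | mis e V I & w \in I]| <= nmis e (V :\: cnb e V w))%N.
  move=> wV; have := inb w set0 wV; rewrite setU0; apply: leq_trans.
  apply/subset_leq_card/subsetP => I; rewrite !inE => /andP[-> ->] /=.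
  by rewrite -setI_eq0 setI0.
(* An isolated [v] lies in every maximal independent set and is deleted for free. *)
have [d1|d1] := leqP #|cnb e V v| 1.
  have cE : cnb e V v = [set v].
    by apply/esym/eqP; rewrite eqEcard sub1set cI // cards1.
  have -> : nmis e V = #|[set I | mis e V I & v \in I]|.
    apply: eq_card => I; rewrite !inE; case: (boolP (mis e V I)) => // Im /=.
    by have [w] := mis_cnb Im vV; rewrite cE inE => /eqP ->.
  apply: (@le_trans _ _ (nmis e (V :\: [set v]))%:R).
    by rewrite ler_nat -cE in0.
  apply: (le_trans (IH _ q _ _ _)).
  - have V0 : (0 < #|V|)%N by (apply/card_gt0P; exists v).
    by rewrite cD ?sub1set // cards1; lia.
  - exact: triangle_freeS (subsetDl _ _) tV.
  - apply: pack_del_isolated => // [x y z|x y]; rewrite inE => /eqP -> yV.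
      move=> zV evy; have : y \in cnb e V v by rewrite !inE yV evy orbT.
      by rewrite cE inE => /eqP yv; rewrite yv eirr in evy.
    move=> evy; have : y \in cnb e V v by rewrite !inE yV evy orbT.
    by rewrite cE inE.
  apply: ler_wpM2r; first exact/exprn_ge0/ltW.
  by apply: ler_weXn2l; [lra | rewrite cD ?sub1set // leq_subr].
have cov2 (A B : {set {set T}}) (x y : R) : [set I | mis e V I] \subset A :|: B ->
   #|A|%:R <= x -> #|B|%:R <= y -> (nmis e V)%:R <= x + y.
  move=> /subset_leq_card sub hA hB; apply: (le_trans _ (lerD hA hB)).
  rewrite -natrD ler_nat; apply: (leq_trans sub); exact: leq_card_setU.
have [d2|d2] := leqP #|cnb e V v| 2.
  have [w wE] : exists w, cnb e V v :\ v = [set w].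
    by apply/cards1P; have := cardsD1 v (cnb e V v); rewrite cI //; lia.
  have wc : w \in cnb e V v :\ v by rewrite wE inE.
  have cE : cnb e V v = [set v; w] by rewrite -wE setD1K // cI.
  have [wv wV evw] : [/\ w != v, w \in V & e v w].
    by move: wc; rewrite !inE; case: eqP => //= _ /andP[].
  have sub : [set I | mis e V I] \subset
     [set I | mis e V I & v \in I] :|: [set I | mis e V I & w \in I].
    apply/subsetP => I; rewrite !inE => Im; rewrite Im /=.
    have [x] := mis_cnb Im vV.
    by rewrite cE !inE => /orP[/eqP->|/eqP->] ->; rewrite ?orbT.
  (* An isolated edge has two maximal independent sets, and [2 = s ^+ 2] matches its two vertices:
     this is where the base [s] is sharp. Otherwise choosing [w] deletes a third vertex, and
     [(5/7)^2 + (5/7)^3 <= 1]. *)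
  have [w2|w2] := leqP #|cnb e V w| 2.
    have wE' : cnb e V w = [set v; w].
      apply/esym/eqP; rewrite eqEcard cards2 (eq_sym v) wv w2 andbT.
      by rewrite subUset !sub1set cI // !inE vV esy evw orbT.
    have half : (nmis e (V :\: [set v; w]))%:R <= bnd * (1 / 2).
      have XV : [set v; w] \subset V by rewrite -cE.
      have X2 : #|[set v; w]| = 2 by rewrite cards2 eq_sym wv.
      have V2 := subset_leq_card XV; rewrite X2 in V2.
      apply: (le_trans (IH _ q _ _ _)).
      - by rewrite cD // X2; move: Vk V2; clear; lia.
      - exact: triangle_freeS (subsetDl _ _) tV.
      - have nb x y : x \in [set v; w] -> y \in V -> e x y -> y \in [set v; w] /\ y != x.
          move=> xX yV exy; split; last by apply: contraTneq exy => ->; rewrite eirr.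
          move: xX; rewrite !inE => /orP[] /eqP xE; rewrite xE in exy.
            have : y \in cnb e V v by rewrite !inE yV exy orbT.
            by rewrite cE !inE.
          have : y \in cnb e V w by rewrite !inE yV exy orbT.
          by rewrite wE' !inE.
        apply: pack_del_isolated => // [x y z xX yV zV exy exz|x y xX yV exy].
          have [yX yx] := nb _ _ xX yV exy; have [zX zx] := nb _ _ xX zV exz.
          move: xX yX zX yx zx; rewrite !inE.
          by do 3 (case/orP => /eqP ->); rewrite ?eqxx.
        by have [] := nb _ _ xX yV exy.
      rewrite cD // X2 /bnd -[in leRHS](subnK V2) exprD s2.
      by rewrite le_eqVlt; apply/orP; left; apply/eqP; field.
    have := cov2 _ _ _ _ sub _ _; move=> /(_ (bnd * (1/2)) (bnd * (1/2))).
    rewrite -mulrDr (_ : 1 / 2 + 1 / 2 = 1 :> R) ?mulr1; last by field.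
    apply; apply: (le_trans _ half); rewrite ler_nat.
      by rewrite -cE; apply: in0.
    by rewrite -wE'; apply: in0.
  have h1 := step 2%N (cnb e V v) (cV _) _; have h2 := step 3%N (cnb e V w) (cV _) _.
  have := cov2 _ _ _ _ sub _ _ => /(_ (bnd * (5/7) ^+ 2) (bnd * (5/7)^+3)).
  move=> h; apply: (le_trans (h _ _)).
  - by apply: le_trans (h1 _); rewrite ?ler_nat ?in0 //; move: d1; clear; lia.
  - by apply: le_trans (h2 _); rewrite ?ler_nat ?in0 //; move: w2; clear; lia.
  rewrite -mulrDr -[leRHS]mulr1; apply: ler_wpM2l => //; lra.
(* Three branches deleting three vertices each would give [3 * (5/7)^3 > 1]. Triangle-freeness makes
   [u] and [w] non-adjacent, so the branch with [w] but without [u] deletes [u] as well, and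
   [2 * (5/7)^3 + (5/7)^4 <= 1]. *)
have [d3|d3] := leqP #|cnb e V v| 3.
  have [u [w [uw cE]]] : exists u w, u != w /\ cnb e V v :\ v = [set u; w].
    have /cards2P[u [w [uw uwE]]] : #|cnb e V v :\ v| == 2%N.
      by have := cardsD1 v (cnb e V v); rewrite cI //; lia.
    by exists u, w.
  have uc : u \in cnb e V v :\ v by rewrite cE !inE eqxx.
  have wc : w \in cnb e V v :\ v by rewrite cE !inE eqxx orbT.
  have [uv uV evu] : [/\ u != v, u \in V & e v u].
    by move: uc; rewrite !inE; case: eqP => //= _ /andP[].
  have [wv wV evw] : [/\ w != v, w \in V & e v w].
    by move: wc; rewrite !inE; case: eqP => //= _ /andP[].
  have nuw : ~~ e u w by apply/negP => euw; exact: (tV v u w).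
  have sub : [set I | mis e V I] \subset
     ([set I | mis e V I & v \in I] :|: [set I | mis e V I & u \in I]) :|:
     [set I | [&& mis e V I, w \in I & [disjoint I & [set u]]]].
    apply/subsetP => I; rewrite !inE => Im; rewrite Im /=.
    have [x xc xI] := mis_cnb Im vV.
    have [uI|uI] := boolP (u \in I); first by rewrite orbT.
    rewrite disjoint_sym disjoints1 uI andbT orbF.
    have : x \in v |: [set u; w] by rewrite -cE setD1K // cI.
    rewrite !inE => /orP[/eqP xv|/orP[/eqP xu|/eqP xw]].
    - by rewrite -xv xI.
    - by rewrite -xu xI in uI.
    - by rewrite -xw xI orbT.
  have h1 := step 3%N (cnb e V v) (cV _) _; have h2 := step 3%N (cnb e V u) (cV _) _.
  have X4 : (3 < #|cnb e V w :|: [set u]|)%N.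
    have -> : cnb e V w :|: [set u] = u |: cnb e V w by rewrite setUC.
    have un : u \notin cnb e V w by rewrite !inE uV negb_or uw esy.
    rewrite cardsU1 un; have := vmin _ wV; move: d2; clear; lia.
  have h3 := step 4%N (cnb e V w :|: [set u]) _ _.
  have c12 : (#|[set I | mis e V I & v \in I] :|: [set I | mis e V I & u \in I]|)%:R
     <= bnd * (5/7)^+3 + bnd * (5/7)^+3.
    apply: (@le_trans _ _ (#|[set I | mis e V I & v \in I]| + #|[set I | mis e V I & u \in I]|)%:R).
      by rewrite ler_nat leq_card_setU.
    rewrite natrD; apply: lerD.
      by apply: le_trans (h1 _); rewrite ?ler_nat ?in0 //; move: d2; clear; lia.
    by apply: le_trans (h2 _); rewrite ?ler_nat ?in0 //; have := vmin _ uV; move: d2; clear; lia.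
  apply: (le_trans (cov2 _ _ _ (bnd * (5/7)^+4) sub c12 _)).
    apply: le_trans (h3 _ _); first by rewrite ler_nat inb.
      by rewrite subUset cV sub1set.
    by move: X4; clear; lia.
  rewrite -!mulrDr -[leRHS]mulr1; apply: ler_wpM2l => //; lra.
(* With four points in the closed neighbourhood it suffices to branch on whether [v] is chosen:
   [5/7 + (5/7)^4 <= 1]. *)
have sub : [set I | mis e V I] \subset
   [set I | [&& mis e V I, set0 \subset I & [disjoint I & [set v]]]] :|:
   [set I | mis e V I & v \in I].
  apply/subsetP => I; rewrite !inE => Im; rewrite Im sub0set /=.
  by rewrite disjoint_sym disjoints1 orNb.
have h1 := step 1%N [set v] _ _; have h2 := step 4%N (cnb e V v) (cV _) _.
apply: (le_trans (cov2 _ _ (bnd * (5/7)^+1) (bnd * (5/7)^+4) sub _ _)).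
- apply: le_trans (h1 _ _); rewrite ?sub1set ?cards1 //.
  rewrite ler_nat; apply: (leq_trans (nmis_restrict _ _ (sub0set _))) => //.
  suff -> : nbhd e set0 = set0 by rewrite !set0U.
  by apply/setP => x; rewrite !inE; apply/negbTE/existsP => -[y]; rewrite inE.
- by apply: le_trans (h2 _); rewrite ?ler_nat ?in0 //; move: d3; clear; lia.
rewrite -mulrDr -[leRHS]mulr1; apply: ler_wpM2l => //; lra.
Qed.

End Pack.

(** * Regularity and triangle removal *)

Local Open Scope ring_scope.

Section Regularity.
Variables (R : realFieldType) (V J : finType) (f : J -> rel V) (eta : R).
Hypotheses (eta0 : 0 < eta).

Let N : R := #|V|%:R.

Definition edges j (U W : {set V}) : R := \sum_(x in U) \sum_(y in W) (f j x y)%:R.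

Lemma sum_affine (U W : {set V}) (F : V -> V -> R) (p q r : R) :
  \sum_(x in U) \sum_(y in W) (p - q * (F x y - r)) =
  p * (#|U|%:R * #|W|%:R) - q * (\sum_(x in U) \sum_(y in W) F x y - r * (#|U|%:R * #|W|%:R)).
Proof.
have cst (z : R) : \sum_(x in U) \sum_(y in W) z = z * (#|U|%:R * #|W|%:R).
  by rewrite !sumr_const -mulrnA -(mulr_natr z) natrM [X in z * X]mulrC.
rewrite -!cst -sumrB mulr_sumr -sumrB; apply: eq_bigr => x _.
by rewrite -sumrB mulr_sumr -sumrB.
Qed.

Let double_gain (p z : R) : 2 * (p * eta) * z = 2 * eta * (p * z).
Proof. by ring. Qed.

Let gain_bound (q z : R) : eta * q <= z -> eta ^+ 2 * q <= 2 * eta * z - eta ^+ 2 * q.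
Proof. by move=> /(ler_wpM2l (ltW eta0)); lra. Qed.

Section Step.
Variables (K : finType) (c : V -> K) (h : J -> K -> K -> R).

Definition cell a := [set x | c x == a].

(** Squared distance from the relations to step functions on the cells. As [h] is arbitrary rather
    than the cell average, a refinement only has to correct it by [eta] up or down. *)
Definition err : R := \sum_j \sum_x \sum_y ((f j x y)%:R - h j (c x) (c y)) ^+ 2.

(** The Boolean is the sign of the deviation; [eta] bounds from below both the relative sizes of the
    two subsets and the deviation. *)
Definition witness j a b (p : {set V} * {set V} * bool) :=
  [&& p.1.1 \subset cell a, p.1.2 \subset cell b,
      eta * #|cell a|%:R <= #|p.1.1|%:R, eta * #|cell b|%:R <= #|p.1.2|%:R
    & eta * (#|p.1.1|%:R * #|p.1.2|%:R) <=
      (-1) ^+ p.2 * (edges j p.1.1 p.1.2 - h j a b * (#|p.1.1|%:R * #|p.1.2|%:R))].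

Definition improvable j a b := [exists p, witness j a b p].

Definition mass : R := \sum_j \sum_a \sum_(b | improvable j a b) #|cell a|%:R * #|cell b|%:R.

Let sumc (F : V -> R) : \sum_x F x = \sum_a \sum_(x in cell a) F x.
Proof.
rewrite (partition_big c xpredT) //=; apply: eq_bigr => a _.
by apply: eq_bigl => x; rewrite inE.
Qed.

Lemma sum_cell (F : V -> V -> R) :
  \sum_x \sum_y F x y = \sum_a \sum_b \sum_(x in cell a) \sum_(y in cell b) F x y.
Proof.
rewrite sumc; apply: eq_bigr => a _.
by rewrite exchange_big sumc; apply: eq_bigr => b _; rewrite exchange_big.
Qed.

Let w j a b := odflt (set0, set0, false) [pick p | witness j a b p].

Let wP j a b : improvable j a b -> witness j a b (w j a b).
Proof.
by move=> /existsP[p pP]; rewrite /w; case: pickP => [//|/(_ p)]; rewrite pP.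
Qed.

Let wN j a b : ~~ improvable j a b -> w j a b = (set0, set0, false).
Proof.
by move=> /existsPn np; rewrite /w; case: pickP => [p|//]; rewrite (negbTE (np p)).
Qed.

Let wsub j a b : (w j a b).1.1 \subset cell a /\ (w j a b).1.2 \subset cell b.
Proof.
have [/wP/and5P[-> ->]//|/wN ->] := boolP (improvable j a b).
by rewrite !sub0set.
Qed.

Let tau j a b : R := (-1) ^+ (w j a b).2 * eta.

(** Adding [eta] with the right sign on a witness of size [u * v] lowers the squared error by at
    least [eta^2 u v], hence by [eta^4] times the size of the pair of cells; in total by
    [eta^4 * mass]. The new cells record for each [(j, a, b)] whether a point lies in the row set
    and whether it lies in the column set of the witness, which explains the 4. *)
Lemma regularity_step : eta * N ^+ 2 <= mass ->
  exists (K' : finType) (c' : V -> K') (h' : J -> K' -> K' -> R),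
    #|K'| = (#|K| * 4 ^ (#|J| * #|K| * #|K|))%N /\
    \sum_j \sum_x \sum_y ((f j x y)%:R - h' j (c' x) (c' y)) ^+ 2
      <= err - eta ^+ 5 * N ^+ 2.
Proof.
move=> hm.
pose K' : finType := (K * {ffun J * K * K -> bool * bool})%type.
pose c' x : K' := (c x, [ffun t => (x \in (w t.1.1 t.1.2 t.2).1.1,
                                    x \in (w t.1.1 t.1.2 t.2).1.2)]).
pose h' j (a b : K') : R := h j a.1 b.1 +
  (if (a.2 (j, a.1, b.1)).1 && (b.2 (j, a.1, b.1)).2 then tau j a.1 b.1 else 0).
exists K', c', h'; split.
  by rewrite card_prod card_ffun !card_prod card_bool.
have cellE j : \sum_x \sum_y ((f j x y)%:R - h' j (c' x) (c' y)) ^+ 2 =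
    \sum_x \sum_y ((f j x y)%:R - h j (c x) (c y)) ^+ 2 +
    \sum_a \sum_b \sum_(x in (w j a b).1.1) \sum_(y in (w j a b).1.2)
      (eta ^+ 2 - 2 * tau j a b * ((f j x y)%:R - h j a b)).
  rewrite !sum_cell -big_split; apply: eq_bigr => a _ /=.
  rewrite -big_split; apply: eq_bigr => b _ /=.
  have [Us Ws] := wsub j a b.
  rewrite [X in _ + X](_ : _ = \sum_(x in cell a) \sum_(y in cell b)
     (if (x \in (w j a b).1.1) && (y \in (w j a b).1.2) then
      (eta ^+ 2 - 2 * tau j a b * ((f j x y)%:R - h j a b)) else 0)); last first.
    rewrite [RHS](big_setID (w j a b).1.1) /= (setIidPr Us).
    rewrite [X in _ = _ + X]big1 ?addr0; last first.
      by move=> x; rewrite inE => /andP[/negbTE -> _]; rewrite big1.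
    apply: eq_bigr => x ->; rewrite [RHS](big_setID (w j a b).1.2) /= (setIidPr Ws).
    rewrite [X in _ = _ + X]big1 ?addr0; last first.
      by move=> y; rewrite inE => /andP[/negbTE -> _].
    by apply: eq_bigr => y ->.
  rewrite -big_split; apply: eq_bigr => x /=; rewrite inE => /eqP xa.
  rewrite -big_split; apply: eq_bigr => y /=; rewrite inE => /eqP yb.
  rewrite /h' /c' /= !ffunE /= xa yb; case: ifP => _; last by rewrite !addr0.
  have t2 : tau j a b ^+ 2 = eta ^+ 2.
    by rewrite /tau exprMn sqrr_sign mul1r.
  by rewrite -t2; ring.
rewrite (eq_bigr _ (fun j _ => cellE j)) big_split /= lerD2l.
rewrite -[leLHS]opprK lerN2 -sumrN.
apply: (@le_trans _ _ (eta ^+ 4 * mass)).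
  by rewrite exprSr -mulrA; apply: ler_wpM2l => //; apply/exprn_ge0/ltW.
rewrite /mass mulr_sumr; apply: ler_sum => j _.
rewrite mulr_sumr -sumrN; apply: ler_sum => a _.
rewrite mulr_sumr -sumrN big_mkcond /=; apply: ler_sum => b _.
have sumE : - (\sum_(x in (w j a b).1.1) \sum_(y in (w j a b).1.2)
      (eta ^+ 2 - 2 * tau j a b * ((f j x y)%:R - h j a b))) =
   2 * tau j a b * (edges j (w j a b).1.1 (w j a b).1.2
      - h j a b * (#|(w j a b).1.1|%:R * #|(w j a b).1.2|%:R))
   - eta ^+ 2 * (#|(w j a b).1.1|%:R * #|(w j a b).1.2|%:R).
  by rewrite sum_affine -/(edges j _ _); ring.
rewrite sumE; case: ifP => [/wP/and5P[_ _ cU cW hw]|/negbT/wN ->]; last first.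
  by rewrite !cards0 /edges big_set0 /= !(mulr0, mul0r, subr0).
set u : R := #|(w j a b).1.1|%:R in sumE cU hw *.
set v : R := #|(w j a b).1.2|%:R in sumE cW hw *.
have -> : 2 * tau j a b * (edges j (w j a b).1.1 (w j a b).1.2 - h j a b * (u * v)) =
  2 * eta * ((-1) ^+ (w j a b).2 * (edges j (w j a b).1.1 (w j a b).1.2 - h j a b * (u * v))).
  exact: double_gain.
apply: (@le_trans _ _ (eta ^+ 2 * (u * v))).
  have -> : eta ^+ 4 * (#|cell a|%:R * #|cell b|%:R) =
    eta ^+ 2 * ((eta * #|cell a|%:R) * (eta * #|cell b|%:R)) by ring.
  apply: ler_wpM2l; first exact/exprn_ge0/ltW.
  by apply: ler_pM => //; apply: mulr_ge0 => //; apply: ltW.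
exact: gain_bound hw.
Qed.

End Step.

Fixpoint tower (j k t : nat) := if t is t'.+1 then
  tower j (k * 4 ^ (j * k * k))%N t' else k.

Lemma tower_ge j k t : (k <= tower j k t)%N.
Proof.
elim: t k => //= t IH k; apply: leq_trans (IH _).
by rewrite leq_pmulr // expn_gt0.
Qed.

(** The error is non-negative and each refinement lowers it by [eta^5 N^2], so the process stops
    within [t] rounds. *)
Lemma regularity (K : finType) (c : V -> K) (h : J -> K -> K -> R) t :
  (0 < #|V|)%N -> err c h <= t%:R * (eta ^+ 5 * N ^+ 2) ->
  exists (K' : finType) (c' : V -> K') (h' : J -> K' -> K' -> R),
    (#|K'| <= tower #|J| #|K| t)%N /\ mass c' h' < eta * N ^+ 2.
Proof.
move=> V0; have N0 : 0 < N by rewrite ltr0n.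
have err0 (K0 : finType) (c0 : V -> K0) h0 : 0 <= err c0 h0.
  by do 3 (apply: sumr_ge0 => ? _); apply: sqr_ge0.
elim: t K c h => [|t IH] K c h he.
  have [lt|ge] := ltP (mass c h) (eta * N ^+ 2); first by exists K, c, h.
  have [K' [c' [h' [_ he']]]] := regularity_step ge.
  have := err0 _ c' h'; rewrite /err => h0.
  have : 0 < eta ^+ 5 * N ^+ 2 by rewrite mulr_gt0 ?exprn_gt0.
  by move: he he' h0; rewrite mul0r; lra.
have [lt|ge] := ltP (mass c h) (eta * N ^+ 2).
  by exists K, c, h; split => //; apply: tower_ge.
have [K' [c' [h' [kE he']]]] := regularity_step ge.
have [|K2 [c2 [h2 [k2 m2]]]] := IH _ c' h'.
  by move: he he'; rewrite -natr1 mulrDl mul1r /err; lra.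
by exists K2, c2, h2; split => //; apply: (leq_trans k2); rewrite kE.
Qed.

End Regularity.

Section Counting.
Variables (R : realFieldType) (V J : finType) (f : J -> rel V) (eta : R).
Hypotheses (eta0 : 0 < eta) (eta4 : eta <= 1 / 4).
Variables (K : finType) (c : V -> K) (h : J -> K -> K -> R).

Let N : R := #|V|%:R.
Let k : R := #|K|%:R.

Definition kept j a b := [&& eta * N <= k * #|cell c a|%:R, eta * N <= k * #|cell c b|%:R,
  ~~ improvable f eta c h j a b &
  3 * eta * (#|cell c a|%:R * #|cell c b|%:R) <= edges R f j (cell c a) (cell c b)].

(** Since [h] is not the density, regularity is used twice: on the whole cells, where density
    [3 * eta] gives [h >= 2 * eta], and then on [U] and [W], where this gives density [eta]. *)
Lemma kept_dense j a b (U W : {set V}) : (0 < #|V|)%N -> kept j a b ->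
  U \subset cell c a -> W \subset cell c b ->
  eta * #|cell c a|%:R <= #|U|%:R -> eta * #|cell c b|%:R <= #|W|%:R ->
  eta * (#|U|%:R * #|W|%:R) <= edges R f j U W.
Proof.
move=> V0 /and4P[la lb ni dab] Us Ws hU hW.
have N0 : 0 < N by rewrite ltr0n.
have cell0 a' : eta * N <= k * #|cell c a'|%:R -> 0 < #|cell c a'|%:R :> R.
  rewrite lt0r ler0n andbT; move=> hl; apply/eqP => z; move: hl; rewrite z mulr0.
  by apply/negP; rewrite -ltNge mulr_gt0.
have a0 := cell0 _ la; have b0 := cell0 _ lb.
have nw p : witness f eta c h j a b p = false.
  by apply/negbTE; apply: contra ni => pp; apply/existsP; exists p.
have := nw (cell c a, cell c b, false); have := nw (U, W, true).
rewrite /witness /= !subxx Us Ws hU hW /= expr1 mulN1r expr0 mul1r.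
have e1 (x : R) : 0 < x -> eta * x <= x by move=> x0; apply: ler_piMl; [exact: ltW | apply: le_trans eta4 _; lra].
rewrite !e1 //= => /negbT; rewrite -ltNge => h1 /negbT; rewrite -ltNge => h2.
have ab0 : 0 < #|cell c a|%:R * #|cell c b|%:R :> R by rewrite mulr_gt0.
have uw0 : 0 <= #|U|%:R * #|W|%:R :> R by rewrite mulr_ge0.
have h2eta : 2 * eta <= h j a b.
  rewrite leNgt; apply/negP => hl.
  have {}hl : h j a b * (#|cell c a|%:R * #|cell c b|%:R) < 2 * eta * (#|cell c a|%:R * #|cell c b|%:R).
    by rewrite ltr_pM2r.
  by move: hl h2 dab; lra.
have := ler_wpM2r uw0 h2eta.
by move: h1; lra.
Qed.

(** Small left cells, small right cells and irregular pairs account for [eta N^2] each, sparse pairs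
    for [3 * eta N^2]. *)
Lemma removed_bound j : (0 < #|V|)%N -> mass f eta c h < eta * N ^+ 2 ->
  \sum_x \sum_y (f j x y && ~~ kept j (c x) (c y))%:R <= 6 * eta * N ^+ 2.
Proof.
move=> V0 hm; have N0 : 0 < N by rewrite ltr0n.
have k0 : 0 < k.
  by have /card_gt0P[x _] := V0; rewrite ltr0n; apply/card_gt0P; exists (c x).
pose sm a := k * #|cell c a|%:R < eta * N.
have cellN : \sum_a #|cell c a|%:R = N.
  have := sum_cell c (fun x y : V => (x == y)%:R : R) => _.
  rewrite /N -sum1_card natr_sum (partition_big c xpredT) //=.
  apply: eq_bigr => a _; rewrite -sum1_card natr_sum.
  by apply: eq_bigl => x; rewrite inE.
have cell2 : \sum_a \sum_b #|cell c a|%:R * #|cell c b|%:R = N ^+ 2.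
  by under eq_bigr do rewrite -mulr_sumr cellN; rewrite -mulr_suml cellN expr2.
have small : \sum_(a | sm a) #|cell c a|%:R <= eta * N.
  apply: (@le_trans _ _ (\sum_(a : K) eta * N / k)).
    rewrite big_mkcond /=; apply: ler_sum => a _; case: ifP => [|_].
      by rewrite /sm => /ltW; rewrite ler_pdivlMr // mulrC.
    by apply: divr_ge0; [apply: mulr_ge0; apply: ltW | apply: ltW].
  by rewrite sumr_const -(mulr_natr (eta * N / k)) -/k divfK ?lt0r_neq0.
have const (A B : {set V}) (z : R) :
    \sum_(x in A) \sum_(y in B) z = #|A|%:R * #|B|%:R * z.
  by rewrite !sumr_const -mulrnA -(mulr_natr z) natrM mulrC (mulrC #|B|%:R).
apply: (@le_trans _ _ (\sum_a \sum_b ((if sm a then #|cell c a|%:R * #|cell c b|%:R else 0)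
   + (if sm b then #|cell c a|%:R * #|cell c b|%:R else 0)
   + (if improvable f eta c h j a b then #|cell c a|%:R * #|cell c b|%:R else 0)
   + 3 * eta * (#|cell c a|%:R * #|cell c b|%:R)))).
  rewrite (sum_cell c); apply: ler_sum => a _; apply: ler_sum => b _.
  set ab := #|cell c a|%:R * _; have ab0 : 0 <= ab by rewrite mulr_ge0.
  have eab0 : 0 <= 3 * eta * ab by rewrite !mulr_ge0 // ltW.
  have if0 (bb : bool) : 0 <= (if bb then ab else 0) by case: bb.
  rewrite (eq_bigr (fun x => \sum_(y in cell c b) (f j x y && ~~ kept j a b)%:R)); last first.
    move=> x; rewrite inE => /eqP xa; apply: eq_bigr => y; rewrite inE => /eqP yb.
    by rewrite xa yb.
  have triv : \sum_(x in cell c a) \sum_(y in cell c b) (f j x y && ~~ kept j a b)%:R <= ab.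
    rewrite -[ab]mulr1 -const; apply: ler_sum => x _; apply: ler_sum => y _.
    by rewrite lern1 leq_b1.
  have [sa|sa] := boolP (sm a).
    by have := if0 (sm b); have := if0 (improvable f eta c h j a b); move: triv eab0; lra.
  have [sb|sb] := boolP (sm b).
    by have := if0 (improvable f eta c h j a b); move: triv eab0; lra.
  have [im|im] := boolP (improvable _ _ _ _ _ _ _); first by move: triv eab0; lra.
  rewrite !add0r; have [kp|nk] := boolP (kept j a b).
    by rewrite big1 // => x _; rewrite big1 // => y _; rewrite andbF.
  have := nk; rewrite {1}/kept im [eta * N <= _]leNgt -/(sm a) sa [eta * N <= _]leNgt -/(sm b) sb /=.
  rewrite -ltNge => /ltW; apply: le_trans.
  by apply: ler_sum => x _; apply: ler_sum => y _; rewrite andbT.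
do 3 (under eq_bigr do rewrite big_split /=; rewrite big_split /=).
have s1 : \sum_a \sum_b (if sm a then #|cell c a|%:R * #|cell c b|%:R else 0) <= eta * N ^+ 2.
  rewrite (eq_bigr (fun a => if sm a then #|cell c a|%:R * N else 0)); last first.
    by move=> a _; case: ifP => _; [rewrite -mulr_sumr cellN | rewrite big1].
  by rewrite -big_mkcond -mulr_suml expr2 mulrA ler_wpM2r // ltW.
have s2 : \sum_a \sum_b (if sm b then #|cell c a|%:R * #|cell c b|%:R else 0) <= eta * N ^+ 2.
  rewrite exchange_big /= (eq_bigr (fun a => if sm a then N * #|cell c a|%:R else 0)); last first.
    by move=> a _; case: ifP => _; [rewrite -mulr_suml cellN | rewrite big1].
  by rewrite -big_mkcond -mulr_sumr expr2 mulrCA ler_wpM2l // ltW.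
have s3 : \sum_a \sum_b (if improvable f eta c h j a b then #|cell c a|%:R * #|cell c b|%:R else 0) <= eta * N ^+ 2.
  apply: le_trans (ltW hm); rewrite /mass (bigD1 j) //=.
  rewrite (eq_bigr (fun a => \sum_(b | improvable f eta c h j a b) #|cell c a|%:R * #|cell c b|%:R)); last first.
    by move=> a _; rewrite [RHS]big_mkcond.
  rewrite lerDl; apply: sumr_ge0 => ? _; apply: sumr_ge0 => ? _; apply: sumr_ge0 => ? _.
  exact: mulr_ge0.
have s4 : \sum_a \sum_b 3 * eta * (#|cell c a|%:R * #|cell c b|%:R) = 3 * eta * N ^+ 2.
  by rewrite -cell2 mulr_sumr; apply: eq_bigr => a _; rewrite mulr_sumr.
rewrite s4; move: s1 s2 s3; clear; move: (\sum_a _) (\sum_a _) (\sum_a _) => x y z; lra.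
Qed.

End Counting.

(** * The triangle removal lemma *)

Section TriangleRemoval.
Variable R : archiRealFieldType.

Definition triangle_sum (V : finType) (f0 f1 f2 : rel V) : R :=
  \sum_x \sum_y \sum_z ([&& f0 x y, f1 y z & f2 x z])%:R.

Definition three_rels (V : finType) (f0 f1 f2 : rel V) (j : 'I_3) : rel V :=
  if j == 0%N :> nat then f0 else if j == 1%N :> nat then f1 else f2.

(** As in a tripartite graph on three copies of [V], the three sides of a triangle have their own
    relations, and what is removed may depend on the side. *)
Theorem triangle_removal (eps : R) : 0 < eps -> exists2 delta : R, 0 < delta &
  forall (V : finType) (f0 f1 f2 : rel V),
    triangle_sum f0 f1 f2 < delta * #|V|%:R ^+ 3 ->
  exists g : 'I_3 -> rel V,
    [/\ forall j x y, g j x y -> three_rels f0 f1 f2 j x y,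
        forall x y z, g (inord 0) x y -> g (inord 1) y z -> g (inord 2) x z -> False
      & forall j, \sum_x \sum_y (three_rels f0 f1 f2 j x y && ~~ g j x y)%:R
          <= eps * #|V|%:R ^+ 2].
Proof.
move=> eps0; pose eta : R := Num.min (eps / 6) (1 / 4).
have eta0 : 0 < eta by rewrite lt_min; apply/andP; split; lra.
have eta4 : eta <= 1 / 4 by rewrite ge_min lexx orbT.
have etae : 6 * eta <= eps.
  have : eta <= eps / 6 by rewrite ge_min lexx.
  by lra.
pose t := Num.bound (3 / eta ^+ 5).
have ht : 3 <= t%:R * eta ^+ 5.
  rewrite -ler_pdivrMr ?exprn_gt0 //; apply/ltW/archi_boundP.
  by apply: divr_ge0 => //; apply/exprn_ge0/ltW.
pose k0 : R := (tower 3 1 t)%:R.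
have k00 : 0 < k0 by rewrite ltr0n tower_ge.
(* One surviving triangle, in cells [a], [b], [d], forces [eta^3 |b| |d|] triangles at each of at
   least half the points of [a], and each of the three cells has at least [eta N / k0] points. *)
exists (1 / 2 * (eta ^+ 6 / k0 ^+ 3)).
  by rewrite mulr_gt0 ?divr_gt0 ?exprn_gt0.
move=> V f0 f1 f2 htri; set f := three_rels f0 f1 f2.
have V0 : (0 < #|V|)%N.
  rewrite lt0n; apply: contraTneq htri => ->; rewrite expr0n mulr0 -leNgt.
  by do 3 (apply: sumr_ge0 => ? _).
set N : R := #|V|%:R in htri *; have N0 : 0 < N by rewrite ltr0n.
have [|K [c [h [Kk hm]]]] := @regularity R V _ f eta eta0 unit (fun=> tt) (fun _ _ _ => 0) t V0.
  rewrite /err mulrA.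
  apply: (@le_trans _ _ (3 * N ^+ 2)); last first.
    by apply: ler_wpM2r => //; apply/exprn_ge0/ltW.
  apply: (@le_trans _ _ (\sum_(j : 'I_3) \sum_(x : V) \sum_(y : V) 1)).
    do 3 (apply: ler_sum => ? _); rewrite subr0.
    by case: f; rewrite ?expr1n ?expr0n.
  rewrite (eq_bigr (fun=> N ^+ 2)); last first.
    move=> j _; rewrite (eq_bigr (fun=> N)); last by move=> x _; rewrite sumr_const.
    by rewrite sumr_const -(mulr_natr N) expr2.
  by rewrite sumr_const card_ord -(mulr_natr (N ^+ 2)) mulrC.
pose g j x y := f j x y && kept f eta c h j (c x) (c y).
exists g; split.
- by move=> j x y /andP[].
- move=> x y z /andP[_ k1] /andP[_ k2] /andP[_ k3].
  set a := c x in k1 k3; set b := c y in k1 k2; set d := c z in k2 k3.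
  have fE : [/\ f (inord 0) = f0, f (inord 1) = f1 & f (inord 2) = f2].
    by split; rewrite /f /three_rels inordK.
  case: fE => e0 e1 e2.
  pose d0 x' : R := \sum_(y' in cell c b) (f0 x' y')%:R.
  pose d2 x' : R := \sum_(z' in cell c d) (f2 x' z')%:R.
  pose U0 := [set x' in cell c a | d0 x' < eta * #|cell c b|%:R].
  pose U2 := [set x' in cell c a | d2 x' < eta * #|cell c d|%:R].
  have eb (C : {set V}) : eta * #|C|%:R <= #|C|%:R.
    by apply: ler_piMl => //; apply: le_trans eta4 _; lra.
  have K0 : 0 < #|K|%:R :> R by rewrite ltr0n; apply/card_gt0P; exists a.
  have cell0 a' : eta * N <= #|K|%:R * #|cell c a'|%:R -> eta * N / k0 <= #|cell c a'|%:R.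
    move=> hl; rewrite ler_pdivrMr //; apply: (le_trans hl); rewrite mulrC.
    by apply: ler_wpM2l => //; rewrite ler_nat; move: Kk; rewrite card_ord card_unit.
  have [la lb ld] : [/\ eta * N / k0 <= #|cell c a|%:R, eta * N / k0 <= #|cell c b|%:R
       & eta * N / k0 <= #|cell c d|%:R].
    move: k1 k3 => /and4P[/cell0 ? /cell0 ? _ _] /and4P[_ /cell0 ? _ _].
    by split.
  have q0 : 0 < eta * N / k0 by rewrite divr_gt0 ?mulr_gt0.
  have small (j : 'I_3) (b' : K) (U : {set V}) : kept f eta c h j a b' -> U \subset cell c a ->
      0 < #|cell c b'|%:R :> R ->
      (forall x', x' \in U -> \sum_(y' in cell c b') (f j x' y')%:R < eta * #|cell c b'|%:R) ->
      #|U|%:R < eta * #|cell c a|%:R.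
    move=> kp Us b0 hU; rewrite ltNge; apply/negP => big.
    have U0' : (0 < #|U|)%N.
      rewrite -(ltr0n R); apply: lt_le_trans big; apply: mulr_gt0 => //.
      exact: lt_le_trans la.
    have := kept_dense eta0 eta4 V0 kp Us (subxx _) big (eb _).
    apply/negP; rewrite -ltNge /edges.
    apply: (@lt_le_trans _ _ (\sum_(x' in U) eta * #|cell c b'|%:R)).
      have /card_gt0P[u uU] := U0'.
      rewrite (bigD1 u) //= [ltRHS](bigD1 u) //=; apply: ltr_leD; first exact: hU.
      by apply: ler_sum => x' /andP[x'U _]; apply/ltW/hU.
    by rewrite sumr_const -(mulr_natr (eta * _)) -mulrA [#|U|%:R * _]mulrC.
  have s0 : #|U0|%:R < eta * #|cell c a|%:R.
    apply: (small _ _ _ k1).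
    - by apply/subsetP => x'; rewrite inE => /andP[].
    - exact: lt_le_trans lb.
    - by move=> x'; rewrite inE e0 => /andP[].
  have s2 : #|U2|%:R < eta * #|cell c a|%:R.
    apply: (small _ _ _ k3).
    - by apply/subsetP => x'; rewrite inE => /andP[].
    - exact: lt_le_trans ld.
    - by move=> x'; rewrite inE e2 => /andP[].
  pose G := cell c a :\: (U0 :|: U2).
  have Gbig : 1 / 2 * #|cell c a|%:R <= #|G|%:R :> R.
    have : (#|cell c a| <= #|G| + #|U0| + #|U2|)%N.
      have := (leq_card_setU U0 U2).1; have := cardsID (U0 :|: U2) (cell c a).
      have := subset_leq_card (subsetIr (cell c a) (U0 :|: U2)).
      by rewrite -/G; clear; lia.
    rewrite -(ler_nat R) !natrD => hG.
    have e4 := ler_wpM2r (ler0n R #|cell c a|) eta4.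
    by move: hG s0 s2 e4; lra.
  have tG x' : x' \in G -> eta ^+ 3 * (#|cell c b|%:R * #|cell c d|%:R) <=
      \sum_y' \sum_z' ([&& f0 x' y', f1 y' z' & f2 x' z'])%:R.
    rewrite !inE => /andP[nU xa]; move: nU; rewrite xa /= negb_or -!leNgt => /andP[h0 h2].
    pose B := [set y' in cell c b | f0 x' y']; pose D := [set z' in cell c d | f2 x' z'].
    have cB : #|B|%:R = d0 x'.
      rewrite /d0 -sum1_card natr_sum big_mkcond [RHS]big_mkcond; apply: eq_bigr => y' _ /=.
      by rewrite !inE; case: (c y' == b); case: (f0 _ _).
    have cD : #|D|%:R = d2 x'.
      rewrite /d2 -sum1_card natr_sum big_mkcond [RHS]big_mkcond; apply: eq_bigr => y' _ /=.
      by rewrite !inE; case: (c y' == d); case: (f2 _ _).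
    have := @kept_dense _ _ _ f eta eta0 eta4 K c h (inord 1) b d B D V0 k2.
    rewrite cB cD => /(_ _ _ h0 h2) hk.
    apply: (@le_trans _ _ (eta * (d0 x' * d2 x'))).
      have -> : eta ^+ 3 * (#|cell c b|%:R * #|cell c d|%:R) =
        eta * ((eta * #|cell c b|%:R) * (eta * #|cell c d|%:R)) by ring.
      apply: ler_wpM2l; first exact: ltW.
      by apply: ler_pM => //; apply: mulr_ge0 => //; apply: ltW.
    apply: (le_trans (hk _ _)); try by apply/subsetP => ?; rewrite inE => /andP[].
    rewrite /edges. rewrite e1 [leLHS]big_mkcond; apply: ler_sum => y' _.
    case: ifP => [|_]; last exact: sumr_ge0.
    rewrite inE => /andP[_ fy]; rewrite big_mkcond; apply: ler_sum => z' _.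
    by case: ifP => // ; rewrite inE => /andP[_ ->]; rewrite fy andbT.
  have : triangle_sum f0 f1 f2 >= 1 / 2 * (eta * N / k0) * (eta ^+ 3 * (eta * N / k0 * (eta * N / k0))).
    apply: (@le_trans _ _ (\sum_(x' in G) eta ^+ 3 * (#|cell c b|%:R * #|cell c d|%:R))).
      rewrite sumr_const -(mulr_natr (eta ^+ 3 * _)) mulrC.
      have e30 : 0 <= eta ^+ 3 by apply/exprn_ge0/ltW.
      apply: ler_pM.
      - by apply: mulr_ge0 => //; apply: mulr_ge0; apply: ltW.
      - by apply: mulr_ge0; [lra | apply: ltW].
      - by apply: ler_wpM2l => //; apply: ler_pM => //; apply: ltW.
      - by apply: le_trans Gbig; apply: ler_wpM2l => //; lra.
    rewrite /triangle_sum big_mkcond /=; apply: ler_sum => x' _; case: ifP => [/tG //|_].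
    by do 2 (apply: sumr_ge0 => ? _).
  apply/negP; rewrite -ltNge; apply: (lt_le_trans htri); rewrite le_eqVlt.
  by apply/orP; left; apply/eqP; field; rewrite lt0r_neq0.
- move=> j; apply: (@le_trans _ _ (6 * eta * N ^+ 2)).
    apply: le_trans (removed_bound eta0 j V0 hm).
    do 2 (apply: ler_sum => ? _); rewrite /g.
    by case: (f j _ _).
  by apply: ler_wpM2r => //; apply/exprn_ge0/ltW.
Qed.

End TriangleRemoval.

Local Close Scope ring_scope.

(** * Sum-free sets and Schur triples *)

Section SumFree.
Variable n : nat.
Implicit Types (S C A M : {set 'I_n.+1}).

Lemma sum_freeP S : reflect
  (forall x y z : 'I_n.+1, x \in S -> y \in S -> z \in S -> x + y <> z :> nat) (sum_free S).
Proof.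
apply: (iffP 'forall_implyP) => [h x y z xS yS zS|h x xS].
  move/'forall_implyP: (h x xS) => /(_ y yS) /'forall_implyP /(_ z zS).
  by rewrite /schur_triple => /eqP.
apply/'forall_implyP => y yS; apply/'forall_implyP => z zS.
by apply/eqP; apply: h.
Qed.

Lemma sum_freeS S C : S \subset C -> sum_free C -> sum_free S.
Proof.
move=> /subsetP sub /sum_freeP sC; apply/sum_freeP => x y z /sub xC /sub yC /sub zC.
exact: sC.
Qed.

Lemma sum_free_interval S : sum_free S -> S \subset interval1 n.
Proof.
move=> /sum_freeP sS; apply/subsetP => x xS; rewrite inE lt0n.
by apply/eqP => x0; apply: (sS x x x) => //; rewrite x0.
Qed.

Definition schur C := [set t : 'I_n.+1 * 'I_n.+1 * 'I_n.+1 |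
  [&& t.1.1 \in C, t.1.2 \in C, t.2 \in C & t.1.1 + t.1.2 == t.2]].

End SumFree.

(** * Small sets and subexponential factors *)

Section SmallSubsets.
Variable T : finType.

Definition small_sets k := [set S : {set T} | #|S| <= k].

Local Open Scope ring_scope.
Variable R : realFieldType.

Lemma sum_subsets (l : R) (A : {set T}) :
  \sum_(S in powerset A) l ^+ #|S| = (1 + l) ^+ #|A|.
Proof.
have := bigA_distr (1 : R) +%R (fun i => if i \in A then l else 0) (fun=> 1).
have -> : \prod_i ((if i \in A then l else 0) + 1) = (1 + l) ^+ #|A|.
  rewrite -prodr_const [RHS]big_mkcond /=; apply: eq_bigr => i _.
  by case: (i \in A); rewrite ?add0r // addrC.
move=> ->; rewrite [LHS]big_mkcond /=; apply: eq_bigr => S _.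
rewrite inE; case: ifP => [SA|/negbT nSA].
  rewrite -big_mkcond /= -prodr_const; apply: eq_bigr => i iS.
  by rewrite (subsetP SA).
case/subsetPn: nSA => i iS iA.
by rewrite (bigD1 i) //= iS (negbTE iA) mul0r.
Qed.

(** A set of size at most [k] contributes at least [l ^+ k] to the sum of [l ^+ #|S|] over all
    sets. *)
Lemma small_sets_weight (l : R) k : 0 < l <= 1 ->
  #|small_sets k|%:R * l ^+ k <= (1 + l) ^+ #|T|.
Proof.
move=> /andP[l0 l1]; rewrite -cardsT -sum_subsets mulr_natl -sumr_const.
rewrite big_mkcond [leRHS]big_mkcond; apply: ler_sum => S _.
rewrite inE powersetE subsetT; case: ifP => [Sk|_]; last exact/exprn_ge0/ltW.
by apply: ler_wiXn2l => //; apply: ltW.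
Qed.

End SmallSubsets.

Section Asymptotics.
Variable R : archiRealFieldType.
Local Open Scope ring_scope.

Lemma bernoulli (e : R) k : 0 <= e -> 1 + k%:R * e <= (1 + e) ^+ k.
Proof.
move=> e0; elim: k => [|k IH]; first by rewrite mul0r addr0 expr0.
rewrite exprSr -natr1; have e1 : 0 <= 1 + e by lra.
apply: (le_trans _ (ler_wpM2r e1 IH)); rewrite mulrDl mul1r.
have : 0 <= k%:R * e * e by rewrite !mulr_ge0.
by move: (k%:R) => z; lra.
Qed.

Lemma expr_unbounded (u x : R) : 1 < u -> exists2 q, (0 < q)%N & x <= u ^+ q.
Proof.
move=> u1; have e0 : 0 < u - 1 by rewrite subr_gt0.
pose q := (Num.bound (`|x| / (u - 1))).+1; exists q => //.
have : `|x| / (u - 1) < q%:R.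
  apply: (lt_le_trans (archi_boundP _)); last by rewrite ler_nat.
  by apply: divr_ge0 => //; apply: ltW.
rewrite ltr_pdivrMr // => hx; have := bernoulli q (ltW e0).
rewrite [1 + (u - 1)]addrC subrK; apply: le_trans.
by apply: (le_trans (ler_norm x)); move: hx; lra.
Qed.

Lemma expr_small (t e : R) : 0 <= t < 1 -> 0 < e -> exists q, t ^+ q <= e.
Proof.
move=> /andP[t0 t1] e0; have [->|tn] := eqVneq t 0.
  by exists 1%N; rewrite expr1 ltW.
have tp : 0 < t by rewrite lt0r tn.
have u1 : 1 < t^-1 by rewrite invf_gt1.
have [q _ hq] := expr_unbounded e^-1 u1; exists q.
by move: hq; rewrite exprVn lef_pV2 // posrE exprn_gt0.
Qed.

(** An archimedean field need not contain roots; iterated approximate square roots, from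
    [(1 + l)^2 <= 1 + 3 l], reach an exponent [2 ^ i >= j]. *)
Lemma expr_root (u : R) j : 1 < u -> exists2 v, 1 < v & v ^+ j <= u.
Proof.
move=> u1; have [i hi] : exists i, (j <= 2 ^ i)%N by exists j; apply/ltnW/ltn_expl.
suff [v v1 hv] : exists2 v : R, 1 < v & v ^+ (2 ^ i) <= u.
  by exists v => //; apply: le_trans hv; apply: ler_weXn2l => //; apply: ltW.
elim: i {hi} => [|i [v v1 hv]]; first by exists u.
pose l : R := Num.min 1 ((v - 1) / 3).
have l0 : 0 < l by rewrite lt_min ltr01 /=; lra.
have l1 : l <= 1 by rewrite ge_min lexx.
have l3 : l <= (v - 1) / 3 by rewrite ge_min lexx orbT.
exists (1 + l); first by lra.
rewrite expnS exprM; apply: le_trans hv.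
have l2 : l * l <= l by apply: ler_piMl => //; apply: ltW.
apply: lerXn2r; rewrite ?nnegrE ?sqr_ge0 //; first by lra.
by rewrite expr2; lra.
Qed.

Lemma nat_le_expr (u : R) : 1 < u -> exists n0, forall n, (n0 <= n)%N -> n%:R <= u ^+ n.
Proof.
move=> u1; have [v v1 hv] := expr_root 2 u1.
have [q q0 hq] := expr_unbounded (v - 1)^-1 v1.
have e0 : 0 < v - 1 by rewrite subr_gt0.
exists q => n qn; have := bernoulli n (ltW e0).
rewrite [1 + (v - 1)]addrC subrK => hb.
apply: (@le_trans _ _ (v ^+ n * v ^+ n)); last first.
  by rewrite -exprMn -expr2; apply: lerXn2r; rewrite ?nnegrE ?exprn_ge0 //; lra.
have h1 : (v - 1)^-1 <= v ^+ n by apply: (le_trans hq); apply: ler_weXn2l => //; apply: ltW.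
have h2 : n%:R * (v - 1) <= v ^+ n by move: hb; lra.
apply: (le_trans _ (ler_pM _ _ h2 h1)).
- by rewrite mulfK // lt0r_neq0.
- by apply: mulr_ge0 => //; apply: ltW.
- by rewrite invr_ge0 ltW.
Qed.

(** In the bound [(1 + l)^|T| / l^k] both factors are at most [v^|T|]: the first by the choice of
    [l], the second since [1 / l <= v^q] and [k q <= |T|]. *)
Lemma small_sets_bound (u : R) : 1 < u -> exists2 q, (0 < q)%N &
  forall (T : finType) k, (k * q <= #|T|)%N -> #|small_sets T k|%:R <= u ^+ #|T|.
Proof.
move=> u1; have [v v1 hv] := expr_root 2 u1.
pose l : R := Num.min 1 (v - 1).
have l0 : 0 < l by rewrite lt_min ltr01 subr_gt0.
have l1 : l <= 1 by rewrite ge_min lexx.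
have lv : 1 + l <= v by rewrite addrC -lerBrDr ge_min lexx orbT.
have [q q0 hq] := expr_unbounded l^-1 v1; exists q => // T k kq.
have v0 : 0 < v by lra.
have := @small_sets_weight T R l k; rewrite l0 l1 => /(_ isT) hw.
rewrite -(ler_pM2r (exprn_gt0 k l0)); apply: (le_trans hw).
apply: (@le_trans _ _ (v ^+ #|T|)); first by apply: lerXn2r; rewrite ?nnegrE //; lra.
apply: (@le_trans _ _ (v ^+ #|T| * (v ^+ #|T| * l ^+ k))); last first.
  rewrite mulrA; apply: ler_wpM2r; first exact/exprn_ge0/ltW.
  by rewrite -exprMn -expr2; apply: lerXn2r; rewrite ?nnegrE ?exprn_ge0 //; lra.
apply: ler_peMr; first exact/exprn_ge0/ltW.
apply: (@le_trans _ _ ((v ^+ q * l) ^+ k)).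
  apply: exprn_ege1; rewrite -(mulVf (lt0r_neq0 l0)).
  by apply: ler_wpM2r => //; apply: ltW.
rewrite exprMn; apply: ler_wpM2r; first exact/exprn_ge0/ltW.
by rewrite -exprM; apply: ler_weXn2l; [lra | rewrite mulnC].
Qed.

End Asymptotics.

Section SchurRemoval.
Variable R : archiRealFieldType.
Local Open Scope ring_scope.

(* Triangles in the Cayley graph on the integers modulo 2n+1: no sum of two elements of [n] wraps around. *)
Theorem schur_removal q : (0 < q)%N -> exists2 delta : R, 0 < delta &
  forall n (C : {set 'I_n.+1}), (0 < n)%N -> C \subset interval1 n ->
    #|schur C|%:R < delta * n%:R ^+ 2 ->
  exists A : {set 'I_n.+1}, [/\ A \subset C, (#|A| * q <= n)%N & sum_free (C :\: A)].
Proof.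
(* The exceptional set has at most [9 * eps * N = N / (3 q)] elements with [N = 2 n + 1], which is
   at most [n / q]. *)
move=> q0; pose eps : R := 1 / (27 * q%:R).
have q0' : 0 < q%:R :> R by rewrite ltr0n.
have eps0 : 0 < eps by rewrite divr_gt0 ?mulr_gt0.
have [delta delta0 removal] := triangle_removal eps0.
exists delta => // n C n0 Cint hC.
pose m := (n + n)%N; pose V : finZmodType := 'I_m.+1.
pose inC (d : V) := [exists a in C, a == d :> nat].
pose f : rel V := fun x y => inC (y - x).
have vS (d d' : V) : (d <= n)%N -> (d' <= n)%N -> (d + d' : V) = (d + d')%N :> nat.
  by move=> dn dn'; rewrite /= modn_small // ltnS leq_add.
have inCn d : inC d -> (d <= n)%N.
  by move=> /exists_inP[a _ /eqP <-]; rewrite -ltnS ltn_ord.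
have NE : #|V| = (n + n).+1 by rewrite card_ord.
set N : R := #|V|%:R in removal *.
have Nn : N = 2 * n%:R + 1 by rewrite /N NE -natr1 natrD; ring.
have n1 : 1 <= n%:R :> R by rewrite ler1n.
have tri : triangle_sum R f f f < delta * N ^+ 3.
  apply: (@le_lt_trans _ _ (N * #|schur C|%:R)); last first.
    have N0 : 0 < N by rewrite Nn; lra.
    rewrite exprS mulrCA ltr_pM2l //; apply: (lt_le_trans hC).
    apply: ler_wpM2l; first exact: ltW.
    by apply: lerXn2r; rewrite ?nnegrE; lra.
  rewrite /triangle_sum /N mulr_natl -sumr_const; apply: ler_sum => x _.
  rewrite pair_big /=.
  pose tr (p : V * V) : 'I_n.+1 * 'I_n.+1 * 'I_n.+1 :=
    (inord (p.1 - x)%R, inord (p.2 - p.1)%R, inord (p.2 - x)%R).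
  pose P (p : V * V) := [&& f x p.1, f p.1 p.2 & f x p.2].
  apply: (@le_trans _ _ (\sum_(p | P p) 1)).
    by rewrite [leRHS]big_mkcond; apply: ler_sum => p _; rewrite /P; case: ifP.
  have injord (d d' : V) : (d <= n)%N -> (d' <= n)%N ->
      inord d = inord d' :> 'I_n.+1 -> d = d'.
    by move=> dn dn' /(congr1 (@nat_of_ord _)); rewrite !inordK ?ltnS // => /ord_inj.
  have inj : {in P &, injective tr}.
    move=> [y z] [y' z'] /and3P[/= /inCn h1 _ /inCn h2] /and3P[/= /inCn h1' _ /inCn h2'] [].
    by move=> /(injord _ _ h1 h1') /addIr -> _ /(injord _ _ h2 h2') /addIr ->.
  rewrite sumr_const ler_nat.
  rewrite -(card_in_imset inj); apply/subset_leq_card/subsetP => t /imsetP[[y z]].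
  move=> /and3P[h1 h2 h3] ->.
  have lift d : inC d -> (inord d : 'I_n.+1) \in C.
    by move=> /exists_inP[a aC /eqP <-]; rewrite inord_val.
  rewrite inE; apply/and4P; split; try exact: lift.
  apply/eqP; rewrite /tr [RHS]inordK ?ltnS ?inCn //.
  rewrite [X in (X + _)%N]inordK ?ltnS ?inCn // [X in (_ + X)%N]inordK ?ltnS ?inCn //.
  by rewrite -vS ?inCn //; congr nat_of_ord; rewrite addrC addrA subrK.
have [g [_ gtri grem]] := removal _ _ _ _ tri.
have {}grem j : \sum_(x : V) \sum_(y : V) (f x y && ~~ g j x y)%:R <= eps * N ^+ 2.
  apply: le_trans (grem j); apply: ler_sum => x _; apply: ler_sum => y _.
  by rewrite /three_rels; case: ifP => // _; case: ifP.
pose bad j (d : V) := [set x : V | ~~ g j x (x + d)].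
(* Differences for which one of the three removals kills at least a third of the [N] translates. If
   [a], [b] and [a + b] all avoid this set, some translate keeps all three sides of its triangle,
   contrary to [gtri]. *)
pose AV := [set d : V | inC d && [exists j, (#|V| <= 3 * #|bad j d|)%N]].
have lem (a : 'I_n.+1) : (a <= m)%N by have := ltn_ord a; rewrite /m; clear; lia.
exists [set a in C | (inord a : V) \in AV]; split.
- by apply/subsetP => a; rewrite inE => /andP[].
- apply: (@leq_trans (#|AV| * q)).
    rewrite leq_mul2r; apply/orP; right.
    rewrite -(@card_in_imset _ _ (fun a : 'I_n.+1 => inord a : V)).
      by apply/subset_leq_card/subsetP => d /imsetP[a]; rewrite inE => /andP[_ ?] ->.
    move=> a b _ _ /(congr1 (@nat_of_ord _)); rewrite !inordK ?ltnS ?lem //.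
    by move/ord_inj.
  have key : #|AV|%:R * N <= 9 * eps * N ^+ 2.
    have -> : #|AV|%:R * N = \sum_(d in AV) N by rewrite sumr_const mulr_natl.
    apply: (@le_trans _ _ (\sum_(d in AV) \sum_j 3 * #|bad j d|%:R)).
      apply: ler_sum => d; rewrite inE => /andP[_ /existsP[j hj]].
      rewrite (bigD1 j) //=; apply: (@le_trans _ _ (3 * #|bad j d|%:R)).
        by rewrite -natrM ler_nat.
      by rewrite lerDl; apply: sumr_ge0 => ? _; rewrite mulr_ge0.
    rewrite exchange_big /=; apply: (@le_trans _ _ (\sum_(j < 3) 3 * (eps * N ^+ 2))).
      apply: ler_sum => j _; rewrite -mulr_sumr; apply: ler_wpM2l => //.
      apply: le_trans (grem j).
      apply: (@le_trans _ _ (\sum_(x : V) \sum_(d : V) (inC d && ~~ g j x (x + d))%:R)); last first.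
        apply: ler_sum => x _; rewrite [leRHS](reindex_inj (addrI x)) /=.
        by apply: ler_sum => d _; rewrite /f addrAC subrr add0r.
      rewrite exchange_big /= big_mkcond; apply: ler_sum => d _; case: ifP => [|_].
        rewrite inE => /andP[-> _]; rewrite -sum1_card natr_sum big_mkcond /=.
        by apply: ler_sum => x _; rewrite inE; case: (g _ _ _).
      exact: sumr_ge0.
    by rewrite sumr_const card_ord -mulr_natl; lra.
  have N0 : 0 < N by rewrite Nn; lra.
  rewrite -(ler_nat R) natrM.
  have : #|AV|%:R <= 9 * eps * N.
    by rewrite -(ler_pM2r N0); apply: (le_trans key); rewrite expr2 mulrA.
  move=> /(ler_wpM2r (ltW q0')) /le_trans; apply.
  have -> : 9 * eps * N * q%:R = N / 3 by rewrite /eps; field; rewrite lt0r_neq0.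
  by rewrite Nn; lra.
- apply/sum_freeP => a b c; rewrite !inE => /andP[na aC] /andP[nb bC] /andP[nc cC] abc.
  pose v (a : 'I_n.+1) : V := inord a.
  have vE (a' : 'I_n.+1) : v a' = a' :> nat.
    by rewrite /v inordK // ltnS lem.
  have vn (a' : 'I_n.+1) : (v a' <= n)%N by rewrite vE -ltnS ltn_ord.
  have inCv (a' : 'I_n.+1) : a' \in C -> inC (v a').
    by move=> a'C; apply/exists_inP; exists a' => //; rewrite vE.
  have badlt (a' : 'I_n.+1) j : a' \in C ->
      ~~ [&& a' \in C, inC (v a') & [exists j, (#|V| <= 3 * #|bad j (v a')|)%N]] ->
      (3 * #|bad j (v a')| < #|V|)%N.
    by move=> a'C; rewrite a'C inCv //= => /existsPn /(_ j); rewrite -ltnNge.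
  have habc : v c = v a + v b by apply: ord_inj; rewrite vS ?vn // !vE abc.
  have := badlt _ (inord 0) aC na =>  b0.
  have := badlt _ (inord 1) bC nb =>  b1.
  have := badlt _ (inord 2) cC nc =>  b2.
  pose B1 := [set x : V | x + v a \in bad (inord 1) (v b)].
  have B1c : #|B1| = #|bad (inord 1) (v b)|.
    rewrite -(card_imset _ (@addIr V (v a))); apply: eq_card => x.
    apply/imsetP/idP => [[y]|xb]; first by rewrite inE => yB ->.
    by exists (x - v a); rewrite ?inE subrK // -(in_set (fun x => ~~ g _ x _)).
  have cov : setT \subset bad (inord 0) (v a) :|: B1 :|: bad (inord 2) (v c).
    apply/subsetP => x _; rewrite !inE; apply/negPn/negP; rewrite !negb_or !negbK.
    move=> /andP[/andP[g0 g1] g2]; apply: (gtri _ _ _ g0 g1).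
    by rewrite -addrA -habc.
  have : (#|V| <= #|bad (inord 0) (v a)| + #|B1| + #|bad (inord 2) (v c)|)%N.
    rewrite -cardsT; apply: (leq_trans (subset_leq_card cov)).
    apply: (leq_trans (leq_card_setU _ _)); rewrite leq_add2r; exact: leq_card_setU.
  by move: b0 b1 b2; rewrite B1c; clear; lia.
Qed.

End SchurRemoval.

(** * Containers for sum-free sets *)

Section Greedy.
Variables (T : finType) (e : rel T).

(** Take [P] maximal such that its members cover, on average, at least [h] points of [C] each. A
    point of [M] with [h] uncovered neighbours is not in [P] and could be added. *)
Lemma greedy_fingerprint (C M : {set T}) h : (0 < h)%N ->
  {in M &, forall x y, ~~ e x y} -> exists P : {set T},
  [/\ P \subset M, (#|P| * h <= #|C|)%N &
   forall v, v \in M -> (#|[set y in C :\: nbhd e P | e v y]| < h)%N].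
Proof.
move=> h0 Mind.
pose good (P : {set T}) := (P \subset M) && (#|P| * h <= #|C :&: nbhd e P|)%N.
have g0 : good set0 by rewrite /good sub0set cards0 mul0n.
have [P /maxsetP[/andP[PM Pc] Pmax] _] := maxset_exists g0.
exists P; split => //.
  by apply: (leq_trans Pc); apply/subset_leq_card/subsetIl.
move=> v vM; pose Y := [set y in C :\: nbhd e P | e v y].
suff: ~~ (h <= #|Y|)%N by rewrite -ltnNge.
apply/negP => big.
have Yv : Y \subset C :&: nbhd e (v |: P).
  apply/subsetP => y; rewrite !inE => /andP[/andP[_ yC] evy]; rewrite yC /=.
  by apply/existsP; exists v; rewrite !inE eqxx.
have YP : [disjoint C :&: nbhd e P & Y].
  rewrite -setI_eq0; apply/eqP/setP => y; rewrite !inE.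
  by case: (y \in C) => //=; rewrite ?andbF //; case: [exists w in P, e w y]; rewrite ?andbF.
have sub : C :&: nbhd e P :|: Y \subset C :&: nbhd e (v |: P).
  rewrite subUset Yv andbT; apply/subsetP => y; rewrite !inE => /andP[-> /existsP[w /andP[wP ewy]]].
  by apply/existsP; exists w; rewrite !inE wP orbT.
have vP : v \notin P.
  apply/negP => vP; have Y0 : Y = set0.
    apply/setP => y; rewrite !inE; case evy: (e v y); last by rewrite andbF.
    have -> : [exists w in P, e w y] by apply/existsP; exists v; rewrite vP evy.
    by [].
  by move: big; rewrite Y0 cards0; move: h0; clear; lia.
have gv : good (v |: P).
  rewrite /good subUset sub1set vM PM /=; apply: leq_trans (subset_leq_card sub).
  rewrite cardsU1 vP [X in (_ <= X)%N]cardsU (disjoint_setI0 YP) cards0 subn0.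
  by move: Pc big; clear; nia.
by have := Pmax _ gv (subsetUr _ _) => E; rewrite -E !inE eqxx in vP.
Qed.

End Greedy.

Section Container.
Variable n : nat.
Local Notation T := 'I_n.+1.
Implicit Types (S C M P D : {set T}).

Definition schur_rel (v x y : T) := [|| x + y == v, x + v == y | y + v == x].

Definition lnk S : rel T := fun x y => [exists s in S, schur_rel s x y].

Lemma lnk_sym S : symmetric (lnk S).
Proof.
move=> x y; apply: eq_existsb => s; congr (_ && _).
by rewrite /schur_rel addnC; congr (_ || _); rewrite orbC.
Qed.

Lemma sum_free_lnk S M : S \subset M -> sum_free M -> {in M &, forall x y, ~~ lnk S x y}.
Proof.
move=> /subsetP SM /sum_freeP sM x y xM yM; apply/negP => /exists_inP[s /SM sS].
by case/or3P => /eqP; apply: sM.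
Qed.

Definition degree C v := \sum_(x in C) \sum_(y in C) schur_rel v x y.

(** Both deletions spare an independent set with fingerprint [P]: its points have no neighbour in
    [P], and the greedy choice leaves each of them fewer than [h] uncovered neighbours. *)
Definition cut h S P C := let U := C :\: nbhd (lnk S) P in
  [set v in U | #|[set y in U | lnk S v y]| < h].

Lemma cards3_le (a b c : T) (A : {set T}) : (forall x, x \in A -> [\/ x = a, x = b | x = c]) ->
  #|A| <= 3.
Proof.
move=> h; apply: (@leq_trans #|[set a; b; c]|).
  by apply/subset_leq_card/subsetP => x /h[->|->|->]; rewrite !inE eqxx ?orbT.
by apply: (leq_trans (leq_card_setU _ _)); rewrite cards1 cards2; case: (_ == _).
Qed.

Lemma schur_rel_eq (v x y : T) : schur_rel v x y ->
  [\/ v = inord (x + y), v = inord (y - x) | v = inord (x - y)].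
Proof.
by case/or3P => /eqP E; [apply: Or31; rewrite E inord_val | apply: Or32 | apply: Or33];
  rewrite -?E ?addKn ?inord_val.
Qed.

Lemma schur_rel_nb (v x : T) : #|[set y | schur_rel v x y]| <= 3.
Proof.
apply: (@cards3_le (inord (v - x)) (inord (v + x)) (inord (x - v))) => y; rewrite inE.
case/or3P => /eqP E.
- by apply: Or31; rewrite -E addKn inord_val.
- by apply: Or32; rewrite addnC E inord_val.
- by apply: Or33; rewrite -E addnK inord_val.
Qed.

Lemma sum_bool_card (I : finType) (A b : pred I) :
  \sum_(i in A) b i = #|[set i in A | b i]|.
Proof.
rewrite -sum1_card big_mkcond [RHS]big_mkcond; apply: eq_bigr => i _ /=.
by rewrite !inE; case: (i \in A); case: (b i).
Qed.

Lemma lnk_nb S x : \sum_y lnk S x y <= 3 * #|S|.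
Proof.
apply: (@leq_trans (\sum_y \sum_(s in S) schur_rel s x y)).
  apply: leq_sum => y _; case: (boolP (lnk S x y)) => // /exists_inP[s sS sxy].
  by rewrite (bigD1 s) //= sxy.
rewrite exchange_big /=; apply: (@leq_trans (\sum_(s in S) 3)).
  apply: leq_sum => s _; apply: leq_trans (schur_rel_nb s x).
  rewrite (sum_bool_card predT (schur_rel s x)).
  by apply/subset_leq_card/subsetP => y; rewrite !inE.
by rewrite sum_nat_const mulnC.
Qed.

(** The points of [S] produce at least [|S| d / 3] ordered edges, since an edge is due to at most
    three of them. Inside the cut the degrees are below [h], which accounts for at most half of
    these edges; the others touch deleted points, each of which has degree at most [3 |S|]. *)
Lemma cut_shrinks h S P C d : S \subset C -> 0 < #|S| ->
    (forall v, v \in S -> d <= degree C v) -> 6 * n.+1 * h <= #|S| * d ->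
  d <= 36 * #|C :\: cut h S P C|.
Proof.
move=> SC S0 hd hh; set C' := cut h S P C.
have C'C : C' \subset C by apply/subsetP => x; rewrite !inE => /andP[/andP[_ ->]].
have h1 : #|S| * d <= 3 * \sum_(x in C) \sum_(y in C) lnk S x y.
  apply: (@leq_trans (\sum_(v in S) degree C v)).
    by rewrite -sum_nat_const; apply: leq_sum.
  rewrite exchange_big big_distrr /=; apply: leq_sum => x _.
  rewrite exchange_big big_distrr /=; apply: leq_sum => y _.
  case: (boolP (lnk S x y)) => [_|nl].
    rewrite muln1 (sum_bool_card (mem S) (fun v => schur_rel v x y)).
    apply: (@cards3_le (inord (x + y)) (inord (y - x)) (inord (x - y))) => v.
    by rewrite inE => /andP[_ /schur_rel_eq].
  rewrite big1 // => v vS; apply/eqP; rewrite eqb0; apply: contra nl => vxy.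
  by apply/exists_inP; exists v.
have h2 : \sum_(x in C) \sum_(y in C) lnk S x y <= n.+1 * h + 6 * #|S| * #|C :\: C'|.
  have half : \sum_(x in C :\: C') \sum_(y in C) lnk S x y <= 3 * #|S| * #|C :\: C'|.
    rewrite [leqRHS]mulnC -sum_nat_const; apply: leq_sum => x _.
    apply: leq_trans (lnk_nb S x); rewrite big_mkcond.
    by apply: leq_sum => y _; case: ifP.
  rewrite (big_setID C') /= (setIidPr C'C).
  have -> : n.+1 * h + 6 * #|S| * #|C :\: C'| =
    (n.+1 * h + 3 * #|S| * #|C :\: C'|) + 3 * #|S| * #|C :\: C'| by clear; lia.
  apply: leq_add => //.
  under eq_bigr do rewrite (big_setID C') /= (setIidPr C'C).
  rewrite big_split /=; apply: leq_add; last first.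
    rewrite exchange_big /=; apply: leq_trans half; apply: leq_sum => x _.
    rewrite [leqRHS](big_setID C') /= (setIidPr C'C).
    by under eq_bigr do rewrite lnk_sym; apply: leq_addr.
  apply: (@leq_trans (\sum_(x in C') h)).
    apply: leq_sum => x xC'; move: (xC'); rewrite inE => /andP[_ /ltnW]; apply: leq_trans.
    rewrite -sum1_card [leqLHS]big_mkcond [leqRHS]big_mkcond; apply: leq_sum => y _.
    case: ifP => // yC'; have yU : y \in C :\: nbhd (lnk S) P.
      by move: yC'; rewrite inE => /andP[].
    by rewrite inE yU /=; case: (lnk S x y).
  by rewrite sum_nat_const leq_mul2r -[X in _ <= X]card_ord max_card orbT.
move: h1 h2 hh S0; set X := \sum_(x in C) _; clear; nia.
Qed.

(** If the set sought has at most [s] points of degree [d] or more, it lies in the light points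
    together with these. Otherwise [S] stands for [s] of its heavy points and [P] for its
    fingerprint in the link graph of [S], and the search continues in the cut. *)
Fixpoint containers s p h d t C : {set {set T}} :=
  if t is t'.+1 then
    [set [set v in C | degree C v < d] :|: (S :&: C) | S in small_sets T s]
    :|: \bigcup_(S in small_sets T s) \bigcup_(P in small_sets T p)
          containers s p h d t' (cut h S P C)
  else [set C].

Lemma card_containers s p h d t C :
  #|containers s p h d t C| <= (2 * (#|small_sets T s| * #|small_sets T p|)) ^ t.
Proof.
have s0 k : 0 < #|small_sets T k| by apply/card_gt0P; exists set0; rewrite inE cards0.
elim: t C => [|t IH] C; first by rewrite /= cards1.
rewrite /= (leq_trans (leq_card_setU _ _)) // expnS.
set B1 := #|small_sets T s|; set B2 := #|small_sets T p|; set X := _ ^ t.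
have X0 : 0 < X by rewrite expn_gt0 !muln_gt0 !s0.
apply: (@leq_trans (B1 + B1 * (B2 * X))); last first.
  have hB : B1 <= B1 * (B2 * X) by rewrite leq_pmulr // muln_gt0 s0.
  by rewrite -!mulnA mul2n -addnn leq_add2r.
apply: leq_add; first exact: leq_imset_card.
have cup (k m : nat) (F : {set T} -> {set {set T}}) : (forall S, #|F S| <= m) ->
    #|\bigcup_(S in small_sets T k) F S| <= #|small_sets T k| * m.
  move=> Fm; rewrite -sum_nat_const; elim/big_ind2: _ => [|A1 x1 A2 x2 h1 h2|S _].
  - by rewrite cards0.
  - by apply: (leq_trans (leq_card_setU _ _)); apply: leq_add.
  - exact: Fm.
by apply: (cup s) => S; apply: (cup p) => P; apply: IH.
Qed.

(** A triple inside [C] is counted in the degree of its sum. A triple meeting [S] is determined by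
    the position and value of that entry and one further entry. *)
Lemma card_schur_heavy C S d : (forall v, v \in C -> degree C v <= d) ->
  #|schur (C :|: S)| <= n.+1 * d + 3 * (#|S| * n.+1).
Proof.
move=> hd.
have pr (f : T * T * T -> T * T) (Q : {set T * T * T}) :
    {in Q &, injective f} -> (forall t, t \in Q -> (f t).1 \in S) -> #|Q| <= #|S| * n.+1.
  move=> fi fS; rewrite -(card_in_imset fi) -[X in _ * X](card_ord n.+1) -cardsT -cardsX.
  apply/subset_leq_card/subsetP => _ /imsetP[t tQ ->].
  by rewrite inE fS // inE.
pose Q1 := [set t in schur (C :|: S) | t.1.1 \in S].
pose Q2 := [set t in schur (C :|: S) | t.1.2 \in S].
pose Q3 := [set t in schur (C :|: S) | t.2 \in S].
have c1 : #|Q1| <= #|S| * n.+1.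
  apply: (pr (fun t => t.1)) => [[[a b] c] [[a' b'] c']|t]; rewrite !inE /=; last by case/andP.
  move=> /andP[/and4P[_ _ _ /eqP e1] _] /andP[/and4P[_ _ _ /eqP e2] _] [Ea Eb].
  by rewrite Ea Eb in e1 *; congr (_, _); apply: ord_inj; rewrite -e1 -e2.
have c2 : #|Q2| <= #|S| * n.+1.
  apply: (pr (fun t => (t.1.2, t.1.1))) => [[[a b] c] [[a' b'] c']|t]; rewrite !inE /=; last by case/andP.
  move=> /andP[/and4P[_ _ _ /eqP e1] _] /andP[/and4P[_ _ _ /eqP e2] _] [Ea Eb].
  by rewrite Ea Eb in e1 *; congr (_, _); apply: ord_inj; rewrite -e1 -e2.
have c3 : #|Q3| <= #|S| * n.+1.
  apply: (pr (fun t => (t.2, t.1.1))) => [[[a b] c] [[a' b'] c']|t]; rewrite !inE /=; last by case/andP.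
  move=> /andP[/and4P[_ _ _ /eqP e1] _] /andP[/and4P[_ _ _ /eqP e2] _] [Ea Eb].
  rewrite Ea Eb in e1 *; congr (_, _, _); apply: ord_inj; move: e1 e2; clear; lia.
have c4 : #|schur C| <= n.+1 * d.
  apply: (@leq_trans (\sum_(v in C) degree C v)); last first.
    apply: (@leq_trans (#|C| * d)); first by rewrite -sum_nat_const; apply: leq_sum.
    by rewrite leq_mul2r -[X in _ <= X]card_ord max_card orbT.
  rewrite -sum1_card.
  rewrite (eq_bigl (fun t : T * T * T => [&& t.1.1 \in C, t.1.2 \in C, t.2 \in C & t.1.1 + t.1.2 == t.2 :> nat])); last first.
    by move=> t; rewrite inE.
  apply: (@leq_trans (\sum_(v : T) \sum_(x : T) \sum_(y : T) [&& x \in C, y \in C, v \in C & x + y == v :> nat])).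
    rewrite pair_big /= pair_big /= big_mkcond /=.
    rewrite (reindex (fun p : T * T * T => (p.1.2, p.2, p.1.1))) /=; last first.
      by exists (fun t : T * T * T => (t.2, t.1.1, t.1.2)) => [[[a b] c]|[[a b] c]].
    by apply: leq_sum => -[[v x] y] _ /=; case: ifP.
  rewrite [leqRHS]big_mkcond; apply: leq_sum => v _; case: ifP => [vC|vC]; last first.
    by rewrite big1 // => x _; rewrite big1 // => y _; rewrite !andbF.
  rewrite /degree [leqRHS]big_mkcond; apply: leq_sum => x _; case: ifP => [xC|xC]; last first.
    by rewrite big1.
  rewrite [leqRHS]big_mkcond; apply: leq_sum => y _; case: ifP => // yC.
  by rewrite /schur_rel; case: (x + y == v).
have sub : schur (C :|: S) \subset schur C :|: Q1 :|: Q2 :|: Q3.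
  apply/subsetP => -[[a b] c]; rewrite !inE /= => /and4P[aC bC cC ->]; rewrite aC bC cC /= !andbT.
  by case: (a \in S) aC; case: (b \in S) bC; case: (c \in S) cC; rewrite ?orbT ?orbF //= => -> -> ->.
apply: (leq_trans (subset_leq_card sub)); apply: (leq_trans (leq_card_setU _ _)).
apply: (@leq_trans (n.+1 * d + #|S| * n.+1 + #|S| * n.+1 + #|S| * n.+1)); last by clear; lia.
apply: leq_add => //; apply: (leq_trans (leq_card_setU _ _)).
apply: leq_add => //; apply: (leq_trans (leq_card_setU _ _)).
exact: leq_add.
Qed.

(** Each cut removes at least [d / 36] points, so the budget [36 |C| <= t d] loses one unit of [t]
    per round; at [t = 0] it forces [C] to be empty. *)
Lemma containersP s p h d t C M : 0 < s -> 0 < h -> n.+1 <= p * h ->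
  6 * n.+1 * h <= s * d -> 36 * #|C| <= t * d -> M \subset C -> sum_free M ->
  exists2 D, D \in containers s p h d t C &
    [/\ M \subset D, D \subset C & #|schur D| <= n.+1 * d + 3 * (s * n.+1)].
Proof.
move=> s0 h0 ph sd; elim: t C => [|t IH] C Ct MC sM.
  have C0 : C = set0 by apply/eqP; rewrite -cards_eq0; move: Ct; clear; lia.
  exists C; rewrite /= ?inE //; split => //.
  apply: (@leq_trans 0) => //; rewrite leqn0 cards_eq0 -subset0; apply/subsetP => x.
  by rewrite inE C0 !inE.
set H := [set v in C | degree C v < d].
have [small|big] := leqP #|M :\: H| s.
  exists (H :|: ((M :\: H) :&: C)).
    by rewrite /= inE; apply/orP; left; apply/imsetP; exists (M :\: H); rewrite ?inE.
  have HC : H \subset C by apply/subsetP => v; rewrite inE => /andP[].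
  split.
  - apply/subsetP => x xM; rewrite !inE xM (subsetP MC) //= andbT.
    by case: (degree C x < d).
  - by rewrite subUset HC subsetIr.
  - apply: (leq_trans (@card_schur_heavy H _ d _)).
      move=> v; rewrite inE => /andP[_ /ltnW]; apply: leq_trans.
      rewrite /degree [leqLHS]big_mkcond [leqRHS]big_mkcond; apply: leq_sum => x _.
      case: ifP => // /(subsetP HC) ->.
      rewrite [leqLHS]big_mkcond [leqRHS]big_mkcond; apply: leq_sum => y _.
      by case: ifP => // /(subsetP HC) ->.
    rewrite leq_add2l leq_mul2l /= leq_mul2r /=; apply: leq_trans small.
    exact/subset_leq_card/subsetIl.
have [S SM Ss] : exists2 S : {set T}, S \subset M :\: H & #|S| = s.
  pose S := [set x in take s (enum (M :\: H))].
  exists S; first by apply/subsetP => x; rewrite inE => /mem_take; rewrite mem_enum.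
  rewrite cardsE; have /card_uniqP -> : uniq (take s (enum (M :\: H))).
    by apply/take_uniq/enum_uniq.
  by rewrite size_take -cardE big.
have SM' : S \subset M by apply: subset_trans SM (subsetDl _ _).
have Mind := sum_free_lnk SM' sM.
have [P [PM Pc Pd]] := @greedy_fingerprint _ (lnk S) C M h h0 Mind.
have MU : M \subset C :\: nbhd (lnk S) P.
  apply/subsetP => x xM; rewrite !inE (subsetP MC) // andbT.
  by apply/existsP => -[y /andP[yP]]; apply/negP/Mind => //; apply: (subsetP PM).
have MC' : M \subset cut h S P C.
  by apply/subsetP => x xM; rewrite inE (subsetP MU) //= Pd.
have C'C : cut h S P C \subset C by apply/subsetP => x; rewrite !inE => /andP[/andP[_ ->]].
have SC : S \subset C by apply: subset_trans SM' MC.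
have shr : d <= 36 * #|C :\: cut h S P C|.
  apply: cut_shrinks; rewrite ?Ss // => v vS.
  have := subsetP SM _ vS; rewrite !inE => /andP[+ vM]; rewrite (subsetP MC) //=.
  by rewrite -leqNgt.
have [|D Dc [MD DC' Ds]] := IH (cut h S P C) _ MC' sM.
  move: Ct shr; have := cardsID (cut h S P C) C; rewrite (setIidPr C'C).
  by clear; nia.
exists D; last by split => //; apply: subset_trans DC' C'C.
rewrite /= inE; apply/orP; right; apply/bigcupP; exists S; first by rewrite inE Ss.
apply/bigcupP; exists P => //; rewrite inE.
have CT : #|C| <= n.+1 by rewrite -[X in _ <= X]card_ord max_card.
by rewrite -(leq_pmul2r h0); apply: (leq_trans Pc); apply: leq_trans CT ph.
Qed.

End Container.

Section Decomposition.
Variable R : archiRealFieldType.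
Local Open Scope ring_scope.

Theorem sum_free_decomposition (u : R) q : 1 < u -> (0 < q)%N -> exists n0, forall n,
  (n0 <= n)%N -> exists F : {set {set 'I_n.+1} * {set 'I_n.+1}},
  [/\ #|F|%:R <= u ^+ n,
      forall p, p \in F -> [/\ (#|p.1| * q <= n)%N, p.1 \subset interval1 n & sum_free p.2]
    & forall M, sum_free M -> exists2 p, p \in F & M \subset p.1 :|: p.2].
Proof.
move=> u1 q0; have [delta delta0 removal] := schur_removal R q0.
(* With [d] about [n / k] a container has at most [4 n^2 / k] Schur triples, which is below
   [delta n^2]. *)
pose k := (Num.bound (8 / delta)).+1.
have hk : 8 <= delta * k%:R.
  rewrite mulrC -ler_pdivrMr //; apply: (le_trans (ltW (archi_boundP _))).
    by rewrite divr_ge0 // ltW.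
  by rewrite ler_nat.
have k0 : (0 < k)%N by [].
(* Gives [36 n <= t d], because [n <= 2 k d]. The depth [t] and the size [s] do not depend on [n];
   only the fingerprint size [p] grows, like [n / h]. *)
pose t := (72 * k)%N.
have [v v1 hv] := expr_root (5 * t) u1.
have [q1 q10 small] := small_sets_bound v1.
pose h := (2 * q1)%N; pose s := (24 * k * h)%N.
have h0 : (0 < h)%N by rewrite muln_gt0.
have s0 : (0 < s)%N by rewrite !muln_gt0 k0.
have [m _ hm] := expr_unbounded 2 v1.
exists (m + 2 * k + 2 * q1 + s * q1 + 3 * k * s + 1)%N => n nn0.
have n0 : (0 < n)%N by move: nn0; clear; lia.
pose d := (n %/ k)%N; pose p := (n.+1 %/ h).+1.
have dk : (d * k <= n)%N by apply: leq_trunc_div.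
have nd : (n <= 2 * k * d)%N.
  have := ltn_ceil n k0; rewrite -/d => hd.
  have : (2 * k <= n)%N by move: nn0; clear; lia.
  by move: hd; clear; nia.
have ph : (n.+1 <= p * h)%N by apply/ltnW/ltn_ceil.
have pq : (p * q1 <= n.+1)%N.
  have := leq_trunc_div n.+1 h; rewrite /p /h.
  have : (2 * q1 <= n)%N by move: nn0; clear; lia.
  by move: (n.+1 %/ _)%N => z; clear; nia.
have sq : (s * q1 <= n.+1)%N by move: nn0; clear; lia.
have hsd : (6 * n.+1 * h <= s * d)%N.
  have h4 : (n.+1 <= 4 * k * d)%N by move: nd n0; clear; lia.
  apply: (@leq_trans (6 * (4 * k * d) * h)).
    by rewrite leq_mul2r leq_mul2l h4 !orbT.
  by rewrite /s; clear; lia.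
have htd : (36 * #|interval1 n| <= t * d)%N.
  apply: (@leq_trans (36 * n)).
    rewrite leq_mul2l /=; have -> : interval1 n = setT :\ ord0.
      by apply/setP => x; rewrite !inE andbT lt0n.
    rewrite -ltnS -[X in (_ < X)%N](card_ord n.+1) -cardsT.
    by rewrite [X in (_ < X)%N](cardsD1 ord0) in_setT.
  by rewrite /t; move: nd; clear; lia.
pose Cs := [set D in containers s p h d t (interval1 n) |
  (D \subset interval1 n) && (#|schur D| <= n.+1 * d + 3 * (s * n.+1))%N].
pose cond (D : {set 'I_n.+1}) (r : {set 'I_n.+1} * {set 'I_n.+1}) :=
  [&& r.1 \subset D, (#|r.1| * q <= n)%N, sum_free r.2 & r.2 == D :\: r.1].
pose f D := odflt (set0, set0) [pick r | cond D r].
have fP D : D \in Cs -> cond D (f D).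
  rewrite inE => /and3P[_ DI hD]; rewrite /f; case: pickP => [//|no].
  have [|A [AD Aq AS]] := removal n D n0 DI; last first.
    by have := no (A, D :\: A); rewrite /cond /= AD Aq AS eqxx.
  apply: (@le_lt_trans _ _ (n.+1 * d + 3 * (s * n.+1))%:R); first by rewrite ler_nat.
  have h1 : (n.+1 * d + 3 * (s * n.+1) <= 2 * n * d + 6 * (s * n))%N.
    by move: n0; clear; nia.
  have h2 : (k * (2 * n * d + 6 * (s * n)) <= 4 * (n * n))%N.
    have : (3 * k * s <= n)%N by move: nn0; clear; lia.
    by move: dk; clear; nia.
  have k0' : 0 < k%:R :> R by rewrite ltr0n.
  apply: (@le_lt_trans _ _ (2 * n * d + 6 * (s * n))%:R); first by rewrite ler_nat.
  rewrite -(ltr_pM2l k0'); apply: (@le_lt_trans _ _ (4 * (n * n))%:R).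
    by rewrite -natrM ler_nat.
  have nn : 0 < n%:R ^+ 2 :> R by rewrite exprn_gt0 // ltr0n.
  rewrite mulrA natrM natrM -expr2 ltr_pM2r // [k%:R * _]mulrC.
  by apply: lt_le_trans hk; rewrite ltr_nat.
exists (f @: Cs); split.
- apply: (@le_trans _ _ #|containers s p h d t (interval1 n)|%:R).
    rewrite ler_nat; apply: (leq_trans (leq_imset_card _ _)).
    by apply/subset_leq_card/subsetP => D; rewrite inE => /andP[].
  apply: (@le_trans _ _ ((2 * (#|small_sets 'I_n.+1 s| * #|small_sets 'I_n.+1 p|)) ^ t)%:R).
    by rewrite ler_nat card_containers.
  have v0 : 0 <= v by lra.
  have v1' : 1 <= v by lra.
  rewrite natrX !natrM; apply: (@le_trans _ _ ((v ^+ (5 * n)) ^+ t)).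
    apply: lerXn2r; rewrite ?nnegrE ?exprn_ge0 //; first by rewrite !mulr_ge0.
    have c1 := small 'I_n.+1 s; rewrite card_ord in c1.
    have c2 := small 'I_n.+1 p; rewrite card_ord in c2.
    apply: (@le_trans _ _ (v ^+ m * (v ^+ n.+1 * v ^+ n.+1))).
      by apply: ler_pM => //; [apply: mulr_ge0 | apply: ler_pM; rewrite ?c1 ?c2].
    rewrite -!exprD; apply: ler_weXn2l => //.
    by move: nn0; clear; lia.
  rewrite -exprM (_ : 5 * n * t = (5 * t) * n)%N; last by clear; lia.
  by rewrite exprM; apply: lerXn2r; rewrite ?nnegrE ?exprn_ge0 //; lra.
- move=> r /imsetP[D DC ->]; have /and4P[h1 h2 h3 _] := fP _ DC; split => //.
  by apply: (subset_trans h1); move: DC; rewrite inE => /and3P[].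
- move=> M sM; have MI := sum_free_interval sM.
  have [D Dc [MD DI Ds]] := containersP s0 h0 ph hsd htd MI sM.
  have DC : D \in Cs by rewrite inE Dc DI Ds.
  exists (f D); first exact: imset_f.
  have /and4P[h1 _ _ /eqP ->] := fP _ DC.
  by apply/subsetP => x /(subsetP MD) xD; rewrite !inE xD andbT orbN.
Qed.

End Decomposition.

(** * Link graphs of sum-free sets *)

Section Fibers.
Variable R : realFieldType.
Local Open Scope ring_scope.

Lemma card_fibers (I J : finType) (A : {set I}) (P : {set J}) (f : I -> J) (K : R) :
  (forall x, x \in A -> f x \in P) ->
  (forall y, y \in P -> #|[set x in A | f x == y]|%:R <= K) ->
  #|A|%:R <= #|P|%:R * K.
Proof.
move=> fP hK; rewrite -sum1_card (partition_big f (mem P)) //= natr_sum mulr_natl -sumr_const.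
apply: ler_sum => y yP; apply: le_trans (hK y yP); rewrite ler_nat -sum1_card.
by rewrite leq_eqVlt; apply/orP; left; apply/eqP; apply: eq_bigl => x; rewrite inE.
Qed.

End Fibers.

Section Blocked.
Variable n : nat.
Local Notation T := 'I_n.+1.
Implicit Types (S M V B : {set T}).

(** The other triples through [x], namely [x + x = x] and [x + a = x], have a zero entry, which
    positivity of [x] and sum-freeness of [M] exclude. *)
Definition blocked M (x : T) := [exists a in M, (x + x == a) ||
  [exists b in M, (a + b == x) || (x + a == b)]].

Lemma blockedP M (x : T) : reflect
  ((exists2 a, a \in M & x + x = a :> nat) \/
   (exists a b, [/\ a \in M, b \in M & a + b = x :> nat \/ x + a = b :> nat]))
  (blocked M x).
Proof.
apply: (iffP exists_inP) => [[a aM /orP[/eqP h|/exists_inP[b bM /orP h]]]|[[a aM h]|[a [b [aM bM h]]]]].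
- by left; exists a.
- by right; exists a, b; split => //; case: h => /eqP; [left|right].
- by exists a => //; rewrite h eqxx.
- exists a => //; apply/orP; right; apply/exists_inP; exists b => //.
  by case: h => ->; rewrite eqxx ?orbT.
Qed.

Lemma blockedS M B (x : T) : M \subset B -> blocked M x -> blocked B x.
Proof.
move=> /subsetP MB /blockedP h; apply/blockedP.
case: h => [[a /MB aB h]|[a [b [/MB aB /MB bB h]]]]; first by left; exists a.
by right; exists a, b.
Qed.

Lemma sum_free_not_blocked M (x : T) : sum_free M -> x \in M -> ~~ blocked M x.
Proof.
move=> /sum_freeP sM xM; apply/blockedP => -[[a aM]|[a [b [aM bM []]]]]; exact: sM.
Qed.

Lemma sum_free_add M (x : T) : sum_free M -> 0 < x -> ~~ blocked M x -> sum_free (x |: M).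
Proof.
move=> /sum_freeP sM x0 /blockedP nb; apply/sum_freeP => a b c.
rewrite !inE => /orP[/eqP->|aM] /orP[/eqP->|bM] /orP[/eqP->|cM] E.
- by move: E x0; clear; lia.
- by apply: nb; left; exists c.
- have b0 : b = 0 :> nat by (move: E; clear; lia).
  by apply: (sM b b b) => //; rewrite b0.
- by apply: nb; right; exists b, c; split => //; right.
- have a0 : a = 0 :> nat by (move: E; clear; lia).
  by apply: (sM a a a) => //; rewrite a0.
- by apply: nb; right; exists a, c; split => //; right; rewrite addnC.
- by apply: nb; right; exists a, b; split => //; left.
- exact: (sM a b c).
Qed.

(** Maximality is tested against the points of [V] only, while [M] may have points elsewhere. In
    this form it passes from [n] to the odd numbers, to the top half, or to the points above
    [h - r]. *)
Definition vmax V M := sum_free M && [forall x in V, (x \notin M) ==> blocked M x].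

Lemma vmaxP V M : reflect (sum_free M /\ forall x, x \in V -> x \notin M -> blocked M x) (vmax V M).
Proof.
apply: (iffP andP) => -[sM h]; split => //.
  by move=> x xV xM; move/'forall_implyP: h => /(_ x xV); rewrite xM.
by apply/'forall_implyP => x xV; apply/implyP; apply: h.
Qed.

Lemma vmaxS V V' M : V' \subset V -> vmax V M -> vmax V' M.
Proof. by move=> /subsetP VV /vmaxP[sM h]; apply/vmaxP; split => // x /VV; apply: h. Qed.

Lemma max_sum_freeE M : max_sum_free M = vmax (interval1 n) M.
Proof.
apply/maxsetP/vmaxP => [[/andP[MI sM] mx]|[sM h]].
  split=> // x; rewrite inE => x0 xM; apply: contraT => nb.
  have sx := sum_free_add sM x0 nb.
  have := mx (x |: M); rewrite sx sum_free_interval // => /(_ isT (subsetUr _ _)) E.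
  by rewrite -E !inE eqxx in xM.
split; first by rewrite sM sum_free_interval.
move=> B /andP[BI sB] MB; apply/eqP; rewrite eqEsubset MB andbT.
apply/subsetP => x xB; apply: contraT => xM.
have := sum_free_not_blocked sB xB.
by rewrite (blockedS MB) // h // (subsetP BI).
Qed.

Definition lk S : rel T := fun x y => (x != y) && lnk S x y.

Lemma lk_sym S : symmetric (lk S).
Proof. by move=> x y; rewrite /lk eq_sym lnk_sym. Qed.

Lemma lk_irr S : irreflexive (lk S).
Proof. by move=> x; rewrite /lk eqxx. Qed.

Definition excl S := [set x | blocked S x].

(** A point of [V] outside [M] is blocked by at most two elements of [M]. If they lie in [S] the
    point is in [excl S]; if only one does, the other is a neighbour in the link graph; and they
    cannot all lie in [V], which is sum-free. *)
Lemma vmax_mis V S M : sum_free V -> S \subset M -> M \subset S :|: V -> vmax V M ->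
  mis (lk S) (V :\: excl S) (M :&: V).
Proof.
move=> sV SM MSV /vmaxP[sM mx]; apply/misP; split.
- apply/subsetP => x; rewrite !inE => /andP[xM ->]; rewrite andbT.
  by apply: contra (sum_free_not_blocked sM xM); apply: blockedS.
- move=> x y; rewrite !inE => /andP[xM _] /andP[yM _].
  by rewrite negb_and orbC (sum_free_lnk SM sM).
- move=> x; rewrite !inE => /andP[nb xV]; rewrite xV andbT => xM.
  have inSV a : a \in M -> a \in S \/ a \in V.
    by move=> /(subsetP MSV); rewrite inE => /orP.
  have sV' a b c : a \in V -> b \in V -> c \in V -> a + b <> c :> nat.
    by move/sum_freeP: sV; apply.
  have lkx a b : a \in S -> b \in M -> b \in V -> schur_rel a x b ->
      exists2 y, y \in M :&: V & lk S x y.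
    move=> aS bM bV ab; exists b; first by rewrite inE bM.
    apply/andP; split; first by apply: contraNneq xM => ->.
    by apply/exists_inP; exists a.
  move/blockedP: (mx x xV xM) => [[a aM E]|[a [b [aM bM E]]]].
    case: (inSV _ aM) => aS; last by case: (sV' _ _ _ xV xV aS E).
    by case/negP: nb; apply/blockedP; left; exists a.
  case: (inSV _ aM) => aS; case: (inSV _ bM) => bS.
  - by case/negP: nb; apply/blockedP; right; exists a, b.
  - apply: (lkx a b) => //; apply/or3P.
    by case: E => E; [apply: Or33; rewrite addnC | apply: Or32]; apply/eqP.
  - apply: (lkx b a) => //; apply/or3P.
    by case: E => E; [apply: Or33 | apply: Or31]; apply/eqP.
  - by case: E => E; [case: (sV' a b x) | case: (sV' x a b)].
Qed.

Lemma card_vmax V S (MM : {set {set T}}) : sum_free V ->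
  (forall M, M \in MM -> [/\ vmax V M, S \subset M & M \subset S :|: V]) ->
  [disjoint S & V] ->
  #|MM| <= nmis (lk S) (V :\: excl S).
Proof.
move=> sV hM dSV.
have key M : M \in MM -> M = S :|: M :&: V.
  move=> /hM[_ SM MSV]; apply/setP => x; rewrite !inE; apply/idP/orP => [xM|[/(subsetP SM)//|/andP[]//]].
  by move: (subsetP MSV _ xM); rewrite inE => /orP[->|->]; [left | rewrite xM; right].
rewrite -(@card_in_imset _ _ (fun M => M :&: V)).
  apply/subset_leq_card/subsetP => I /imsetP[M /hM[h1 h2 h3] ->].
  by rewrite inE vmax_mis.
by move=> M M' /key {2}-> /key {2}-> /= ->.
Qed.

End Blocked.

Section Sparse.
Variable R : realFieldType.
Local Open Scope ring_scope.

Lemma card_max_in_container (c : R) n (A B : {set 'I_n.+1}) :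
  (forall k, (0 < k)%N -> k%:R <= c ^+ k) -> sum_free B ->
  #|[set M : {set 'I_n.+1} | max_sum_free M & M \subset A :|: B]|%:R <= 2 ^+ #|A| * c ^+ #|B|.
Proof.
move=> hc sB; have c1 : 1 <= c by have := hc 1%N isT; rewrite expr1.
have -> : 2 ^+ #|A| = #|powerset A|%:R :> R by rewrite card_powerset natrX.
apply: (@card_fibers _ _ _ _ _ (fun M => M :&: A)) => [M _|S].
  by rewrite inE subsetIr.
rewrite inE => SA; pose V := B :\: A.
apply: (@le_trans _ _ (nmis (lk S) (V :\: excl S))%:R).
  rewrite ler_nat; apply: card_vmax.
  - by apply: sum_freeS sB; apply: subsetDl.
  - move=> M; rewrite !inE => /andP[/andP[mM MAB] /eqP ME].
    rewrite -ME subsetIl; split => //.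
      apply: vmaxS (_ : vmax (interval1 n) M); last by rewrite -max_sum_freeE.
      by apply: (subset_trans (subsetDl _ _)); apply: sum_free_interval.
    apply/subsetP => x xM; have := subsetP MAB _ xM; rewrite !inE xM.
    by case: (x \in A).
  - by rewrite -setI_eq0; apply/eqP/setP => x; rewrite !inE; case: (boolP (x \in S)) => // /(subsetP SA) ->.
apply: (le_trans (moon_moser hc (@lk_sym _ S) (V :\: excl S))).
apply: ler_weXn2l => //; apply/subset_leq_card/subsetP => x; rewrite !inE.
by case/and3P.
Qed.

End Sparse.

(** * Dense sum-free sets *)

Section SmallDoubling.
Variable G : finZmodType.
Local Open Scope ring_scope.

Definition diffs (X : {set G}) := [set p.1 - p.2 | p in setX X X].

Lemma diffsP (X : {set G}) h : reflect (exists x y, [/\ x \in X, y \in X & h = x - y]) (h \in diffs X).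
Proof.
apply: (iffP imsetP) => [[[x y]]|[x [y [xX yX ->]]]].
  by rewrite inE /= => /andP[xX yX] ->; exists x, y.
by exists (x, y); rewrite ?inE ?xX.
Qed.

(* If |X - X| < 3/2 |X|, every difference has more than |X|/2 representations. *)
Lemma diffs_closed (X : {set G}) : (2 * #|diffs X| < 3 * #|X|)%N ->
  {in diffs X &, forall g h, g + h \in diffs X}.
Proof.
move=> hX; pose Y h := [set y in X | y + h \in X].
have many h : h \in diffs X -> (#|X| < 2 * #|Y h|)%N.
  move=> /diffsP[u [v [uX vX hE]]].
  pose Z u := [set x - u | x in X].
  have cZ w : #|Z w| = #|X| by apply: card_imset; apply: addIr.
  have sZ w : w \in X -> Z w \subset diffs X.
    by move=> wX; apply/subsetP => _ /imsetP[x xX ->]; apply/diffsP; exists x, w.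
  have cU : (#|Z u :|: Z v| <= #|diffs X|)%N.
    by apply/subset_leq_card; rewrite subUset !sZ.
  have cI : (#|Z u :&: Z v| <= #|Y h|)%N.
    rewrite -(card_imset (Z u :&: Z v) (@addIr G v)).
    apply/subset_leq_card/subsetP => _ /imsetP[z + ->]; rewrite inE.
    move=> /andP[/imsetP[x xX zx] /imsetP[y yX zy]]; rewrite inE {1}zy subrK yX /=.
    have -> : z + v + h = x by rewrite hE zx -addrA [v + _]addrC subrK subrK.
    exact: xX.
  have := cardsUI (Z u) (Z v); rewrite !cZ; move: cU cI hX.
  move: (#|Z u :|: Z v|) (#|Z u :&: Z v|) => a b; clear; lia.
move=> g h gH hH.
have nhH : - h \in diffs X.
  by move/diffsP: hH => [x [y [xX yX ->]]]; apply/diffsP; exists y, x; rewrite opprB.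
have /set0Pn[y] : Y g :&: Y (- h) != set0.
  apply/eqP => I0; have := cardsUI (Y g) (Y (- h)); rewrite I0 cards0.
  have : (#|Y g :|: Y (- h)| <= #|X|)%N.
    by apply/subset_leq_card; rewrite subUset; apply/andP; split; apply/subsetP => x; rewrite inE => /andP[].
  have := many _ gH; have := many _ nhH.
  move: (#|Y g :|: Y (- h)|) => a; clear; lia.
rewrite !inE => /andP[/andP[_ h1] /andP[_ h2]]; apply/diffsP.
by exists (y + g), (y - h); split => //; rewrite opprB [RHS]addrC addrA subrK addrC.
Qed.

End SmallDoubling.

(** Let [m] and [L] be the extreme elements and [X] the image of [B - m] modulo [L - m]. The
    positive differences of [B] avoid [B], so there are few of them; modulo [L - m] the nonzero
    elements of [X] are differences of both signs, which saves another [|X|]. This makes [X - X]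
    small enough to be a subgroup, and its index decides the alternative. *)
Theorem dense_sum_free n (B : {set 'I_n.+1}) :
  sum_free B -> 47 * n <= 100 * #|B| -> 100 <= n ->
  (forall x : 'I_n.+1, x \in B -> odd x) \/
  (forall x : 'I_n.+1, x \in B -> 3 * #|B| <= n + x + 1).
Proof.
move=> sB dense n100.
have [b0 b0B] : exists b, b \in B.
  by apply/card_gt0P; move: dense n100; clear; lia.
case: (arg_minnP (fun x : 'I_n.+1 => x : nat) b0B) => m mB' mmin.
case: (arg_maxnP (fun x : 'I_n.+1 => x : nat) b0B) => L LB' Lmax.
have {mB' LB'} [mB LB] : m \in B /\ L \in B by [].
have {}mmin (x : 'I_n.+1) : x \in B -> m <= x by apply: mmin.
have {}Lmax (x : 'I_n.+1) : x \in B -> x <= L by apply: Lmax.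
set k := #|B| in dense *.
have Ln : L <= n by rewrite -ltnS ltn_ord.
have B0 x : x \in B -> 0 < x.
  by move=> xB; have := subsetP (sum_free_interval sB) _ xB; rewrite inE.
have sBP := sum_freeP _ sB.
pose E := [set x : 'I_n.+1 | 0 < x <= L].
have cE : #|E| <= L.
  rewrite -(@card_in_imset _ _ (fun x : 'I_n.+1 => inord x.-1 : 'I_L.-1.+1)).
    by rewrite -[X in _ <= X](prednK (B0 _ LB)) -[X in _ <= X]card_ord max_card.
  move=> x y; rewrite !inE => /andP[x0 xL] /andP[y0 yL] /(congr1 (@nat_of_ord _)).
  rewrite !inordK; first by move=> xy; apply: ord_inj; move: x0 y0 xy; clear; lia.
    by move: y0 yL; clear; lia.
  by move: x0 xL; clear; lia.
pose D := [set x in E | [exists a in B, exists b in B, a + x == b]].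
have BE : B \subset E by apply/subsetP => x xB; rewrite inE B0 ?Lmax.
have cD : #|D| + k <= L.
  have dis : [disjoint D & B].
    rewrite -setI_eq0; apply/eqP/setP => x; rewrite !inE; apply/negbTE/negP.
    move=> /andP[/andP[_ /exists_inP[a aB /exists_inP[b bB /eqP abE]]] xB].
    exact: (sBP a x b).
  have := cardsUI D B; rewrite (disjoint_setI0 dis) cards0 addn0 => <-.
  apply: leq_trans cE; apply/subset_leq_card; rewrite subUset BE andbT.
  by apply/subsetP => x; rewrite inE => /andP[].
have cD' : k <= #|D|.+1.
  rewrite /k (cardsD1 m B) mB ltnS.
  rewrite -(@card_in_imset _ _ (fun x : 'I_n.+1 => inord (x - m) : 'I_n.+1)); last first.
    have lt (z : 'I_n.+1) : z - m < n.+1 by apply: leq_ltn_trans (ltn_ord z); apply: leq_subr.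
    move=> x y; rewrite !inE => /andP[_ xB] /andP[_ yB] /(congr1 (@nat_of_ord _)).
    rewrite !inordK ?lt // => e; apply: ord_inj.
    by move: (mmin _ xB) (mmin _ yB) e; clear; lia.
  apply/subset_leq_card/subsetP => y /imsetP[x]; rewrite !inE => /andP[xm xB] ->.
  have mx := mmin _ xB; have xL := Lmax _ xB; have xn := ltn_ord x.
  have ne : x != m :> nat by [].
  rewrite inordK; last by clear -xn; lia.
  apply/andP; split; first by move: mx xL ne; clear; lia.
  apply/exists_inP; exists m => //; apply/exists_inP; exists x => //.
  by apply/eqP; move: mx; clear; lia.
have hk : 47 * L <= 100 * k by move: dense Ln; clear; lia.
have kL : 47 <= L by move: dense cD cD' n100; clear; lia.
(* ['I_l.+1] is the group of integers modulo [L - m]; there [m] and [L] coincide, so [X] may have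
   one element fewer than [B]. *)
pose l := (L - m).-1.
have lE : l.+1 = L - m.
  have : m < L; last by rewrite /l; clear; lia.
  have [//|Lm] := ltnP m L.
  have B1 : B \subset [set m].
    apply/subsetP => x xB; rewrite inE; apply/eqP/ord_inj.
    by move: (mmin _ xB) (Lmax _ xB) Lm; clear; lia.
  by move: (subset_leq_card B1) hk kL; rewrite cards1 -/k; clear; lia.
have rl (r : 'I_l.+1) : r < L - m by rewrite -lE ltn_ord.
pose iz i : 'I_l.+1 := inZp i.
have izD i j : iz (i + j) = (iz i + iz j)%R.
  by apply: val_inj; rewrite /= modnDm.
have iz0 : iz 0 = 0%R by apply: val_inj; rewrite /= mod0n.
have izl : iz l.+1 = 0%R by apply: val_inj; rewrite /= modnn.
have izK (x : 'I_l.+1) : iz x = x by apply: val_inj; rewrite /= modn_small.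
pose X := [set iz (b - m) | b : 'I_n.+1 in B].
have mX : 0%R \in X by apply/imsetP; exists m; rewrite ?subnn ?iz0.
have cX : k <= #|X|.+1.
  rewrite /k (cardsD1 L B) LB ltnS.
  rewrite -(@card_in_imset _ _ (fun b : 'I_n.+1 => iz (b - m)) (B :\ L)).
    by apply/subset_leq_card/imsetS/subsetDl.
  have lt (z : 'I_n.+1) : z \in B :\ L -> z - m < l.+1.
    rewrite !inE lE => /andP[zL zB]; have zL' : z != L :> nat by [].
    by move: (mmin _ zB) (Lmax _ zB) zL'; clear; lia.
  move=> x y xB yB /(congr1 (@nat_of_ord _)); rewrite /= !modn_small ?lt // => e.
  move: xB yB; rewrite !inE => /andP[_ xB] /andP[_ yB]; apply: ord_inj.
  by move: (mmin _ xB) (mmin _ yB) e; clear; lia.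
pose D1 := [set r : 'I_l.+1 | (r != 0)%R && [exists a in B, exists b in B, a + r == b]].
pose N1 := [set (- r)%R | r in D1].
have cD1 : #|D1| < #|D|.
  have LmD : inord (L - m) \in D.
    rewrite !inE inordK; last by move: Ln; clear; lia.
    apply/andP; split; first by rewrite -lE; move: lE; clear; lia.
    apply/exists_inP; exists m => //; apply/exists_inP; exists L => //.
    by apply/eqP; move: lE; clear; lia.
  rewrite (cardsD1 (inord (L - m)) D) LmD ltnS.
  have ln (r : 'I_l.+1) : r < n.+1 by move: (rl r) Ln; clear; lia.
  rewrite -(@card_in_imset _ _ (fun r : 'I_l.+1 => inord r : 'I_n.+1)).
    apply/subset_leq_card/subsetP => _ /imsetP[r + ->].
    rewrite 3!inE => /andP[r0 rD]; rewrite !inE !inordK //.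
    apply/and3P; split => //.
    - apply/eqP => /(congr1 (@nat_of_ord _)); rewrite !inordK //.
        by move=> e; have := rl r; rewrite e ltnn.
      by move: Ln; clear; lia.
    - have : 0 < r by rewrite lt0n; apply: contra r0 => /eqP r0; apply/eqP/val_inj.
      by move=> ->; move: (rl r); clear; lia.
  move=> r s _ _ /(congr1 (@nat_of_ord _)); rewrite !inordK //.
  exact: ord_inj.
have izD1 (a b : 'I_n.+1) : a \in B -> b \in B -> a < b -> iz (b - a) != 0%R -> iz (b - a) \in D1.
  move=> aB bB ab ne; rewrite inE ne /=; apply/exists_inP; exists a => //.
  apply/exists_inP; exists b => //.
  have lt : b - a < l.+1.
    have : b - a != L - m.
      by apply/eqP => e; move: ne; rewrite e -lE izl eqxx.
    by rewrite lE; move: (mmin _ aB) (Lmax _ bB); clear; lia.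
  by rewrite /= modn_small //; apply/eqP; move: ab; clear; lia.
have izB (a b : 'I_n.+1) : a \in B -> b \in B -> a <= b -> iz (b - a) = (iz (b - m)%N - iz (a - m)%N)%R.
  move=> aB _ ab; have -> : b - m = (b - a) + (a - m).
    by move: (mmin _ aB) ab; clear; lia.
  by rewrite izD addrK.
have diffE : diffs X \subset 0%R |: (D1 :|: N1).
  apply/subsetP => h /diffsP[x [y [/imsetP[b bB ->] /imsetP[a aB ->] ->]]].
  rewrite in_setU1 inE; have [//|ne] := eqVneq (iz (b - m)%N - iz (a - m)%N)%R 0%R.
  case: (ltngtP a b) => ab.
  - by rewrite -izB ?(ltnW ab) // in ne *; rewrite izD1 // orbT.
  - have ne' : iz (a - b) != 0%R.
      by rewrite izB ?(ltnW ab) // -oppr_eq0 opprB.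
    rewrite [_ \in N1](_ : _ = true) ?orbT //; apply/imsetP.
    by exists (iz (a - b)); rewrite ?izD1 // (izB b a) ?(ltnW ab) // opprB.
  - by move: ne; rewrite ab subrr eqxx.
have cN : #|N1| = #|D1| by apply: card_imset; apply: oppr_inj.
(* For [m < b < L] the residue of [b - m] is also the opposite of that of [L - b]. *)
have cI : #|X| <= #|D1 :&: N1|.+1.
  rewrite (cardsD1 0%R) mX ltnS; apply/subset_leq_card/subsetP => x.
  rewrite in_setD1 => /andP[x0 /imsetP[b bB xE]]; rewrite in_setI.
  have mb : m < b.
    have := mmin _ bB; rewrite leq_eqVlt => /orP[/eqP mb|//].
    by move: x0; rewrite xE mb subnn iz0 eqxx.
  have bL : b < L.
    have := Lmax _ bB; rewrite leq_eqVlt => /orP[/eqP Lb|//].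
    by move: x0; rewrite xE Lb -lE izl eqxx.
  rewrite xE izD1 -?xE //=; apply/imsetP; exists (iz (L - b)); last first.
    apply/eqP; rewrite -addr_eq0 xE -izD (_ : b - m + (L - b) = l.+1) ?izl //.
    by rewrite lE; move: mb bL; clear; lia.
  apply: izD1 => //; apply: contra x0 => /eqP e.
  have := izD (b - m) (L - b); rewrite e GRing.addr0 xE => <-.
  by rewrite (_ : b - m + (L - b) = l.+1) ?izl // lE; move: mb bL; clear; lia.
have cH : #|diffs X| + 3 * k <= 2 * L + 1.
  have h1 : #|diffs X| <= 1 + #|D1 :|: N1|.
    apply: (leq_trans (subset_leq_card diffE)); apply: (leq_trans (leq_card_setU _ _)).
    by rewrite cards1.
  have h2 := cardsUI D1 N1; rewrite cN in h2.
  by move: cD cD' cD1 cX cI h1 h2; clear; lia.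
have closed : {in diffs X &, forall g h, (g + h)%R \in diffs X}.
  have hX : 2 * #|diffs X| < 3 * #|X| by move: cH cX hk kL; clear; lia.
  exact: diffs_closed.
have H0 : 0%R \in diffs X by apply/diffsP; exists 0%R, 0%R; rewrite subr0.
have Hopp h : h \in diffs X -> (- h)%R \in diffs X.
  by move/diffsP => [x [y [xX yX ->]]]; apply/diffsP; exists y, x; rewrite opprB.
have XH x : x \in X -> x \in diffs X.
  by move=> xX; apply/diffsP; exists x, 0%R; rewrite subr0.
(* The least positive [g] with residue in the subgroup divides [b - m] for all [b] in [B]. If it is
   1, the subgroup is the whole group and [cH] gives the second alternative; if it is at least 3,
   [B] has too few elements; if it is 2, all of [B] has one parity. *)
have ex : exists g, (0 < g) && (iz g \in diffs X) by exists l.+1; rewrite izl H0.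
case: (ex_minnP ex) => g /andP[g0 gH] gmin.
have gdiv i : iz i \in diffs X -> g %| i.
  elim/ltn_ind: i => i IH iH; have [ig|gi] := ltnP i g.
    have [->|i0] := posnP i; first exact: dvdn0.
    by have := gmin i; rewrite i0 iH => /(_ isT); rewrite leqNgt ig.
  rewrite -(subnK gi) dvdn_addl // IH //; first by move: gi g0; clear; lia.
  have -> : iz (i - g) = (iz i - iz g)%R by apply/eqP; rewrite eq_sym subr_eq -izD subnK.
  by apply: closed => //; apply: Hopp.
have gB (b : 'I_n.+1) : b \in B -> g %| b - m by move=> bB; apply/gdiv/XH/imset_f.
have [g1|g2] := leqP g 1.
  right=> x xB; have mx := mmin _ xB.
  have allH i : iz i \in diffs X.
    elim: i => [|i IH]; first by rewrite iz0.
    have -> : iz i.+1 = (iz i + iz 1%N)%R by rewrite -izD addn1.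
    apply: closed => //; have <- : g = 1 by (move: g0 g1; clear; lia).
    exact: gH.
  have : #|diffs X| = l.+1.
    by rewrite -[RHS]card_ord -cardsT; congr #|pred_of_set _|; apply/setP => y; rewrite inE -(izK y) allH.
  by move: cH lE mx Ln; clear; lia.
left.
have [g3|g2'] := ltnP 2 g.
  exfalso; have : k <= (L %/ 3).+1.
    rewrite /k -[X in _ <= X]card_ord -cardsT.
    rewrite -(@card_in_imset _ _ (fun b : 'I_n.+1 => inord ((b - m) %/ g) : 'I_(L %/ 3).+1)).
      by apply/subset_leq_card/subsetT.
    have lt (b : 'I_n.+1) : b \in B -> (b - m) %/ g < (L %/ 3).+1.
      move=> bB; rewrite ltnS; apply: (@leq_trans ((b - m) %/ 3)).
        by apply: leq_div2l.
      by apply: leq_div2r; move: (Lmax _ bB); clear; lia.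
    move=> x y xB yB /(congr1 (@nat_of_ord _)); rewrite !inordK ?lt // => /(congr1 (muln^~ g)).
    rewrite /= !divnK ?gB // => e; apply: ord_inj.
    by move: (mmin _ xB) (mmin _ yB) e; clear; lia.
  by have := leq_trunc_div L 3; move: hk kL; clear; lia.
have gE : g = 2 by move: g2 g2'; clear; lia.
have par (b : 'I_n.+1) : b \in B -> odd b = odd m.
  move=> bB; have := gB _ bB; rewrite gE dvdn2 oddB ?mmin //.
  by case: (odd b); case: (odd m).
have [om|em] := boolP (odd m); first by move=> x /par ->.
(* If [B] is even, so are its differences, and the disjoint sets [D] and [B] would hold at least
   [2 k - 1] even numbers up to [L]. *)
exfalso; have : #|D :|: B| <= (L %/ 2).
  pose Z := [set z : 'I_(L %/ 2).+1 | z != ord0].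
  have cZ : #|Z| = L %/ 2.
    have := cardsD1 (ord0 : 'I_(L %/ 2).+1) setT; rewrite cardsT card_ord in_setT add1n.
    by case=> e; apply: etrans (esym e); apply: eq_card => z; rewrite !inE andbT.
  rewrite -[leqRHS]cZ.
  have ev (x : 'I_n.+1) : x \in D :|: B -> ~~ odd x /\ 0 < x <= L.
    rewrite inE => /orP[|xB]; last by rewrite par ?B0 ?Lmax.
    rewrite !inE => /andP[-> /exists_inP[a aB /exists_inP[b bB /eqP abE]]].
    have := par _ aB; have := par _ bB; rewrite -abE oddD (negbTE em).
    by case: (odd a); case: (odd x).
  have lt (x : 'I_n.+1) : x \in D :|: B -> x %/ 2 < (L %/ 2).+1.
    by move/ev => [_ /andP[_ xL]]; rewrite ltnS leq_div2r.
  rewrite -(@card_in_imset _ _ (fun x : 'I_n.+1 => inord (x %/ 2) : 'I_(L %/ 2).+1)).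
    apply/subset_leq_card/subsetP => _ /imsetP[x xDB ->]; rewrite inE.
    apply/eqP => /(congr1 (@nat_of_ord _)); rewrite inordK ?lt //=.
    by move: (ev _ xDB); clear; lia.
  move=> x y xDB yDB /(congr1 (@nat_of_ord _)); rewrite !inordK ?lt //.
  move: (ev _ xDB) (ev _ yDB) => h1 h2 h3; apply: ord_inj; move: h1 h2 h3; clear; lia.
have dis : [disjoint D & B].
  rewrite -setI_eq0; apply/eqP/setP => x; rewrite !inE; apply/negbTE/negP.
  move=> /andP[/andP[_ /exists_inP[a aB /exists_inP[b bB /eqP abE]]] xB].
  exact: (sBP a x b).
have := cardsUI D B; rewrite (disjoint_setI0 dis) cards0 addn0 => ->.
have := leq_trunc_div L 2.
by move: cD' hk kL; rewrite -/k; clear; lia.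
Qed.

(** * Exponentially small quantities *)

Local Open Scope ring_scope.

(** 1.443 slightly exceeds the cube root of 3; from [k = 3] on, the induction step only needs
    [3 * 0.443 >= 1]. *)
Lemma moon_moser_base (R : realFieldType) k : (0 < k)%N -> k%:R <= (1443 / 1000) ^+ k :> R.
Proof.
have step : forall j, 3 + j%:R <= (1443 / 1000 : R) ^+ (3 + j).
  elim=> [|j IH]; first by rewrite addr0 addn0 !exprS expr0; lra.
  rewrite addnS exprSr -[j.+1%:R]natr1; have : 0 <= j%:R :> R by [].
  by move: (j%:R) ((1443 / 1000) ^+ _) IH => x y; lra.
case: k => [//|[_|[_|k _]]]; [rewrite expr1; lra | rewrite expr2; lra |].
by have := step k; rewrite -natrD.
Qed.

Lemma ler_expn (R : realDomainType) (x y : R) n : 0 <= x -> x <= y -> x ^+ n <= y ^+ n.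
Proof. by move=> x0 xy; apply: lerXn2r; rewrite ?nnegrE // (le_trans x0). Qed.

Section Small.
Variables (R : archiRealFieldType) (a : R).

(** Negligible relative to [a ^+ n], which is [2^(n/4)], by an exponential factor. *)
Definition expsmall (f : nat -> nat) := exists t : R, 0 < t < 1 /\
  exists n0, forall n, (n0 <= n)%N -> (f n)%:R <= (t * a) ^+ n.

Hypotheses (a0 : 0 < a) (a4 : a ^+ 4 = 2).

Lemma expsmall_const f (C t : R) : 0 < t < 1 ->
  (exists n0, forall n, (n0 <= n)%N -> (f n)%:R <= C * (t * a) ^+ n) -> expsmall f.
Proof.
move=> /andP[t0 t1] [n0 hn].
have u1 : 1 < t^-1 by rewrite invf_gt1.
have [v v1 hv] := expr_root 2 u1.
have v0 : 0 < v by apply: lt_trans v1.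
have [q _ hq] := expr_unbounded C v1.
exists (t * v); split.
  rewrite mulr_gt0 //= -(ltr_pM2l (v0)); have : v ^+ 2 * t <= 1.
    by rewrite -(mulVf (lt0r_neq0 t0)) ler_pM2r.
  by rewrite expr2 mulr1 mulrCA mulrC => h; apply: le_lt_trans v1.
exists (n0 + q)%N => n nq; apply: (le_trans (hn n _)); first by move: nq; clear; lia.
rewrite (_ : t * v * a = v * (t * a)); last by ring.
rewrite [leRHS]exprMn; apply: ler_wpM2r; first by rewrite exprn_ge0 // mulr_ge0 // ltW.
apply: (le_trans hq); apply: ler_weXn2l; [exact: ltW | move: nq; clear; lia].
Qed.

Lemma expsmall_le f g : (exists n0, forall n, (n0 <= n)%N -> (f n <= g n)%N) ->
  expsmall g -> expsmall f.
Proof.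
move=> [n1 h1] [t [t01 [n0 hn]]]; exists t; split => //; exists (n0 + n1)%N => n nn.
by apply: le_trans (hn n _); rewrite ?ler_nat ?h1 //; move: nn; clear; lia.
Qed.

Lemma expsmall_add f g : expsmall f -> expsmall g -> expsmall (fun n => f n + g n)%N.
Proof.
move=> [t [/andP[t0 t1] [n0 hn]]] [t' [/andP[t0' t1'] [n0' hn']]].
apply: (@expsmall_const _ 2 (Num.max t t')).
  by rewrite lt_max t0 /= gt_max t1.
exists (n0 + n0')%N => n nn; rewrite natrD mulr_natl mulr2n.
have mono x : 0 < x -> x <= Num.max t t' -> (x * a) ^+ n <= (Num.max t t' * a) ^+ n.
  move=> x0 xm; have m0 := lt_le_trans x0 xm.
  by apply: ler_expn; [apply: mulr_ge0; exact: ltW | apply: ler_wpM2r => //; exact: ltW].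
apply: lerD.
  by apply: le_trans (hn _ _) (mono _ t0 _); [move: nn; clear; lia | rewrite le_max lexx].
by apply: le_trans (hn' _ _) (mono _ t0' _); [move: nn; clear; lia | rewrite le_max lexx orbT].
Qed.

(* Absorbs subexponential factors: the bound may carry [u ^+ n] for every [u > 1]. *)
Lemma expsmall_sub f (t : R) : 0 < t < 1 ->
  (forall u : R, 1 < u -> exists n0, forall n, (n0 <= n)%N -> (f n)%:R <= u ^+ n * (t * a) ^+ n) ->
  expsmall f.
Proof.
move=> /andP[t0 t1] h; have u1 : 1 < t^-1 by rewrite invf_gt1.
have [u u1' hu] := expr_root 2 u1; have u0 : 0 < u by apply: lt_trans u1'.
have [n0 hn] := h u u1'; exists (u * t); split.
  rewrite mulr_gt0 //= -(ltr_pM2l u0).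
  have : u ^+ 2 * t <= 1 by rewrite -(mulVf (lt0r_neq0 t0)) ler_pM2r.
  by rewrite expr2 mulrA mulr1 => h'; apply: le_lt_trans h' u1'.
exists n0 => n /hn; rewrite -exprMn mulrA.
by [].
Qed.

Lemma expsmall_muln f : expsmall f -> expsmall (fun n => n.+1 * f n)%N.
Proof.
move=> [t [t01 [n0 hn]]]; apply: (expsmall_sub t01) => u u1.
have [m hm] := nat_le_expr u1.
have u0 : 0 < u by apply: lt_trans u1.
have [w w1 hw] := expr_root 2 u1; have [m' hm'] := nat_le_expr w1.
have [q _ hq] := expr_unbounded w w1.
exists (n0 + m' + q + 1)%N => n nn; rewrite natrM; apply: ler_pM => //; last first.
  by apply: hn; move: nn; clear; lia.
apply: (@le_trans _ _ (w ^+ n.+1)); first by apply: hm'; move: nn; clear; lia.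
apply: (@le_trans _ _ (w ^+ (2 * n))).
  by apply: ler_weXn2l; [exact: ltW | move: nn; clear; lia].
by rewrite exprM; apply: ler_expn => //; apply/exprn_ge0/ltW/(lt_trans _ w1).
Qed.

(** After raising to the power 100 this is [1.443^47 < 2^25], the inequality that makes 0.47 an
    admissible density threshold. It is checked through the powers 3, 15 and 45, rounding up each
    time. *)
Lemma moon_moser_gap : exists2 t : R, 0 < t < 1 &
  forall k n, (100 * k <= 47 * n)%N -> (1443 / 1000 : R) ^+ k <= (t * a) ^+ n.
Proof.
pose c : R := 1443 / 1000.
have c0 : 0 < c by rewrite /c; lra.
have c3 : c ^+ 3 <= 3005 / 1000 by rewrite /c !exprS expr0; lra.
have c15 : c ^+ 15 <= 246.
  rewrite (_ : 15 = 3 * 5)%N // exprM; apply: (@le_trans _ _ ((3005 / 1000) ^+ 5)).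
    by apply: ler_expn => //; apply/exprn_ge0/ltW.
  by rewrite !exprS expr0; lra.
have c47 : c ^+ 47 < 2 ^+ 25.
  have c45 : c ^+ 45 <= 246 ^+ 3.
    by rewrite (_ : 45 = 15 * 3)%N // exprM; apply: ler_expn => //; apply/exprn_ge0/ltW.
  have c2 : c ^+ 2 <= 2083 / 1000 by rewrite /c expr2; lra.
  apply: (@le_lt_trans _ _ (246 ^+ 3 * (2083 / 1000))); last by rewrite !exprS expr0; lra.
  rewrite (_ : 47 = 45 + 2)%N // exprD; apply: ler_pM => //; exact/exprn_ge0/ltW.
have c470 : 0 < c ^+ 47 by rewrite exprn_gt0.
have u1 : 1 < 2 ^+ 25 / c ^+ 47 by rewrite ltr_pdivlMr // mul1r.
have [v v1 hv] := expr_root 100 u1; have v0 : 0 < v by apply: lt_trans v1.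
exists v^-1; first by rewrite invr_gt0 v0 invf_lt1.
move=> k n kn; rewrite -/c -(@ler_pXn2r _ 100) // ?nnegrE; last 2 first.
- exact/exprn_ge0/ltW.
- by apply: exprn_ge0; apply: mulr_ge0; [rewrite invr_ge0|]; exact: ltW.
rewrite -exprM; apply: (@le_trans _ _ (c ^+ (47 * n))).
  by apply: ler_weXn2l; [rewrite /c; lra | rewrite mulnC].
rewrite (exprM c) -[leRHS]exprM [X in _ <= _ ^+ X]mulnC [leRHS]exprM.
apply: ler_expn; first exact: ltW.
have a100 : a ^+ 100 = 2 ^+ 25 by rewrite -a4 -exprM.
rewrite [leRHS]exprMn a100 exprVn.
by rewrite mulrC ler_pdivlMr ?exprn_gt0 // mulrC -ler_pdivlMr //.
Qed.

End Small.

(** * Sets of mostly odd numbers *)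

Section GraphBounds.
Variables (R : realFieldType) (T : finType) (e : rel T).
Hypotheses (esy : symmetric e) (eirr : irreflexive e).
Implicit Types (O V W C I : {set T}).

Let deg O x := #|[set y in O | e x y]|.

(** Each remaining point has at least [d - h] neighbours among the covered points, each of which
    receives at most [D] edges; the two sets are disjoint in [O]. *)
Lemma fingerprint_size O (P : {set T}) d D h : (h <= d)%N ->
  (forall x, x \in O -> (d <= deg O x <= D)%N) ->
  (#|[set v in O :\: nbhd e P | (#|[set y in O :\: nbhd e P | e v y]| < h)%N]|
    * (d + D - h) <= D * #|O|)%N.
Proof.
move=> hd hdeg; set U := O :\: _; set C := [set v in U | _].
have CO : C \subset O by apply/subsetP => x; rewrite !inE => /andP[/andP[_ ->]].
have UO : U \subset O by apply: subsetDl.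
have h1 : (#|C| * (d - h) <= \sum_(x in C) \sum_(y in O :\: U) e x y)%N.
  rewrite -sum_nat_const; apply: leq_sum => x xC.
  have xO := subsetP CO _ xC; move: (xC); rewrite inE => /andP[_ hx].
  have /andP[hd1 _] := hdeg _ xO.
  have -> : (\sum_(y in O :\: U) e x y = #|[set y in O :\: U | e x y]|)%N.
    rewrite -sum1_card big_mkcond [RHS]big_mkcond; apply: eq_bigr => y _ /=.
    by rewrite inE; case: (y \in _); case: (e x y).
  have : (deg O x <= #|[set y in U | e x y]| + #|[set y in O :\: U | e x y]|)%N.
    apply: leq_trans (leq_card_setU _ _); apply/subset_leq_card/subsetP => y.
    by rewrite !inE => /andP[-> ->]; rewrite !andbT; case: [exists _ in _, _].
  by move: hx hd1; clear; lia.
have h2 : (\sum_(x in C) \sum_(y in O :\: U) e x y <= D * #|O :\: U|)%N.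
  rewrite exchange_big mulnC -sum_nat_const; apply: leq_sum => y; rewrite inE => /andP[_ yO].
  have /andP[_ hD] := hdeg _ yO; apply: leq_trans hD.
  rewrite /deg -sum1_card [leqLHS]big_mkcond [leqRHS]big_mkcond; apply: leq_sum => x _.
  rewrite inE esy; case: ifP => // /(subsetP CO) ->.
  by case: (e y x).
have h3 : (#|C| + #|O :\: U| <= #|O|)%N.
  have := cardsID U O; rewrite (setIidPr UO) => <-; rewrite leq_add2r.
  by apply/subset_leq_card/subsetP => x; rewrite inE => /andP[].
by move: h1 h2 h3 hd; clear; nia.
Qed.

(** All maximal independent sets with the same fingerprint live on at most [B] points, where
    Moon-Moser applies. *)
Lemma nmis_fingerprint (c : R) O V d D h B :
    (forall k, (0 < k)%N -> k%:R <= c ^+ k) -> (0 < h <= d)%N -> V \subset O ->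
    (forall x, x \in O -> (d <= deg O x <= D)%N) ->
    (forall k, (k * (d + D - h) <= D * #|O|)%N -> (k <= B)%N) ->
  (nmis e V)%:R <= #|small_sets T (#|O| %/ h)|%:R * c ^+ B.
Proof.
move=> hc /andP[h0 hd] VO hdeg hB.
have c1 : 1 <= c by have := hc 1%N isT; rewrite expr1.
pose ok I (P : {set T}) := [&& P \subset I, (#|P| <= #|O| %/ h)%N &
   [forall v in I, (#|[set y in O :\: nbhd e P | e v y]| < h)%N]].
pose f I := odflt set0 [pick P | ok I P].
have fP I : mis e V I -> ok I (f I).
  move=> /misP[IV Iind _]; rewrite /f; case: pickP => [//|no].
  have [P [PI Pc Pd]] := @greedy_fingerprint _ e O I h h0 Iind.
  have := no P; rewrite /ok PI leq_divRL // Pc /=.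
  by have -> : [forall v in I, (#|[set y in O :\: nbhd e P | e v y]| < h)%N] by apply/'forall_implyP.
apply: (@card_fibers _ _ _ _ _ f) => [I|P _].
  by rewrite !inE => /fP /and3P[].
pose U := O :\: nbhd e P; pose C := [set v in U | (#|[set y in U | e v y]| < h)%N].
apply: (@le_trans _ _ (nmis e (C :&: V))%:R).
  rewrite ler_nat; apply/subset_leq_card/subsetP => I; rewrite !inE => /andP[Im /eqP fI].
  have := fP _ Im; rewrite fI => /and3P[PI _ /'forall_implyP Pd].
  have /misP[IV Iind Idom] := Im.
  have IU : I \subset U.
    apply/subsetP => x xI; rewrite !inE (subsetP VO) ?(subsetP IV) // andbT.
    by apply/existsP => -[y /andP[yP]]; apply/negP/Iind => //; apply: (subsetP PI).
  apply/misP; split => //.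
    by apply/subsetP => x xI; rewrite inE (subsetP IV) // andbT inE (subsetP IU) //= Pd.
  by move=> x; rewrite inE => /andP[_ xV]; apply: Idom.
apply: (le_trans (moon_moser hc esy _)); apply: ler_weXn2l => //.
apply: (@leq_trans #|C|); first exact/subset_leq_card/subsetIl.
by apply/hB/fingerprint_size.
Qed.

(** Once the trace on [W] is guessed, [W] and the neighbours of the trace disappear: at most
    [|W| (D + 1)] points, hence at most as many paths. *)
Lemma nmis_hit (s g : R) V W q D :
    0 < s -> s ^+ 2 = 2 -> s * g = 7 / 5 -> g <= 1 ->
    W \subset V -> triangle_free e (V :\: W) -> pack e V q ->
    (forall x, (#|[set y | e x y]| <= D)%N) ->
  (nmis e V)%:R <= 2 ^+ #|W| * (s ^+ #|V| * g ^+ (q - #|W| * D.+1)).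
Proof.
move=> s0 s2 sg g1 WV tW pV hD.
have s1 : 1 <= s.
  rewrite leNgt; apply/negP => lt; have : s * s < 1 * 1 by apply: ltr_pM; rewrite // ltW.
  by rewrite -expr2 s2; lra.
have g0 : 0 < g by have : 0 < s * g by [rewrite sg; lra]; rewrite pmulr_rgt0.
have -> : 2 ^+ #|W| = #|powerset W|%:R :> R by rewrite card_powerset natrX.
apply: (@card_fibers _ _ _ _ _ (fun I => I :&: W)) => [I _|W'].
  by rewrite inE subsetIr.
rewrite inE => WW'; have W'V := subset_trans WW' WV.
pose X := W' :|: nbhd e W' :|: (W :\: W').
apply: (@le_trans _ _ (nmis e (V :\: X))%:R).
  rewrite ler_nat; apply: leq_trans (nmis_restrict esy (W :\: W') W'V).
  apply/subset_leq_card/subsetP => I; rewrite !inE => /andP[-> /eqP <-] /=.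
  rewrite subsetIl -setI_eq0; apply/eqP/setP => x; rewrite !inE.
  by case: (x \in I); case: (x \in W).
have cX : (#|V :&: X| <= #|W| * D.+1)%N.
  apply: (@leq_trans #|W :|: nbhd e W'|).
    apply/subset_leq_card/subsetP => x; rewrite !inE => /andP[_].
    by move=> /orP[/orP[/(subsetP WW') ->|->]|/andP[_ ->]]; rewrite ?orbT.
  apply: (leq_trans (leq_card_setU _ _)); rewrite mulnS leq_add2l.
  apply: (@leq_trans (\sum_(w in W') #|[set y | e w y]|)%N).
    have -> : nbhd e W' = \bigcup_(w in W') [set y | e w y].
      apply/setP => y; rewrite inE; apply/exists_inP/bigcupP => -[w wW'].
        by move=> ewy; exists w; rewrite ?inE.
      by rewrite inE => ewy; exists w.
    elim/big_ind2: _ => [|A1 x1 A2 x2 h1 h2|S _] //; first by rewrite cards0.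
    by apply: (leq_trans (leq_card_setU _ _)); apply: leq_add.
  apply: (@leq_trans (\sum_(w in W') D)%N); first by apply: leq_sum.
  by rewrite sum_nat_const leq_mul2r subset_leq_card ?orbT.
have VX : V :\: (V :&: X) = V :\: X by rewrite setDIr setDv set0U.
have pX := pack_del (V :&: X) pV; rewrite VX in pX.
apply: (le_trans (hujter_tuza esy eirr s0 s2 sg _ (pack_le (leq_sub2l q cX) pX))).
  apply: triangle_freeS tW; apply/subsetP => x; rewrite !inE.
  case: (x \in V); rewrite ?andbF // !andbT; apply: contra => xW.
  by rewrite xW andbT; case: (x \in W') => //=; rewrite orbT.
apply: ler_pM; try by apply: exprn_ge0; apply: ltW.
  by apply: ler_weXn2l => //; apply/subset_leq_card/subsetDl.
by [].
Qed.

End GraphBounds.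

Local Close Scope ring_scope.

Section LinkTriangles.
Variables (n : nat) (S : {set 'I_n.+1}).
Hypothesis sS : sum_free S.
Local Notation T := 'I_n.+1.

(** An edge of the link graph reads [x + y = a] or [|x - y| = a]. If an even number of the edges of
    a triangle are sums, the three labels form a Schur triple in [S]; if an odd number are, twice
    some vertex is a signed sum of the labels. These are the possible such vertices. *)
Definition tri_point (x : T) := [exists a in S, exists b in S, exists c in S,
  [|| x + x + b == a + c, x + x + b + c == a | x + x == a + b + c]].

Lemma card_tri_point : #|[set x | tri_point x]| <= 3 * #|S| ^ 3.
Proof.
pose f (p : T * T * T * 'I_3) : T :=
  inord (if p.2 == 0 :> nat then (p.1.1.1 + p.1.2 - p.1.1.2) %/ 2
    else if p.2 == 1 :> nat then (p.1.1.1 - p.1.1.2 - p.1.2) %/ 2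
    else (p.1.1.1 + p.1.1.2 + p.1.2) %/ 2).
pose P := setX (setX (setX S S) S) [set: 'I_3].
apply: (@leq_trans #|f @: P|); last first.
  by apply: (leq_trans (leq_imset_card _ _)); rewrite !cardsX cardsT card_ord mulnC leq_mul2l /= !expnS expn0 muln1 mulnA.
apply/subset_leq_card/subsetP => x; rewrite inE.
move=> /exists_inP[a aS /exists_inP[b bS /exists_inP[c cS h]]].
have fE (j : 'I_3) y : y = x :> nat -> f (a, b, c, j) = inord y -> x \in f @: P.
  by move=> yx fj; apply/imsetP; exists (a, b, c, j); rewrite ?inE ?aS ?bS ?cS // fj yx inord_val.
case/or3P: h => /eqP h.
- apply: (fE (inord 0) ((a + c - b) %/ 2)); first by move: h; clear; lia.
  by rewrite /f /= inordK.
- apply: (fE (inord 1) ((a - b - c) %/ 2)); first by move: h; clear; lia.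
  by rewrite /f /= inordK.
- apply: (fE (inord 2) ((a + b + c) %/ 2)); first by move: h; clear; lia.
  by rewrite /f /= inordK.
Qed.

Lemma lk_triangle_free (V : {set T}) : triangle_free (lk S) (V :\: [set x | tri_point x]).
Proof.
have sP := sum_freeP _ sS.
have pt (x a b c : T) : a \in S -> b \in S -> c \in S ->
   [\/ x + x + b = a + c, x + x + b + c = a | x + x = a + b + c] -> tri_point x.
  move=> aS bS cS h; apply/exists_inP; exists a => //; apply/exists_inP; exists b => //.
  apply/exists_inP; exists c => //; apply/or3P.
  by case: h => h; [apply: Or31 | apply: Or32 | apply: Or33]; apply/eqP.
move=> x y z; rewrite !inE => /andP[nx _] /andP[ny _] /andP[nz _].
move=> /andP[_ /exists_inP[a aS axy]] /andP[_ /exists_inP[b bS byz]] /andP[_ /exists_inP[c cS cxz]].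
have no (v : T) : ~~ tri_point v -> forall p q r, p \in S -> q \in S -> r \in S ->
   [/\ v + v + q <> p + r :> nat, v + v + q + r <> p :> nat & v + v <> p + q + r :> nat].
  move=> nv p q r pS qS rS; split=> h; case/negP: nv; apply: (pt _ p q r) => //;
  by [apply: Or31 | apply: Or32 | apply: Or33].
have X := no _ nx; have Y := no _ ny; have Z := no _ nz.
move: axy byz cxz; rewrite /schur_rel.
have aux (P : T -> T -> T -> Prop) : (forall p q r, p \in S -> q \in S -> r \in S -> P p q r) ->
  [/\ P a b c, P b c a & P c a b] by move=> h; split; apply: h.
have {sP}[s1 s2 s3] := aux _ sP.
have {X}[[x1 x2 x3] [x4 x5 _] [x7 x8 _]] := aux _ X.
have {Y}[[y1 y2 y3] [y4 y5 _] [y7 y8 _]] := aux _ Y.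
have {Z}[[z1 z2 z3] [z4 z5 _] [z7 z8 _]] := aux _ Z.
case/or3P => /eqP e1; case/or3P => /eqP e2; case/or3P => /eqP e3; exfalso; first
 [ apply: s1; move: e1 e2 e3; clear; lia
 | apply: s2; move: e1 e2 e3; clear; lia
 | apply: s3; move: e1 e2 e3; clear; lia
 | apply: x1; move: e1 e2 e3; clear; lia
 | apply: x2; move: e1 e2 e3; clear; lia
 | apply: x3; move: e1 e2 e3; clear; lia
 | apply: x4; move: e1 e2 e3; clear; lia
 | apply: x5; move: e1 e2 e3; clear; lia
 | apply: x7; move: e1 e2 e3; clear; lia
 | apply: x8; move: e1 e2 e3; clear; lia
 | apply: y1; move: e1 e2 e3; clear; lia
 | apply: y2; move: e1 e2 e3; clear; lia
 | apply: y3; move: e1 e2 e3; clear; lia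
 | apply: y4; move: e1 e2 e3; clear; lia
 | apply: y5; move: e1 e2 e3; clear; lia
 | apply: y7; move: e1 e2 e3; clear; lia
 | apply: y8; move: e1 e2 e3; clear; lia
 | apply: z1; move: e1 e2 e3; clear; lia
 | apply: z2; move: e1 e2 e3; clear; lia
 | apply: z3; move: e1 e2 e3; clear; lia
 | apply: z4; move: e1 e2 e3; clear; lia
 | apply: z5; move: e1 e2 e3; clear; lia
 | apply: z7; move: e1 e2 e3; clear; lia
 | apply: z8; move: e1 e2 e3; clear; lia ].
Qed.

Lemma lk_degree x : #|[set y | lk S x y]| <= 3 * #|S|.
Proof.
apply: leq_trans (lnk_nb S x); rewrite -sum1_card big_mkcond; apply: leq_sum => y _.
by rewrite inE /lk; case: (x != y); case: (lnk S x y).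
Qed.

End LinkTriangles.

Local Close Scope ring_scope.

(** * Link graphs of even sets on the odd numbers *)

Section Odds.
Variable n : nat.
Local Notation T := 'I_n.+1.

Definition odds : {set T} := [set x : T | odd x].

Lemma odds_sum_free : sum_free odds.
Proof.
apply/sum_freeP => x y z; rewrite !inE => ox oy oz e.
by move: oz; rewrite -e oddD ox oy.
Qed.

Lemma card_odd_lt k : k <= n.+1 -> #|[set x : T | odd x && (x < k)]| = k %/ 2.
Proof.
move=> kn; have lt (i : 'I_(k %/ 2)) : 2 * i + 1 < n.+1.
  by have := ltn_ord i; move: kn; clear; lia.
have -> : [set x : T | odd x && (x < k)] = [set (inord (2 * i + 1) : T) | i : 'I_(k %/ 2)].
  apply/setP => x; rewrite inE; apply/andP/imsetP => [[ox xk]|[i _ ->]].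
    have xi : x %/ 2 < k %/ 2 by move: ox xk; clear; lia.
    exists (Ordinal xi) => //; rewrite (_ : 2 * Ordinal xi + 1 = x) ?inord_val //=.
    by move: ox; clear; lia.
  by rewrite inordK ?lt // addn1 /= mul2n odd_double; have := ltn_ord i; clear; lia.
rewrite card_imset ?card_ord // => i j /(congr1 (@nat_of_ord _)).
by rewrite !inordK ?lt // => e; apply: ord_inj; move: e; clear; lia.
Qed.

Lemma card_odds : 2 * #|odds| <= n.+1.
Proof.
have := card_odd_lt (leqnn n.+1); rewrite (_ : [set x : T | _] = odds) => [->|].
  by clear; lia.
by apply/setP => x; rewrite !inE ltn_ord andbT.
Qed.

Variable S : {set T}.
Hypothesis evS : forall s, s \in S -> ~~ odd s.
Hypothesis sS : sum_free S.

Let S0 (s : T) : s \in S -> 0 < s.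
Proof. by move=> sS'; have := subsetP (sum_free_interval sS) _ sS'; rewrite inE. Qed.

Lemma lkI (s x y : T) : s \in S -> x <> y :> nat ->
  [\/ x + y = s, x + s = y | y + s = x] -> lk S x y.
Proof.
move=> sS' xy h; apply/andP; split; first by apply/eqP => e; apply: xy; rewrite e.
by apply/exists_inP; exists s => //; apply/or3P; case: h => h;
  [apply: Or31 | apply: Or32 | apply: Or33]; apply/eqP.
Qed.

Lemma odd_stars (f g h : nat -> nat) k q : k <= n.+1 -> 9 * q <= k %/ 2 ->
  (forall x, odd x -> x < k -> [/\ odd (f x), f x <= n, odd (g x) & g x <= n]) ->
  (forall x, odd x -> x < k -> odd (h x) /\ h x <= n) ->
  (forall x y, odd x -> odd y -> x < k -> y < k -> [/\ f x = f y -> x = y,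
      g x = g y -> x = y & h x = h y -> x = y]) ->
  (forall x, odd x -> x < k -> g x <> h x) ->
  (forall x, odd x -> x < k -> lk S (inord (f x)) (inord (g x)) && lk S (inord (f x)) (inord (h x))) ->
  pack (lk S) odds q.
Proof.
move=> kn qk hfg hh inj gh edge.
pose X := [set x : T | odd x && (x < k)].
apply: (@pack_stars _ (lk S) _ X odds (fun x => inord (f x)) (fun x => inord (g x))
   (fun x => inord (h x))).
- move=> x y; rewrite !inE => /andP[ox xk] /andP[oy yk] /(congr1 (@nat_of_ord _)).
  have [_ fx _ _] := hfg x ox xk; have [_ fy _ _] := hfg y oy yk.
  by rewrite !inordK // => e; apply: ord_inj; have [i1 _ _] := inj x y ox oy xk yk; apply: i1.
- move=> x y; rewrite !inE => /andP[ox xk] /andP[oy yk] /(congr1 (@nat_of_ord _)).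
  have [_ _ _ fx] := hfg x ox xk; have [_ _ _ fy] := hfg y oy yk.
  by rewrite !inordK // => e; apply: ord_inj; have [_ i2 _] := inj x y ox oy xk yk; apply: i2.
- move=> x y; rewrite !inE => /andP[ox xk] /andP[oy yk] /(congr1 (@nat_of_ord _)).
  have [_ fx] := hh x ox xk; have [_ fy] := hh y oy yk.
  by rewrite !inordK // => e; apply: ord_inj; have [_ _ i3] := inj x y ox oy xk yk; apply: i3.
- move=> x; rewrite !inE => /andP[ox xk]; have [f1 f2 g1 g2] := hfg x ox xk.
  have [h1 h2] := hh x ox xk; rewrite !inordK // f1 g1 h1; split => //.
  apply/eqP => /(congr1 (@nat_of_ord _)); rewrite !inordK //; exact: gh.
- by move=> x; rewrite inE => /andP[ox xk]; apply: edge.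
- by rewrite card_odd_lt.
Qed.

(** An element [s <= n / 4] gives the paths [x, x + s, x + 2 s]. Above [n / 4], two elements
    [s1 < s2] give [s1 - x, x, s2 - x], and one element bounded away from [n] gives
    [s - x, x, x + s]. What escapes is a single element close to [n]. *)
Lemma beta_pack E q : 4 <= E -> 36 * E * q.+1 <= n ->
  ((exists s1 s2, [/\ s1 \in S, s2 \in S & s1 < s2]) \/
   (exists2 s, s \in S & n <= E * (n - s))) ->
  pack (lk S) odds q.
Proof.
move=> E4 nq cond; have n144 : 144 * q.+1 <= n.
  by apply: leq_trans nq; rewrite leq_mul2r orbC; apply/orP; left; move: E4; clear; lia.
have caseA (s : T) : s \in S -> 4 * s <= n -> pack (lk S) odds q.
  move=> sS' s4; have s0 := S0 sS'; have es := evS sS'.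
  apply: (@odd_stars (fun x => x + s) id (fun x => x + s + s) (n.+1 - 2 * s)).
  - by clear; lia.
  - by move: s4 n144; clear; lia.
  - by move=> x ox xk; rewrite oddD ox (negbTE es); split => //; move: xk; clear; lia.
  - by move=> x ox xk; rewrite !oddD ox (negbTE es); split => //; move: xk; clear; lia.
  - by move=> x y _ _ _ _; split; clear; lia.
  - by move=> x _ _; move: s0; clear; lia.
  - move=> x ox xk; have x1 : x < n.+1 by move: xk; clear; lia.
    have x2 : x + s < n.+1 by move: xk; clear; lia.
    have x3 : x + s + s < n.+1 by move: xk; clear; lia.
    apply/andP; split; apply: (lkI sS'); rewrite !inordK //; try by move: s0; clear; lia.
      by apply: Or33.
    by apply: Or32.
case: cond => [[s1 [s2 [s1S s2S s12]]]|[s sS' hs]].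
  have [s4|s4] := leqP (4 * s1) n; first exact: (caseA s1).
  have s0 := S0 s1S; have es := evS s1S; have es2 := evS s2S; have s2n := ltn_ord s2.
  apply: (@odd_stars id (fun x => s1 - x) (fun x => s2 - x) ((s1 + 1) %/ 2)).
  - by move: s12 s2n; clear; lia.
  - by move: s4 n144; clear; lia.
  - move=> x ox xk; have xs : x <= s1 by move: xk; clear; lia.
    by rewrite oddB // ox (negbTE es); split => //; move: s12 s2n xk; clear; lia.
  - move=> x ox xk; have xs : x <= s2 by move: xk s12; clear; lia.
    by rewrite oddB // ox (negbTE es2); split => //; move: s12 s2n xk; clear; lia.
  - by move=> x y _ _ xk yk; split => //; move: xk yk s12; clear; lia.
  - by move=> x _ xk; move: xk s12; clear; lia.
  - move=> x ox xk; have x1 : x < n.+1 by move: xk s12 s2n; clear; lia.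
    have x2 : s1 - x < n.+1 by move: xk s12 s2n; clear; lia.
    have x3 : s2 - x < n.+1 by move: xk s12 s2n; clear; lia.
    apply/andP; split; [apply: (lkI s1S)|apply: (lkI s2S)]; rewrite !inordK //.
    + by move: xk; clear; lia.
    + by apply: Or31; move: xk; clear; lia.
    + by move: xk s12; clear; lia.
    + by apply: Or31; move: xk s12; clear; lia.
have [s4|s4] := leqP (4 * s) n; first exact: (caseA s).
have s0 := S0 sS'; have es := evS sS'; have sn := ltn_ord s.
have hE : 36 * q.+1 <= n - s.
  rewrite leqNgt; apply/negP => lt; have : E * (n - s).+1 <= E * (36 * q.+1) by rewrite leq_mul2l lt orbT.
  by move: hs nq E4; rewrite mulnS mulnCA mulnA; clear; lia.
apply: (@odd_stars id (fun x => x + s) (fun x => s - x) (minn ((s + 1) %/ 2) (n.+1 - s))).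
- by move: sn; clear; lia.
- by move: s4 n144 hE; clear; lia.
- by move=> x ox xk; rewrite oddD ox (negbTE es); split => //; move: xk; clear; lia.
- move=> x ox xk; have xs : x <= s by move: xk; clear; lia.
  by rewrite oddB // ox (negbTE es); split => //; move: sn xk; clear; lia.
- by move=> x y _ _ xk yk; split => //; move: xk yk; clear; lia.
- by move=> x ox xk; have : 0 < x by [case: (x) ox]; move: xk; clear; lia.
- move=> x ox xk; have x1 : x < n.+1 by move: xk sn; clear; lia.
  have x2 : s - x < n.+1 by move: xk sn; clear; lia.
  have x3 : x + s < n.+1 by move: xk sn; clear; lia.
  apply/andP; split; apply: (lkI sS'); rewrite !inordK //.
  + by move: s0; clear; lia.
  + by apply: Or32.
  + by move: xk; clear; lia.
  + by apply: Or31; move: xk; clear; lia.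
Qed.

(** By parity, even elements block an odd [x] only through [x + x]. *)
Lemma card_excl_odds : #|odds :&: excl S| <= #|S|.
Proof.
rewrite -(@card_in_imset _ _ (fun x : T => inord (x + x) : T)).
  apply/subset_leq_card/subsetP => _ /imsetP[x + ->]; rewrite !inE => /andP[ox].
  case/blockedP => [[a aS xa]|[a [b [aS bS h]]]]; first by rewrite xa inord_val.
  have := evS aS; have := evS bS; case: h => e; first by move: ox; rewrite -e oddD; case: odd => //; case: odd.
  by rewrite -e oddD ox; case: odd.
have dbl (x : T) : x \in odds :&: excl S -> x + x < n.+1.
  rewrite !inE => /andP[ox /blockedP[[a aS ->]|[a [b [aS bS h]]]]] //.
  have := evS aS; have := evS bS; case: h => e; first by move: ox; rewrite -e oddD; case: odd => //; case: odd.
  by rewrite -e oddD ox; case: odd.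
move=> x y /dbl xd /dbl yd /(congr1 (@nat_of_ord _)); rewrite !inordK // => e.
by apply: ord_inj; move: e; clear; lia.
Qed.

Lemma beta_few (R : realFieldType) (s g : R) K E q :
    (0 < s)%R -> (s ^+ 2 = 2)%R -> (s * g = 7 / 5)%R -> (g <= 1)%R ->
    #|S| <= K -> 4 <= E -> 36 * E * q.+1 <= n ->
  ((exists s1 s2, [/\ s1 \in S, s2 \in S & s1 < s2]) \/
   (exists2 s, s \in S & n <= E * (n - s))) ->
  ((nmis (lk S) (odds :\: excl S))%:R <=
    2 ^+ (3 * K ^ 3) * (s ^+ #|odds| * g ^+ (q - K - 3 * K ^ 3 * (3 * K).+1)))%R.
Proof.
move=> s0 s2 sg g1 SK E4 nq cond.
have g0 : (0 < g)%R.
  have : (0 < s * g)%R by rewrite sg divr_gt0.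
  by rewrite pmulr_rgt0.
have s1 : (1 <= s)%R.
  rewrite leNgt; apply/negP => lt; have : (s * s < 1 * 1)%R by apply: ltr_pM => //; apply: ltW.
  by rewrite -expr2 s2 mulr1 ltNge ler1n.
have pk := pack_del (odds :&: excl S) (beta_pack E4 nq cond).
pose V := odds :\: excl S; have VE : odds :\: (odds :&: excl S) = V by rewrite setDIr setDv set0U.
rewrite VE in pk; pose W := V :&: [set x | tri_point S x].
have cW : #|W| <= 3 * K ^ 3.
  apply: (@leq_trans (3 * #|S| ^ 3)).
    by apply: leq_trans (card_tri_point S); apply/subset_leq_card/subsetIr.
  by rewrite leq_mul2l leq_exp2r.
have tf : triangle_free (lk S) (V :\: W).
  by rewrite setDIr setDv set0U; apply: lk_triangle_free.
have deg x : #|[set y | lk S x y]| <= 3 * K.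
  by apply: leq_trans (lk_degree S x) _; rewrite leq_mul2l SK.
apply: (le_trans (nmis_hit (@lk_sym _ S) (@lk_irr _ S) s0 s2 sg g1 (subsetIl _ _) tf pk deg)).
apply: ler_pM.
- by rewrite exprn_ge0.
- by apply: mulr_ge0; apply: exprn_ge0; apply: ltW.
- by apply: ler_weXn2l => //; rewrite ler1n.
- apply: ler_pM; try by apply: exprn_ge0; apply: ltW.
    by apply: ler_weXn2l => //; apply/subset_leq_card/subsetDl.
  apply: ler_wiXn2l => //; first exact: ltW.
  apply: leq_sub; first by apply: leq_sub2l; apply: leq_trans SK; apply: card_excl_odds.
  by rewrite leq_mul2r cW orbT.
Qed.

(** Each [s] other than [2 x] yields the neighbour [|s - x|], and a neighbour [y] comes in this way
    from [x + y] and [x - y] only. *)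
Lemma lk_degree_odds x : x \in odds ->
  (#|S|.-1 %/ 2 <= #|[set y in odds | lk S x y]| <= 3 * #|S|)%N.
Proof.
rewrite inE => ox; apply/andP; split; last first.
  apply: leq_trans (lk_degree S x); apply/subset_leq_card/subsetP => y.
  by rewrite !inE => /andP[].
set Y := [set y in odds | _].
have cov : S \subset [set inord (x + x)] :|: ([set (inord (y + x) : T) | y : T in Y] :|: [set (inord (x - y) : T) | y : T in Y]).
  apply/subsetP => s sS'; have es := evS sS'; have sn := ltn_ord s; have xn := ltn_ord x.
  rewrite !inE; have [->//|ne] := eqVneq s (inord (x + x)); rewrite /=.
  have ne' : x + x <> s.
    by move=> e; move: ne; rewrite e inord_val eqxx.
  have [xs|sx|e] := ltngtP x s.
  - apply/orP; left; apply/imsetP; exists (inord (s - x)); last first.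
      by rewrite inordK ?subnK ?inord_val ?(ltnW xs) //; move: sn; clear; lia.
    have lt : s - x < n.+1 by move: sn; clear; lia.
    rewrite !inE inordK // oddB ?(ltnW xs) // ox (negbTE es) /=.
    apply: (lkI sS'); rewrite inordK //; first by move: ne' xs; clear; lia.
    by apply: Or31; move: xs; clear; lia.
  - apply/orP; right; apply/imsetP; exists (inord (x - s)); last first.
      rewrite inordK ?subKn ?inord_val ?(ltnW sx) //; move: xn; clear; lia.
    have lt : x - s < n.+1 by move: xn; clear; lia.
    rewrite !inE inordK // oddB ?(ltnW sx) // ox (negbTE es) /=.
    apply: (lkI sS'); rewrite inordK //; first by move: (S0 sS') sx; clear; lia.
    by apply: Or33; move: sx; clear; lia.
  - by move: es; rewrite -e ox.
have := subset_leq_card cov => /leq_trans /(_ (leq_card_setU _ _)).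
rewrite cards1 => hc; have {hc} : #|S| <= 1 + (#|Y| + #|Y|).
  apply: (leq_trans hc); rewrite leq_add2l; apply: (leq_trans (leq_card_setU _ _)).
  by apply: leq_add; apply: leq_imset_card.
by clear; lia.
Qed.

(** With degrees between about [0.5 |S|] and [3 |S|], [fingerprint_size] leaves at most [300 / 348]
    of the odd numbers, about [0.431 n] points. *)
Lemma beta_many (R : realFieldType) (c : R) h : (forall k, (0 < k)%N -> (k%:R <= c ^+ k)%R) ->
  0 < h -> 100 * h <= #|S| -> 13 <= n ->
  ((nmis (lk S) (odds :\: excl S))%:R <= #|small_sets T (#|odds| %/ h)|%:R * c ^+ (47 * n %/ 100))%R.
Proof.
move=> hc h0 hS n13.
apply: (nmis_fingerprint (@lk_sym _ S) hc _ (subsetDl _ _) lk_degree_odds).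
  by rewrite h0; move: hS; clear; lia.
move=> k; have := card_odds; set s := #|S| in hS *; set o := #|odds|.
move=> ho hk; rewrite leq_divRL // mulnC.
set d := _ - h in hk; have hd : 348 * s <= 100 * d.
  by rewrite /d; move: hS h0; clear; lia.
have h1 : k * (348 * s) <= 300 * (s * o).
  apply: (@leq_trans (k * (100 * d))); first by rewrite leq_mul2l hd orbT.
  rewrite mulnCA (_ : 300 * (s * o) = 100 * (3 * s * o)); last by clear; lia.
  by rewrite leq_mul2l hk orbT.
have s0 : 0 < s by move: hS h0; clear; lia.
have {h1} : k * 348 <= 300 * o.
  rewrite -(leq_pmul2l s0); apply: leq_trans (_ : k * (348 * s) <= _).
    by rewrite mulnA mulnC [k * _]mulnC mulnA.
  by apply: (leq_trans h1); rewrite mulnCA.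
by move: ho n13; clear; lia.
Qed.

End Odds.

(** * From maximal independent sets back to maximal sum-free sets *)

Section Converse.
Variable n : nat.
Local Notation T := 'I_n.+1.
Implicit Types (S V I M : {set T}).

Lemma mis_vmax S V I : sum_free S -> sum_free V -> [disjoint S & V] ->
  mis (lk S) (V :\: excl S) I -> vmax V (S :|: I).
Proof.
move=> sS sV dSV /misP[IV Iind Idom].
have sSP := sum_freeP _ sS; have sVP := sum_freeP _ sV.
have IV' x : x \in I -> x \in V /\ ~~ blocked S x.
  by move=> /(subsetP IV); rewrite !inE => /andP[].
have nlk x y : x \in I -> y \in I -> forall s, s \in S -> ~~ schur_rel s x y.
  move=> xI yI s sS'; have [xy|xy] := eqVneq x y; last first.
    have := Iind _ _ xI yI; rewrite /lk xy /=; apply: contra => h.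
    by apply/exists_inP; exists s.
  rewrite -xy; have [xV nb] := IV' _ xI; have s0 : 0 < s.
    by have := subsetP (sum_free_interval sS) _ sS'; rewrite inE.
  apply/negP => /or3P[] /eqP e; last 2 first.
  - by move: e s0; clear; lia.
  - by move: e s0; clear; lia.
  by case/negP: nb; apply/blockedP; left; exists s.
have two x a b : x \in I -> a \in S -> b \in S -> ~ (a + b = x :> nat \/ x + a = b :> nat).
  move=> xI aS bS h; have [_ /negP] := IV' _ xI; apply.
  by apply/blockedP; right; exists a, b.
have tw x a : x \in I -> a \in S -> x + x <> a :> nat.
  move=> xI aS e; have [_ /negP] := IV' _ xI; apply.
  by apply/blockedP; left; exists a.
apply/vmaxP; split.
  apply/sum_freeP => x y z; rewrite !inE => /orP[xS|xI] /orP[yS|yI] /orP[zS|zI] e.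
  - exact: (sSP x y z).
  - by apply: (two z x y) => //; left.
  - by apply: (two y x z) => //; right; rewrite addnC.
  - by have /negP := nlk y z yI zI x xS; apply; apply/or3P/Or32/eqP; rewrite addnC.
  - by apply: (two x y z) => //; right.
  - by have := nlk x z xI zI y yS; rewrite /schur_rel e eqxx orbT.
  - by have := nlk x y xI yI z zS; rewrite /schur_rel e eqxx.
  - have [xV _] := IV' _ xI; have [yV _] := IV' _ yI; have [zV _] := IV' _ zI.
    exact: (sVP x y z).
move=> x xV; rewrite inE negb_or => /andP[xS xI].
have [b|nb] := boolP (blocked S x); first by apply: blockedS b; apply: subsetUl.
have [|y yI /andP[_ /exists_inP[s sS' h]]] := Idom x _ xI; first by rewrite !inE nb.
apply/blockedP; right; case/or3P: h => /eqP h.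
- by exists y, s; rewrite !inE yI sS' orbT; split => //; right.
- by exists s, y; rewrite !inE yI sS' orbT; split => //; right.
- by exists y, s; rewrite !inE yI sS' orbT; split => //; left.
Qed.

(** Only a point [x] outside [V] can prevent [S :|: I] from being maximal. Then [I] is maximal
    independent for the link graph of [x |: S] too, so the loss is bounded by the counts for these
    larger sets. *)
Lemma card_nonmax S V : sum_free S -> sum_free V -> [disjoint S & V] ->
  nmis (lk S) (V :\: excl S) <= #|[set M | max_sum_free M & M :\: V == S]| +
    \sum_(x | [&& x \notin V, x \notin S & sum_free (x |: S)])
       nmis (lk (x |: S)) (V :\: excl (x |: S)).
Proof.
move=> sS sV dSV.
have UK I : I \subset V -> (S :|: I) :\: V = S.
  move=> IV; apply/setP => x; rewrite !inE; case: (boolP (x \in V)) => [xV|xV] /=.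
    by rewrite (disjointFl dSV xV).
  by rewrite [x \in I]negbTE ?orbF //; apply: contra xV; apply: (subsetP IV).
have mV S' I : mis (lk S') (V :\: excl S') I -> I \subset V.
  by move=> /misP[IV _ _]; apply: (subset_trans IV); apply: subsetDl.
set G := [set M | max_sum_free M & _].
set Q := fun x => [set I | mis (lk (x |: S)) (V :\: excl (x |: S)) I].
apply: (@leq_trans #|[set I | mis (lk S) (V :\: excl S) I & max_sum_free (S :|: I)] :|:
   \bigcup_(x | [&& x \notin V, x \notin S & sum_free (x |: S)]) Q x|).
  apply/subset_leq_card/subsetP => I; rewrite inE => Im; rewrite !inE Im /=.
  have [//|nm] := boolP (max_sum_free (S :|: I)); rewrite /=.
  have vm := mis_vmax sS sV dSV Im; have /vmaxP[sM vb] := vm.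
  move: nm; rewrite max_sum_freeE /vmax sM /= => /forall_inPn[x x0].
  rewrite negb_imply => /andP[xM nb]; rewrite inE in x0.
  have xV : x \notin V by apply: contra nb => xV; apply: vb.
  have sx := sum_free_add sM x0 nb.
  have xS : x \notin S by move: xM; rewrite inE negb_or => /andP[].
  have sxS : sum_free (x |: S) by apply: sum_freeS sx; apply/setUS/subsetUl.
  apply/bigcupP; exists x; first by rewrite xV xS.
  rewrite /Q inE.
  have -> : I = (x |: (S :|: I)) :&: V.
    apply/setP => y; rewrite !inE; have [yV|yV] := boolP (y \in V); last first.
      by rewrite !andbF; apply/negbTE; apply: contra yV; apply: (subsetP (mV _ _ Im)).
    rewrite andbT (disjointFl dSV yV) /=; case: eqP => // yx.
    by rewrite -yx yV in xV.
  apply: vmax_mis => //.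
  - by apply/setUS/subsetUl.
  - by rewrite setUA; apply/setUS/(mV _ _ Im).
  - apply/vmaxP; split => // y yV; rewrite inE negb_or => /andP[_ yM].
    by apply: blockedS (vb y yV yM); apply: subsetUr.
apply: (leq_trans (leq_card_setU _ _)); apply: leq_add.
  rewrite -[leqLHS](@card_in_imset _ _ (fun I => S :|: I)).
    apply/subset_leq_card/subsetP => _ /imsetP[I + ->]; rewrite !inE => /andP[Im ->] /=.
    by rewrite UK // (mV _ _ Im).
  move=> I J; rewrite !inE => /andP[/mV IV _] /andP[/mV JV _] /setP E; apply/setP => x.
  have := E x; rewrite !inE; have [xS|//] := boolP (x \in S).
  have xV := disjointFr dSV xS; move=> _.
  by rewrite [x \in I](contraFF (subsetP IV x) xV) [x \in J](contraFF (subsetP JV x) xV).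
elim/big_ind2: _ => [|A1 x1 A2 x2 h1 h2|x _]; first by rewrite cards0.
  by apply: (leq_trans (leq_card_setU _ _)); apply: leq_add.
by [].
Qed.

Section Exact.
Variable s : T.
Hypotheses (es : ~~ odd s) (s0 : 0 < s) (hs : 2 * n < 3 * s).

Let Q := [set x : T | odd x && (x < s %/ 2)].
Let V := odds n :\: excl [set s].

Let sS : sum_free [set s].
Proof.
by apply/sum_freeP => x y z; rewrite !inE => /eqP -> /eqP -> /eqP ->; move: (s0); clear; lia.
Qed.

Let VE y : (y \in V) = odd y && (y + y != s).
Proof.
rewrite !inE andbC; case oy: (odd y) => //=; congr (~~ _).
apply/blockedP/eqP => [[[b]|[b [c []]]]|h]; rewrite ?inE.
- by move=> /eqP ->.
- move=> /eqP -> /eqP -> [] h; first by move: oy (es); rewrite -h oddD; case: odd.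
  by move: h oy; clear; lia.
- by left; exists s; rewrite ?inE.
Qed.

Let lkE x y : lk [set s] x y = (x != y) && schur_rel s x y.
Proof.
rewrite /lk; congr (_ && _); apply/exists_inP/idP => [[z]|h]; first by rewrite inE => /eqP ->.
by exists s; rewrite ?inE.
Qed.

(* Outside [Q], the only neighbour of [y] in the link graph is [s - y] or [y - s]. *)
Let char I y : mis (lk [set s]) V I -> y \in V -> y \notin Q ->
  (y \in I) = ((inord (if y < s then s - y else y - s) : T) \notin I).
Proof.
move=> /misP[IV Iind Idom] yV yQ; set z : T := inord _.
have [oy ny] : odd y /\ y + y <> s by move: yV; rewrite VE => /andP[? /eqP].
have yn := ltn_ord y; have sn := ltn_ord s.
have ys : y <> s :> nat by move=> e; move: (es); rewrite -e oy.
have y2 : ~ (y < s %/ 2) by move=> h; move: yQ; rewrite inE oy h.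
have zE : z = (if y < s then s - y else y - s) :> nat.
  by rewrite /z inordK //; move: yn sn; clear; case: ifP; lia.
apply/idP/idP => [yI|zI].
  apply/negP => zI; have := Iind _ _ yI zI; rewrite lkE => /negP; apply.
  apply/andP; split; first by apply/eqP => e; move: zE; rewrite -e; case: ifP; move: ny ys (s0); clear; lia.
  apply/or3P; move: zE; case: ltnP => h ->; [apply: Or31 | apply: Or33]; apply/eqP; move: h; clear; lia.
apply: contraT => yI; have [w wI] := Idom _ yV yI; rewrite lkE => /andP[_ h].
case/negP: zI; suff -> : z = w by [].
apply: ord_inj; rewrite zE; have wn := ltn_ord w; move: (es); case/or3P: h => /eqP h _.
- by case: ifP; move: h; clear; lia.
- by move: h y2 (hs) wn (es); clear; lia.
- by case: ifP; move: h; clear; lia.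
Qed.

Lemma mis_single_inj I J :
  mis (lk [set s]) (odds n :\: excl [set s]) I -> mis (lk [set s]) (odds n :\: excl [set s]) J ->
  I :&: [set x : T | odd x && (x < s %/ 2)] = J :&: [set x : T | odd x && (x < s %/ 2)] -> I = J.
Proof.
move=> mI mJ /setP IJ; have sn := ltn_ord s.
have IJQ y : y \in Q -> (y \in I) = (y \in J).
  by move=> yQ; have := IJ y; rewrite !inE; move: yQ; rewrite inE => ->; rewrite !andbT.
apply/setP => y; have [yQ|yQ] := boolP (y \in Q); first exact: IJQ.
have [yV|yV] := boolP (y \in V); last first.
  have nI K : mis (lk [set s]) V K -> y \notin K.
    by move=> /misP[KV _ _]; apply: contra yV; apply: (subsetP KV).
  by rewrite !(negbTE (nI _ _)).
rewrite (char mI yV yQ) (char mJ yV yQ); congr (~~ _); have := yV; rewrite VE => /andP[oy /eqP ny].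
have yn := ltn_ord y; have y2 : ~ (y < s %/ 2) by move=> h; move: yQ; rewrite inE oy h.
have lt : (if y < s then s - y else y - s) < n.+1 by move: yn sn; clear; case: ifP; lia.
apply: IJQ; rewrite inE inordK //; case: ltnP => h.
  rewrite oddB ?(ltnW h) // (negbTE es) oy /=.
  by move: (es) y2 ny h; clear; lia.
rewrite oddB // (negbTE es) oy /=.
by move: (es) h yn (hs); clear; lia.
Qed.

(** The link graph is a union of stars: the centres are the odd [x < s / 2], the leaves [s - x] and,
    when it is at most [n], [s + x]. The condition [2 n < 3 s] gives [n - s < s / 2], so every leaf
    has one centre. In each star either the centre or all leaves are chosen. *)
Lemma nmis_single : nmis (lk [set s]) (odds n :\: excl [set s]) = 2 ^ (s %/ 2 %/ 2).
Proof.
have sn := ltn_ord s.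
have cQ : #|Q| = s %/ 2 %/ 2 by rewrite /Q card_odd_lt //; move: sn; clear; lia.
rewrite -cQ -card_powerset -/V; apply/eqP; rewrite eqn_leq; apply/andP; split.
  rewrite /nmis -[leqLHS](@card_in_imset _ _ (fun I => I :&: Q)).
    by apply/subset_leq_card/subsetP => _ /imsetP[I _ ->]; rewrite inE subsetIr.
  by move=> I J; rewrite !inE; apply: mis_single_inj.
pose F (U : {set T}) := [set y in V | if y \in Q then y \in U
   else (inord (if y < s then s - y else y - s) : T) \notin U].
have FQ (U : {set T}) : U \subset Q -> F U :&: Q = U.
  move=> UQ; apply/setP => y; rewrite in_setI [y \in F U]inE.
  have [yQ|yQ] := boolP (y \in Q); last first.
    by rewrite andbF; apply/esym/negbTE; apply: contra yQ; apply: (subsetP UQ).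
  rewrite andbT VE; move: yQ; rewrite inE => /andP[-> h].
  by have -> : y + y != s by move: h; clear; lia.
rewrite -[leqLHS](@card_in_imset _ _ F); last first.
  by move=> U U'; rewrite !inE => UQ UQ' e; rewrite -(FQ U) // e FQ.
apply/subset_leq_card/subsetP => _ /imsetP[U + ->]; rewrite !inE => UQ.
have FI y : (y \in F U) = (y \in V) && (if y \in Q then y \in U
   else (inord (if y < s then s - y else y - s) : T) \notin U) by rewrite inE.
(* Each edge joins a point of [Q] to a point outside [Q] whose only neighbour it is. *)
have edge (x y : T) : x \in V -> y \in V -> schur_rel s x y ->
    (x \in Q /\ y \notin Q /\ (inord (if y < s then s - y else y - s) : T) = x) \/
    (y \in Q /\ x \notin Q /\ (inord (if x < s then s - x else x - s) : T) = y).
  rewrite !VE => /andP[ox /eqP nx] /andP[oy /eqP ny] h.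
  have xn := ltn_ord x; have yn := ltn_ord y.
  rewrite !inE ox oy /=.
  have [xy|yx] := ltnP x y; [left|right].
    have e : (if y < s then s - y else y - s) = x.
      by case/or3P: h => /eqP h; case: ifP; move: h xy (s0); clear; lia.
    rewrite e inord_val; split; first by case/or3P: h => /eqP h; move: h xy (es) xn yn (hs) nx; clear; lia.
    by split => //; case/or3P: h => /eqP h; move: h xy (es) xn yn (hs) nx; clear; lia.
  have xy' : y < x.
    rewrite ltn_neqAle yx andbT; apply/eqP => e; case/or3P: h => /eqP h; move: h nx (s0); rewrite e; clear; lia.
  have e : (if x < s then s - x else x - s) = y.
    by case/or3P: h => /eqP h; case: ifP; move: h xy' (s0); clear; lia.
  rewrite e inord_val; split; first by case/or3P: h => /eqP h; move: h xy' (es) xn yn (hs) ny; clear; lia.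
  by split => //; case/or3P: h => /eqP h; move: h xy' (es) xn yn (hs) ny; clear; lia.
apply/misP; split.
- by apply/subsetP => y; rewrite FI => /andP[].
- move=> x y; rewrite !FI => /andP[xV xU] /andP[yV yU]; rewrite lkE; apply/negP => /andP[_ h].
  case: (edge _ _ xV yV h) => [[xQ [yQ e]]|[yQ [xQ e]]].
    by move: xU yU; rewrite xQ (negbTE yQ) e => ->.
  by move: xU yU; rewrite yQ (negbTE xQ) e => /negbTE ->.
- move=> x xV; rewrite FI xV /=; have := xV; rewrite VE => /andP[ox /eqP nx].
  have xn := ltn_ord x.
  have [xQ|xQ] := boolP (x \in Q) => xU.
    have xs : x < s %/ 2 by move: xQ; rewrite inE => /andP[].
    have lt : s - x < n.+1 by move: sn; clear; lia.
    exists (inord (s - x)); last first.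
      rewrite lkE; apply/andP; split; first by apply/eqP => /(congr1 (@nat_of_ord _)); rewrite inordK //; move: xs; clear; lia.
      by apply/or3P/Or31; rewrite inordK //; move: xs; clear; lia.
    rewrite FI VE inE inordK // oddB ?ox ?(negbTE es) /=; last by move: xs; clear; lia.
    have -> : (s - x + (s - x) != s) by move: xs; clear; lia.
    have -> : (s - x < s %/ 2) = false by move: xs; clear; lia.
    have -> : s - x < s by move: xs ox; clear; lia.
    by rewrite subKn ?inord_val //; move: xs; clear; lia.
  have ltz : (if x < s then s - x else x - s) < n.+1 by move: xn sn; clear; case: ifP; lia.
  exists (inord (if x < s then s - x else x - s)).
    rewrite FI; have zU : (inord (if x < s then s - x else x - s) : T) \in U by rewrite negbK in xU.
    have zQ := subsetP UQ _ zU; rewrite zQ zU andbT VE.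
    by move: zQ; rewrite inE => /andP[-> h] /=; move: h; clear; lia.
  have x2 : ~ (x < s %/ 2) by move=> h; move: xQ; rewrite inE ox h.
  have xs' : x <> s :> nat by move=> e; move: (es); rewrite -e ox.
  rewrite lkE; apply/andP; split.
    apply/eqP => /(congr1 (@nat_of_ord _)); rewrite inordK //.
    by case: ifP; move: nx xs' (s0); clear; lia.
  apply/or3P; rewrite inordK //; case: ltnP => h; [apply: Or31 | apply: Or33]; apply/eqP; move: h; clear; lia.
Qed.

End Exact.
End Converse.

Lemma card_fibers_sum (I J : finType) (A : {set I}) (P : {set J}) (f : I -> J) :
  (forall x, x \in A -> f x \in P) -> #|A| = \sum_(y in P) #|[set x in A | f x == y]|.
Proof.
move=> fP; rewrite -sum1_card (partition_big f (mem P)) //=.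
by apply: eq_bigr => y _; rewrite -sum1_card; apply: eq_bigl => x; rewrite inE.
Qed.

(** * Counting the sets with few even elements *)

Section Beta.
Variables (R : archiRealFieldType) (a : R).
Hypotheses (a0 : (0 < a)%R) (a4 : (a ^+ 4 = 2)%R).

Definition beta_max n q :=
  [set M : {set 'I_n.+1} | max_sum_free M & #|M :\: odds n| * q <= n].

Definition evsum n := \sum_(s : 'I_n.+1 | ~~ odd s && (0 < s)) 2 ^ (s %/ 2 %/ 2).

Definition weight n (S : {set 'I_n.+1}) := nmis (lk S) (odds n :\: excl S).

Definition even_sets n := [set S : {set 'I_n.+1} | (S \subset ~: odds n) && sum_free S].

Definition many n K q := [set S in even_sets n | (K <= #|S|) && (#|S| * q <= n)].

(** Bounded sets to which [beta_pack] applies with [E = 4]: they have two elements, or one element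
    at most [3 n / 4]. *)
Definition few n K := [set S in even_sets n | (#|S| <= K) &&
  ([exists s1 in S, exists s2 in S, s1 < s2] || [exists s in S, n <= 4 * (n - s)])].

Lemma even_setsP n (S : {set 'I_n.+1}) : S \in even_sets n ->
  [/\ forall s, s \in S -> ~~ odd s, sum_free S & [disjoint S & odds n]].
Proof.
rewrite inE => /andP[SO sS]; split => //.
  by move=> s /(subsetP SO); rewrite !inE.
by rewrite disjoints_subset.
Qed.

Lemma beta_fiber n (A : {set {set 'I_n.+1}}) (P : {set {set 'I_n.+1}}) :
  P \subset even_sets n ->
  (forall M, M \in A -> max_sum_free M /\ M :\: odds n \in P) ->
  #|A| <= \sum_(S in P) weight S.
Proof.
move=> PE h; rewrite (@card_fibers_sum _ _ A P (fun M => M :\: odds n)); last first.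
  by move=> M /h[].
apply: leq_sum => S SP; have [_ _ dS] := even_setsP (subsetP PE _ SP).
apply: card_vmax => //; first exact: odds_sum_free.
move=> M; rewrite inE => /andP[/h[mM _] /eqP <-]; split.
- apply: vmaxS (_ : vmax (interval1 n) M); last by rewrite -max_sum_freeE.
  exact/sum_free_interval/odds_sum_free.
- exact: subsetDl.
- by apply/subsetP => x xM; rewrite !inE xM; case: (odd x).
Qed.

Local Open Scope ring_scope.

Let s : R := a ^+ 2.
Let g : R := 7 / 5 / s.

Lemma base_facts : [/\ 0 < s, s ^+ 2 = 2, s * g = 7 / 5, 0 < g < 1 & 1 <= a].
Proof.
have s0 : 0 < s by apply: exprn_gt0.
have s2 : s ^+ 2 = 2 by rewrite -exprM.
have sg : s * g = 7 / 5 by rewrite /g mulrCA divff ?mulr1 // lt0r_neq0.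
have sl : 7 / 5 < s.
  rewrite ltNge; apply/negP => h; have : s * s <= 7 / 5 * (7 / 5).
    by apply: ler_pM => //; apply: ltW.
  by rewrite -expr2 s2; lra.
split => //.
  by rewrite /g divr_gt0 //= ?divr_gt0 // ltr_pdivrMr // mul1r.
rewrite leNgt; apply/negP => h; have : a ^+ 4 < 1 by apply: exprn_ilt1 => //; apply: ltW.
by rewrite a4; lra.
Qed.

Lemma power_gap (x : R) m : 0 < x < 1 -> exists2 t : R, 0 < t < 1 &
  forall k n, (n <= m * k)%N -> x ^+ k <= t ^+ n.
Proof.
move=> /andP[x0 x1]; have u1 : 1 < x^-1 by rewrite invf_gt1.
have [v v1 hv] := expr_root m u1; have v0 : 0 < v by apply: lt_trans v1.
exists v^-1; first by rewrite invr_gt0 v0 invf_lt1.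
move=> k n nk; have vi : 0 < v^-1 <= 1 by rewrite invr_gt0 v0 invf_le1 ?ltW.
apply: (@le_trans _ _ (v^-1 ^+ (m * k))); last first.
  by apply: ler_wiXn2l => //; case/andP: vi => // /ltW.
rewrite exprM; apply: ler_expn; first exact: ltW.
by rewrite exprVn -[x]invrK lef_pV2 ?posrE ?exprn_gt0 ?invr_gt0.
Qed.

Lemma few_small K : expsmall a (fun n => \sum_(S in few n K) weight S)%N.
Proof.
have [s0 s2 sg /andP[g0 g1] a1] := base_facts.
pose c := (K + 3 * K ^ 3 * (3 * K).+1)%N.
have g01 : 0 < g < 1 by rewrite g0.
(* [beta_pack] with [E = 4] supplies about [n / 144] paths, and the bounded losses leave at least
   [n / 288]. *)
have [t t01 ht] := power_gap 288 g01.
apply: (expsmall_sub t01) => u u1.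
have [v v1 hv] := expr_root 4 u1; have v0 : 0 < v by apply: lt_trans v1.
have [q q0 small] := small_sets_bound v1.
have [m _ hm] := expr_unbounded (2 ^+ (3 * K ^ 3) * a) v1.
exists (K * q + m + 288 * c + 600)%N => n nn.
have n0 : (0 < n)%N by move: nn; clear; lia.
pose k := (n %/ 144).-1.
have hk : (36 * 4 * k.+1 <= n)%N.
  by rewrite /k; have := leq_trunc_div n 144; move: nn; clear; lia.
have hkn : (n <= 288 * (k - K - 3 * K ^ 3 * (3 * K).+1))%N.
  rewrite -subnDA -/c /k; have := ltn_ceil n (isT : (0 < 144)%N); move: nn; clear; lia.
have oddsn : s ^+ #|odds n| <= a ^+ n.+1.
  by rewrite /s -exprM; apply: ler_weXn2l => //; apply: card_odds.
have t0 : 0 < t by case/andP: t01.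
apply: (@le_trans _ _ (#|small_sets 'I_n.+1 K|%:R * (2 ^+ (3 * K ^ 3) * (a ^+ n.+1 * t ^+ n)))).
  rewrite natr_sum; apply: (@le_trans _ _ (\sum_(S in few n K) 2 ^+ (3 * K ^ 3) * (a ^+ n.+1 * t ^+ n))).
    apply: ler_sum => S; rewrite inE => /and3P[/even_setsP[evS sS _] SK cond].
    have cond' : (exists s1 s2, [/\ s1 \in S, s2 \in S & (s1 < s2)%N]) \/
       (exists2 s, s \in S & (n <= 4 * (n - s))%N).
      case/orP: cond => [/exists_inP[s1 s1S /exists_inP[s2' s2S lt]]|/exists_inP[s1 s1S h]].
        by left; exists s1, s2'.
      by right; exists s1.
    apply: (le_trans (beta_few evS sS s0 s2 sg (ltW g1) SK (leqnn 4) hk cond')).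
    apply: ler_wpM2l; first exact: exprn_ge0.
    apply: ler_pM; try by apply: exprn_ge0; apply: ltW.
      exact: oddsn.
    exact: ht.
  rewrite sumr_const -[leLHS]mulr_natl; apply: ler_wpM2r.
    by rewrite !mulr_ge0 ?exprn_ge0 // ltW.
  rewrite ler_nat; apply/subset_leq_card/subsetP => S; rewrite !inE.
  by move=> /and3P[_ ? _].
have sm : #|small_sets 'I_n.+1 K|%:R <= v ^+ n.+1.
  rewrite -[X in v ^+ X](card_ord n.+1); apply: small.
  by rewrite card_ord; move: nn; clear; lia.
have -> : #|small_sets 'I_n.+1 K|%:R * (2 ^+ (3 * K ^ 3) * (a ^+ n.+1 * t ^+ n)) =
  (#|small_sets 'I_n.+1 K|%:R * (2 ^+ (3 * K ^ 3) * a)) * (t * a) ^+ n.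
  by rewrite exprS exprMn; ring.
apply: ler_wpM2r; first by rewrite exprn_ge0 // mulr_ge0 // ltW.
apply: (@le_trans _ _ (v ^+ n.+1 * v ^+ n)).
  apply: ler_pM => //; first by rewrite mulr_ge0 ?exprn_ge0 // ltW.
  apply: (le_trans hm); apply: ler_weXn2l; [exact: ltW | by move: nn; clear; lia].
rewrite -exprD; apply: (@le_trans _ _ (v ^+ (4 * n))).
  by apply: ler_weXn2l; [exact: ltW | by move: n0; clear; lia].
by rewrite exprM; apply: ler_expn => //; apply/exprn_ge0/ltW.
Qed.

Lemma many_small : exists K q, (0 < q)%N /\ forall q', (q <= q')%N ->
  expsmall a (fun n => \sum_(S in many n K q') weight S)%N.
Proof.
have [s0 s2 sg /andP[g0 g1] a1] := base_facts.
have [t /andP[t0 t1] ht] := moon_moser_gap a0 a4.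
have u1 : 1 < t^-1 by rewrite invf_gt1.
have [v v1 hv] := expr_root 4 u1; have v0 : 0 < v by apply: lt_trans v1.
have [h h0 small] := small_sets_bound v1.
(* The fingerprints and the sets [S] themselves both have density at most [1 / h], so each costs a
   factor [v^(n+1)]; the size [100 * h] is what [beta_many] asks for. *)
exists (100 * h)%N, h; split => // q hq.
have vt : v ^+ 3 * t < 1.
  have : v ^+ 4 * t <= 1 by rewrite -(mulVf (lt0r_neq0 t0)) ler_pM2r.
  rewrite exprSr -mulrA mulrCA => h1; apply: lt_le_trans h1.
  by rewrite ltr_pMl // mulr_gt0 ?exprn_gt0.
apply: (@expsmall_const _ _ a0 _ (v ^+ 2) (v ^+ 2 * t)).
  rewrite mulr_gt0 ?exprn_gt0 //=; apply: le_lt_trans vt.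
  by apply: ler_wpM2r; [exact: ltW | apply: ler_weXn2l => //; exact: ltW].
exists 13 => n n13.
have key S : S \in many n (100 * h) q -> (weight S)%:R <= v ^+ n.+1 * (t * a) ^+ n.
  rewrite inE => /and3P[/even_setsP[evS sS _] hS _].
  apply: (le_trans (beta_many evS sS (@moon_moser_base R) h0 hS n13)).
  apply: ler_pM => //; first by apply: exprn_ge0; lra.
    rewrite -[X in v ^+ X](card_ord n.+1); apply: small.
    apply: (leq_trans (leq_trunc_div _ _)); exact: max_card.
  by apply: ht; rewrite mulnC leq_trunc_div.
have cm : #|many n (100 * h) q|%:R <= v ^+ n.+1.
  apply: (@le_trans _ _ #|small_sets 'I_n.+1 (n.+1 %/ h)|%:R).
    rewrite ler_nat; apply/subset_leq_card/subsetP => S; rewrite !inE => /and3P[_ _ hS].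
    rewrite leq_divRL //; apply: leq_trans (leqW hS).
    by rewrite leq_mul2l hq orbT.
  rewrite -[X in v ^+ X](card_ord n.+1); apply: small.
  by rewrite card_ord leq_trunc_div.
rewrite natr_sum; apply: (le_trans (ler_sum _ key)).
rewrite sumr_const -[leLHS]mulr_natl.
apply: (le_trans (ler_wpM2r _ cm)).
  by rewrite mulr_ge0 // exprn_ge0 // ?mulr_ge0 // ltW.
rewrite mulrA -exprD (_ : n.+1 + n.+1 = 2 + 2 * n)%N; last by clear; lia.
by rewrite exprD [v ^+ (2 * n)]exprM -[leLHS]mulrA -exprMn mulrA.
Qed.

Local Close Scope ring_scope.

Lemma even_pair n (x s' : 'I_n.+1) K : 2 <= K -> x \notin odds n -> s' \notin odds n ->
  x != s' -> sum_free (x |: [set s']) -> x |: [set s'] \in few n K.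
Proof.
move=> K2 xO sO xs sf; rewrite !inE sf andbT; apply/and3P; split.
- by apply/subsetP => y; rewrite !inE => /orP[] /eqP ->; move: xO sO; rewrite !inE.
- by apply: leq_trans K2; rewrite cardsU1 cards1; case: (_ \notin _).
- apply/orP; left; have [lt|gt|e] := ltngtP x s'.
  + by apply/exists_inP; exists x; rewrite ?inE ?eqxx //; apply/exists_inP; exists s'; rewrite ?inE ?eqxx ?orbT.
  + by apply/exists_inP; exists s'; rewrite ?inE ?eqxx ?orbT //; apply/exists_inP; exists x; rewrite ?inE ?eqxx.
  + by move: xs; rewrite (ord_inj e) eqxx.
Qed.

Lemma single_sum_free n (x : 'I_n.+1) : 0 < x -> sum_free [set x].
Proof.
by move=> x0; apply/sum_freeP => ? ? ?; rewrite !inE => /eqP -> /eqP -> /eqP ->; move: x0; clear; lia.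
Qed.

(* Only singletons [{s}] with [s] close to [n] contribute to the main term. *)
Definition main n (s' : 'I_n.+1) := [&& ~~ odd s', 0 < s' & 3 * n < 4 * s'].
Definition main_sets n := [set [set s'] | s' : 'I_n.+1 in main (n := n)].

Lemma mainP n (s' : 'I_n.+1) : main s' ->
  [/\ ~~ odd s', 0 < s', 2 * n < 3 * s' & [set s'] \in even_sets n].
Proof.
move=> /and3P[h1 h2 h3]; split => //; first by move: h3 h2; clear; lia.
by rewrite !inE single_sum_free // andbT sub1set !inE.
Qed.

Lemma main_sets_even n : main_sets n \subset even_sets n.
Proof. by apply/subsetP => _ /imsetP[s' /mainP[_ _ _ h] ->]. Qed.

Lemma odds_part n q M : M \in beta_max n q -> M :\: odds n \in even_sets n.
Proof.
rewrite inE => /andP[mM _]; rewrite inE; apply/andP; split.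
  by apply/subsetP => x; rewrite !inE => /andP[].
move: mM; rewrite max_sum_freeE => /vmaxP[sM _].
by apply: sum_freeS sM; apply: subsetDl.
Qed.

Lemma beta_fibers n q (P : {set {set 'I_n.+1}}) : P \subset even_sets n ->
  #|[set M in beta_max n q | M :\: odds n \in P]| <= \sum_(S in P) weight S.
Proof.
move=> PE; apply: beta_fiber => // M; rewrite in_set => /andP[MB ->]; split => //.
by move: MB; rewrite inE => /andP[].
Qed.

(** An even part outside [main_sets] is empty, which happens only for the set of all odd numbers, or
    is too large to be bounded, or belongs to [few]. *)
Lemma beta_rest : exists2 q0, 0 < q0 & forall q, q0 <= q ->
  expsmall a (fun n => #|[set M in beta_max n q | M :\: odds n \notin main_sets n]|).
Proof.
have [K' [q0 [q00 hmany]]] := many_small.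
pose K := K'.+2; exists q0 => // q qq.
have fs := few_small K.
have [_ _ _ _ a1] := base_facts.
have a1' : (1 < a)%R.
  rewrite lt_neqAle a1 andbT; apply/eqP => e; have : (1 < 2 :> R)%R by rewrite ltr1n.
  by rewrite -a4 -e expr1n ltxx.
have one : expsmall a (fun=> 1).
  exists a^-1%R; rewrite invr_gt0 a0 invf_lt1 //; split => //; exists 0 => n _.
  by rewrite mulVf ?expr1n // lt0r_neq0.
apply: (expsmall_le _ (expsmall_add a0 (expsmall_add a0 one (hmany q qq)) fs)).
exists 1 => n n1; set X := [set M in beta_max n q | _].
pose A0 := [set M in beta_max n q | M :\: odds n == set0].
pose A1 := [set M in beta_max n q | M :\: odds n \in many n K' q].
pose A2 := [set M in beta_max n q | M :\: odds n \in few n K].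
have cov : X \subset A0 :|: A1 :|: A2.
  apply/subsetP => M; rewrite in_set => /andP[MB]; have evM := odds_part MB.
  have e0 : (M \in A0) = (M :\: odds n == set0) by rewrite in_set MB.
  have e1 : (M \in A1) = (M :\: odds n \in many n K' q) by rewrite in_set MB.
  have e2 : (M \in A2) = (M :\: odds n \in few n K) by rewrite in_set MB.
  rewrite !in_setU e0 e1 e2 {e0 e1 e2}.
  move: (MB); rewrite inE => /andP[_ hq].
  move: (M :\: odds n) evM hq => S evM hq; apply: contraR; rewrite !negb_or => /andP[/andP[SN nb] nf].
  have sm : #|S| < K' by rewrite ltnNge; apply: contra nb => big; rewrite inE evM big hq.
  have /set0Pn[x xS] := SN.
  move: nf; rewrite inE evM /= (leqW (leqW (ltnW sm))) /= negb_or => /andP[no2 no1].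
  have hx : 4 * (n - x) < n.
    by rewrite ltnNge; apply: contra no1 => h; apply/exists_inP; exists x.
  have SE : S = [set x].
    apply/setP => y; rewrite inE; apply/idP/eqP => [yS|->//]; apply: ord_inj.
    have [lt|gt|//] := ltngtP y x; case/negP: no2.
      by apply/exists_inP; exists y => //; apply/exists_inP; exists x.
    by apply/exists_inP; exists x => //; apply/exists_inP; exists y.
  have [evS sS' _] := even_setsP evM.
  apply/imsetP; exists x => //; rewrite unfold_in /main evS //=.
  have := subsetP (sum_free_interval sS') _ xS; rewrite inE => -> /=.
  by have := ltn_ord x; move: hx n1; clear; lia.
have c0 : #|A0| <= 1.
  rewrite -(cards1 (odds n)); apply/subset_leq_card/subsetP => M.
  rewrite !in_set => /andP[/andP[mM _] /eqP M0]; rewrite inE eqEsubset.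
  have MO : M \subset odds n by rewrite -setD_eq0 M0.
  rewrite MO; apply/subsetP => x xO; apply: contraT => xM.
  move: mM; rewrite max_sum_freeE => /vmaxP[_ mx].
  have := mx x (subsetP (sum_free_interval (odds_sum_free n)) x xO) xM.
  move=> /(blockedS MO); apply/contraLR => _.
  exact: sum_free_not_blocked (odds_sum_free n) xO.
have c1 : #|A1| <= \sum_(S in many n K' q) weight S.
  apply: leq_trans (beta_fibers q _); last by apply/subsetP => S; rewrite inE => /andP[].
  by apply/subset_leq_card/subsetP => M; rewrite !in_set.
have c2 : #|A2| <= \sum_(S in few n K) weight S.
  apply: leq_trans (beta_fibers q _); last by apply/subsetP => S; rewrite inE => /andP[].
  by apply/subset_leq_card/subsetP => M; rewrite !in_set.
apply: (leq_trans (subset_leq_card cov)); apply: (leq_trans (leq_card_setU _ _).1).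
by apply: leq_add => //; apply: (leq_trans (leq_card_setU _ _).1); apply: leq_add.
Qed.

(** The two truncated differences express closeness from both sides. From below, [card_nonmax] loses
    only contributions of pairs, which belong to [few], and each term of [evsum] with [s <= 3 n / 4]
    is at most [2^(3n/16)]. *)
Theorem beta_count : exists2 q0, 0 < q0 & forall q, q0 <= q ->
  expsmall a (fun n => #|beta_max n q| - evsum n) /\
  expsmall a (fun n => evsum n - #|beta_max n q|).
Proof.
have [q0 q00 hrest] := beta_rest; pose K := 2; exists q0 => // q qr.
have fs := few_small K.
have wmain n (s' : 'I_n.+1) : main s' -> weight [set s'] = 2 ^ (s' %/ 2 %/ 2).
  by move=> /mainP[h1 h2 h3 _]; apply: nmis_single.
have [_ _ _ _ a1] := base_facts.
have a1' : (1 < a)%R.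
  rewrite lt_neqAle a1 andbT; apply/eqP => e; have : (1 < 2 :> R)%R by rewrite ltr1n.
  by rewrite -a4 -e expr1n ltxx.
have ia : (0 < a^-1 < 1)%R by rewrite invr_gt0 a0 invf_lt1.
have half : expsmall a (fun n => 2 ^ (3 * n %/ 16)).
  have [t t01 ht] := power_gap 4 ia; exists t; split => //; exists 0 => n _.
  set k := 3 * n %/ 16; have hk : 16 * k <= 3 * n by rewrite mulnC leq_trunc_div.
  have kn : 4 * k <= n by move: hk; clear; lia.
  rewrite natrX -a4 -exprM exprMn; have hn : n <= 4 * (n - 4 * k) by move: hk; clear; lia.
  apply: (@le_trans _ _ (a^-1 ^+ (n - 4 * k) * a ^+ n)%R); last first.
    by apply: ler_wpM2r; [apply/exprn_ge0/ltW | apply: ht].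
  rewrite -[X in (_ * a ^+ X)%R](subnK kn) exprD mulrA -exprMn mulVf ?lt0r_neq0 //.
  by rewrite expr1n mul1r.
have fiber_sum n (f : {set 'I_n.+1} -> nat) : \sum_(S in main_sets n) f S = \sum_(s' | main s') f [set s'].
  by rewrite big_imset //=; move=> x y _ _; apply: set1_inj.
split.
  apply: (expsmall_le _ (hrest q qr)); exists 0 => n _; rewrite leq_subLR.
  pose A3 := [set M in beta_max n q | M :\: odds n \in main_sets n].
  have c3 : #|A3| <= evsum n.
    apply: (leq_trans (beta_fibers q (main_sets_even n))); rewrite fiber_sum /evsum.
    rewrite big_mkcond [leqRHS]big_mkcond; apply: leq_sum => s' _.
    by case: ifP => // hm; rewrite wmain //; move: hm => /and3P[-> ->].
  apply: (leq_trans _ (leq_add c3 (leqnn _))).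
  apply: leq_trans _ (leq_card_setU _ _).1; apply/subset_leq_card/subsetP => M MB.
  by rewrite in_setU !in_set; move: MB; rewrite in_set => ->; rewrite orbN.
have err : expsmall a (fun n => n.+1 * 2 ^ (3 * n %/ 16) + n.+1 * \sum_(S in few n K) weight S).
  exact: (expsmall_add a0 (expsmall_muln half) (expsmall_muln fs)).
apply: (expsmall_le _ err).
exists q => n qn; rewrite leq_subLR.
have split_ev : evsum n <= \sum_(s' : 'I_n.+1 | main s') weight [set s'] + n.+1 * 2 ^ (3 * n %/ 16).
  have -> : n.+1 * 2 ^ (3 * n %/ 16) = \sum_(s' : 'I_n.+1) 2 ^ (3 * n %/ 16).
    by rewrite sum_nat_const card_ord.
  rewrite /evsum [X in _ <= X + _]big_mkcond -big_split big_mkcond.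
  apply: leq_sum => s' _ /=; case: ifP => // /andP[h1 h2].
  have [hm|nm] := boolP (main s'); first by rewrite wmain // leq_addr.
  rewrite add0n leq_exp2l //; move: nm; rewrite /main h1 h2 /= -leqNgt.
  by clear; lia.
apply: (leq_trans split_ev); rewrite [X in _ <= _ + X]addnC addnA leq_add2r.
have main_bound : \sum_(s' : 'I_n.+1 | main s') weight [set s'] <=
   \sum_(s' : 'I_n.+1 | main s') (#|[set M | max_sum_free M & M :\: odds n == [set s']]| +
     \sum_(S in few n K) weight S).
  apply: leq_sum => s' hm; have [h1 h2 h3 hE] := mainP hm.
  have [_ sS' dS] := even_setsP hE.
  apply: (leq_trans (card_nonmax sS' (odds_sum_free n) dS)); rewrite leq_add2l.
  pose P := [set x : 'I_n.+1 | [&& x \notin odds n, x \notin [set s'] & sum_free (x |: [set s'])]].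
  have inj : {in P &, injective (fun x => x |: [set s'])}.
    move=> x y; rewrite !inE => /and3P[_ xs _] /and3P[_ ys _] /setP /(_ x).
    by rewrite !inE eqxx (negbTE xs) !orbF => e; apply/eqP; rewrite -e.
  rewrite (eq_bigl (mem P)); last by move=> x; rewrite !inE.
  rewrite -(big_imset (fun S => nmis (lk S) (odds n :\: excl S)) inj) /=.
  rewrite big_mkcond [leqRHS]big_mkcond; apply: leq_sum => S _.
  case: ifP => // /imsetP[x]; rewrite inE => /and3P[xO xs xsf] ->.
  rewrite even_pair //; first by rewrite inE.
  by rewrite in_set1 in xs.
apply: (leq_trans main_bound); rewrite big_split /=; apply: leq_add.
  pose A3 := [set M in beta_max n q | M :\: odds n \in main_sets n].
  have := @card_fibers_sum _ _ A3 (main_sets n) (fun M => M :\: odds n).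
  rewrite fiber_sum => h; apply: (@leq_trans #|A3|); last first.
    by apply/subset_leq_card/subsetP => M; rewrite in_set => /andP[].
  rewrite h; last by move=> M; rewrite in_set => /andP[].
  apply: leq_sum => s' hm; apply/subset_leq_card/subsetP => M; rewrite !inE.
  move=> /andP[mM /eqP ME]; rewrite mM ME cards1 mul1n qn eqxx andbT /=.
  by apply/imsetP; exists s'.
apply: (@leq_trans (\sum_(s' : 'I_n.+1) \sum_(S in few n K) weight S)).
  by rewrite big_mkcond; apply: leq_sum => s' _; case: ifP.
by rewrite sum_nat_const card_ord.
Qed.

End Beta.

(** * Sets with few elements below the middle *)

(** The points of [V :&: U] are isolated, hence common to all maximal independent sets. *)
Lemma nmis_isolated (T : finType) (e : rel T) (V U : {set T}) : symmetric e ->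
  (forall x y, x \in V -> x \in U -> y \in V -> ~~ e x y) ->
  nmis e V <= nmis e (V :\: U).
Proof.
move=> esy h; pose W := V :&: U.
have -> : nmis e V = #|[set I | [&& mis e V I, W \subset I & [disjoint I & set0]]]|.
  apply: eq_card => I; rewrite !inE; case: (boolP (mis e V I)) => //= /misP[IV _ Idom].
  rewrite disjoint_sym disjoints_subset sub0set andbT; apply/esym/subsetP => x.
  rewrite inE => /andP[xV xU]; apply: contraT => xI; have [y yI] := Idom x xV xI.
  by rewrite (negbTE (h x y xV xU (subsetP IV _ yI))).
apply: (leq_trans (nmis_restrict esy set0 (subsetIl V U))); apply: eq_leq; congr nmis.
apply/setP => x; rewrite !inE; case xV: (x \in V); rewrite ?andbF // !andbT /= orbF.
case xU: (x \in U) => //=; apply/negP => /exists_inP[w]; rewrite inE => /andP[wV wU].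
by apply/negP/h.
Qed.

(** * Link graphs of low sets on the top half *)

Section Top.
Variable n : nat.
Local Notation T := 'I_n.+1.
Local Notation h := (n %/ 2).
Implicit Types S V : {set T}.

Definition top : {set T} := [set x : T | n < 2 * x].

Lemma top_sum_free : sum_free top.
Proof.
apply/sum_freeP => x y z; rewrite !inE => hx hy hz e; have := ltn_ord z.
by move: e hx hy; clear; lia.
Qed.

Lemma card_range i j : j <= n -> #|[set x : T | i <= x <= j]| = j.+1 - i.
Proof.
move=> jn; have lt (k : 'I_(j.+1 - i)) : i + k < n.+1 by have := ltn_ord k; move: jn; clear; lia.
have -> : [set x : T | i <= x <= j] = [set (inord (i + k) : T) | k : 'I_(j.+1 - i)].
  apply/setP => x; rewrite inE; apply/andP/imsetP => [[ix xj]|[k _ ->]].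
    have lk : x - i < j.+1 - i by move: ix xj; clear; lia.
    by exists (Ordinal lk) => //=; rewrite subnKC // inord_val.
  by rewrite inordK ?lt //; have := ltn_ord k; clear; lia.
rewrite card_imset ?card_ord // => k k' /(congr1 (@nat_of_ord _)).
by rewrite !inordK ?lt // => e; apply: ord_inj; move: e; clear; lia.
Qed.

Lemma card_top : #|top| = n - h.
Proof.
have -> : top = [set x : T | h.+1 <= x <= n].
  by apply/setP => x; rewrite !inE; have := ltn_ord x; clear; lia.
by rewrite card_range //; clear; lia.
Qed.

Definition low_sets := [set S : {set T} | (S \subset ~: top) && sum_free S].

Lemma low_setsP S : S \in low_sets ->
  [/\ forall s, s \in S -> 0 < s <= h, sum_free S & [disjoint S & top]].
Proof.
rewrite inE => /andP[SL sS]; split => //; last by rewrite disjoints_subset.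
move=> s sS'; have := subsetP SL _ sS'; rewrite !inE => s1.
have := subsetP (sum_free_interval sS) _ sS'; rewrite inE => ->.
by move: s1; clear; lia.
Qed.

Section LowSet.
Variable S : {set T}.
Hypothesis SL : S \in low_sets.

Lemma lk_top x y : x \in top -> y \in top -> lk S x y ->
  exists2 s, s \in S & x + s = y \/ y + s = x.
Proof.
have [Sh _ _] := low_setsP SL; rewrite !inE => xt yt /andP[_ /exists_inP[s sS /or3P h]].
exists s => //; have := Sh s sS; case: h => /eqP h; [|by left|by right].
by move: h xt yt; clear; lia.
Qed.

Lemma top_triangle_free : triangle_free (lk S) top.
Proof.
have [Sh sS _] := low_setsP SL; have sP := sum_freeP _ sS.
move=> x y z xt yt zt /(lk_top xt yt)[a aS e1] /(lk_top yt zt)[b bS e2] /(lk_top xt zt)[c cS e3].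
have [a0 b0] := (Sh _ aS, Sh _ bS).
case: e1 => e1; case: e2 => e2; case: e3 => e3; first
 [ by apply: (sP a b c) => //; move: e1 e2 e3; clear; lia
 | by apply: (sP a c b) => //; move: e1 e2 e3; clear; lia
 | by apply: (sP b c a) => //; move: e1 e2 e3; clear; lia
 | by move: e1 e2 e3 a0 b0; clear; lia ].
Qed.

Lemma range_stars (f g k : nat -> nat) i j q V : j <= n ->
  (forall x, i <= x <= j -> [/\ f x <= n, g x <= n & k x <= n]) ->
  (forall x, i <= x <= j -> [/\ (inord (f x) : T) \in V, (inord (g x) : T) \in V & (inord (k x) : T) \in V]) ->
  (forall x y, i <= x <= j -> i <= y <= j -> [/\ f x = f y -> x = y,
      g x = g y -> x = y & k x = k y -> x = y]) ->
  (forall x, i <= x <= j -> g x <> k x) ->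
  (forall x, i <= x <= j -> lk S (inord (f x)) (inord (g x)) && lk S (inord (f x)) (inord (k x))) ->
  9 * q <= j.+1 - i ->
  pack (lk S) V q.
Proof.
move=> jn hn hV inj gk edge qk.
pose X := [set x : T | i <= x <= j].
apply: (@pack_stars _ (lk S) _ X V (fun x => inord (f x)) (fun x => inord (g x))
   (fun x => inord (k x))).
- move=> x y; rewrite !inE => xX yX /(congr1 (@nat_of_ord _)).
  have [fx _ _] := hn x xX; have [fy _ _] := hn y yX.
  by rewrite !inordK // => e; apply: ord_inj; have [i1 _ _] := inj x y xX yX; apply: i1.
- move=> x y; rewrite !inE => xX yX /(congr1 (@nat_of_ord _)).
  have [_ fx _] := hn x xX; have [_ fy _] := hn y yX.
  by rewrite !inordK // => e; apply: ord_inj; have [_ i1 _] := inj x y xX yX; apply: i1.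
- move=> x y; rewrite !inE => xX yX /(congr1 (@nat_of_ord _)).
  have [_ _ fx] := hn x xX; have [_ _ fy] := hn y yX.
  by rewrite !inordK // => e; apply: ord_inj; have [_ _ i1] := inj x y xX yX; apply: i1.
- move=> x; rewrite !inE => xX; have [f1 g1 k1] := hn x xX; have [v1 v2 v3] := hV x xX.
  split => //; apply/eqP => /(congr1 (@nat_of_ord _)); rewrite !inordK //; exact: gk.
- by move=> x; rewrite inE; apply: edge.
- by rewrite card_range.
Qed.

Lemma chain_pack (m : T) i j q V : m \in S -> j + 2 * m <= n ->
  (forall x : T, i <= x <= j + 2 * m -> x \in V) -> 9 * q <= j.+1 - i ->
  pack (lk S) V q.
Proof.
move=> mS jn hV qk; have [Sh _ _] := low_setsP SL; have m0 := Sh _ mS.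
have inV x : i <= x <= j + 2 * m -> (inord x : T) \in V.
  by move=> hx; apply: hV; rewrite inordK //; move: hx jn; clear; lia.
apply: (@range_stars (fun x => x + m) id (fun x => x + m + m) i j) => //.
- by move: jn; clear; lia.
- by move=> x hx; split; move: hx jn; clear; lia.
- by move=> x hx; split; apply: inV; move: hx jn; clear; lia.
- by move=> x y _ _; split; clear; lia.
- by move=> x _; move: m0; clear; lia.
- move=> x hx; apply/andP; split; apply: (lkI mS); rewrite !inordK //; try by move: hx jn m0; clear; lia.
    by apply: Or33.
  by apply: Or32.
Qed.

Lemma two_pack (m s : T) i j q V : m \in S -> s \in S -> m != s -> j + maxn m s <= n ->
  (forall x : T, i <= x -> x \in V) -> 9 * q <= j.+1 - i ->
  pack (lk S) V q.
Proof.
move=> mS sS ms jn hV qk; have [Sh _ _] := low_setsP SL; have m0 := Sh _ mS; have s0 := Sh _ sS.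
have ms' : m <> s :> nat by move=> e; move: ms; rewrite (ord_inj e) eqxx.
have inV x : i <= x <= n -> (inord x : T) \in V.
  by move=> hx; apply: hV; rewrite inordK //; move: hx; clear; lia.
apply: (@range_stars id (fun x => x + m) (fun x => x + s) i j) => //.
- by move: jn; clear; lia.
- by move=> x hx; split; move: hx jn; clear; lia.
- by move=> x hx; split; apply: inV; move: hx jn; clear; lia.
- by move=> x y _ _; split; clear; lia.
- by move=> x _; move: ms'; clear; lia.
- move=> x hx; apply/andP; split; [apply: (lkI mS)|apply: (lkI sS)]; rewrite !inordK //;
    try by move: hx jn m0 s0; clear; lia.
    by apply: Or32.
  by apply: Or32.
Qed.

(* A single element [m] below [h - r], and [m] within [r] of n/4. *)
Definition ideal r := [exists m in S, (4 * m <= n + 4 * r) && (n <= 4 * m + 4 * r) &&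
  [forall s in S, (s + r <= h) ==> (s == m)]].

Local Open Scope ring_scope.
Variables (R : realFieldType) (s g : R).
Hypotheses (s0 : 0 < s) (s2 : s ^+ 2 = 2) (sg : s * g = 7 / 5) (g01 : 0 < g < 1).

Lemma one_le_s : 1 <= s.
Proof.
rewrite leNgt; apply/negP => lt; have : s * s < 1 * 1 by apply: ltr_pM => //; apply: ltW.
by rewrite -expr2 s2 mulr1 ltNge ler1n.
Qed.

Lemma sV_le_g : s^-1 <= g.
Proof. by rewrite -(ler_pM2l s0) divff ?lt0r_neq0 // sg; lra. Qed.

(** Excluded points may destroy paths, but a point and a path lost together are worth [s * g >= 1],
    so exclusion never worsens the bound. *)
Lemma trade (N x q : nat) : (x <= N)%N -> s ^+ (N - x) * g ^+ (q - x) <= s ^+ N * g ^+ q.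
Proof.
move=> xN; have /andP[g0 g1] := g01.
rewrite -[in leRHS](subnK xN) [s ^+ (_ + _)]exprD -mulrA.
apply: ler_wpM2l; first exact/exprn_ge0/ltW.
apply: (@le_trans _ _ (s ^+ x * g ^+ (q - x + x))); last first.
  apply: ler_wpM2l; first exact/exprn_ge0/ltW.
  by apply: ler_wiXn2l; [exact: ltW | exact: ltW | clear; lia].
rewrite exprD mulrCA -exprMn sg ler_peMr //; first exact/exprn_ge0/ltW.
by apply: exprn_ege1; lra.
Qed.

Lemma nmis_top_pack V q : V \subset top -> pack (lk S) V q ->
  (nmis (lk S) (V :\: excl S))%:R <= s ^+ #|V| * g ^+ q.
Proof.
move=> Vt pV; have /andP[g0 g1] := g01.
have pk := pack_del (V :&: excl S) pV.
have VE : V :\: (V :&: excl S) = V :\: excl S by rewrite setDIr setDv set0U.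
rewrite VE in pk.
have tf : triangle_free (lk S) (V :\: excl S).
  by apply: triangle_freeS top_triangle_free; apply: subset_trans Vt; apply: subsetDl.
apply: (le_trans (hujter_tuza (@lk_sym _ S) (@lk_irr _ S) s0 s2 sg tf pk)).
have -> : #|V :\: excl S| = (#|V| - #|V :&: excl S|)%N by rewrite cardsD.
by apply: trade; apply/subset_leq_card/subsetIl.
Qed.

Lemma nmis_top_removed (V U : {set T}) k : V \subset top -> U \subset V ->
  (forall x y : T, x \in V -> x \in U -> y \in V -> ~~ lk S x y) -> (k <= #|U|)%N ->
  (nmis (lk S) (V :\: excl S))%:R <= s ^+ #|V| * (s^-1) ^+ k.
Proof.
move=> Vt UV iso kU; set V' := V :\: excl S.
have tf : triangle_free (lk S) (V' :\: U).
  apply: triangle_freeS top_triangle_free; apply: subset_trans Vt.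
  by apply: (subset_trans (subsetDl _ _)); apply: subsetDl.
have p0 : pack (lk S) (V' :\: U) 0 by exists (set0 : {set {set T}}); split=> //; [apply/trivIsetP=> A B; rewrite inE | move=> B; rewrite inE].
apply: (@le_trans _ _ (nmis (lk S) (V' :\: U))%:R).
  rewrite ler_nat; apply: nmis_isolated; first exact: lk_sym.
  by move=> x y; rewrite !inE => /andP[_ xV] xU /andP[_ yV]; apply: iso.
apply: (le_trans (hujter_tuza (@lk_sym _ S) (@lk_irr _ S) s0 s2 sg tf p0)).
rewrite expr0 mulr1 exprVn ler_pdivlMr ?exprn_gt0 // -exprD.
apply: ler_weXn2l; first exact: one_le_s.
apply: (@leq_trans (#|V :\: U| + #|U|)); last by rewrite cardsD (setIidPr UV) subnK // subset_leq_card.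
apply: leq_add => //; apply/subset_leq_card/setSD/subsetDl.
Qed.

(** If all elements exceed [n / 4 + r], the points within [r] of [3 n / 4] are isolated in the top
    half. An element [m] below [n / 4 - r] gives paths [x, x + m, x + 2 m]. The remaining way not to
    be ideal is to have two elements [m] and [t] up to [h - r], which give paths
    [x + m, x, x + t]. *)
Lemma nonideal_gain r q : ~~ ideal r -> (9 * q <= r)%N -> (8 * r + 8 <= n)%N ->
  (nmis (lk S) (top :\: excl S))%:R <= s ^+ #|top| * g ^+ q.
Proof.
move=> nid qr rn; have /andP[g0 g1] := g01; have [Sh sS _] := low_setsP SL.
have inT (x : T) i : (h < i)%N -> (i <= x)%N -> x \in top.
  by move=> hi ix; rewrite inE; move: hi ix; clear; lia.
have [all1|] := boolP [forall t in S, (n + 4 * r < 4 * t)%N].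
  pose U := [set x : T | ((3 * n - 4 * r + 3) %/ 4 <= x <= (3 * n + 4 * r) %/ 4)%N].
  apply: (@le_trans _ _ (s ^+ #|top| * (s^-1) ^+ q)).
    apply: (@nmis_top_removed top U) => //.
    - by apply/subsetP => x; rewrite !inE; move: rn; clear; lia.
    - move=> x y xt; rewrite inE => xU yt; apply/negP => /(lk_top xt yt)[t tS e].
      move/'forall_implyP: all1 => /(_ t tS) ht; have yn := ltn_ord y.
      by case: e => e; move: yt xU e ht yn; rewrite inE; clear; lia.
    - by rewrite card_range; move: rn qr; clear; lia.
  apply: ler_wpM2l; first exact/exprn_ge0/ltW.
  by apply: ler_expn; [rewrite invr_ge0 ltW | exact: sV_le_g].
move=> /forall_inPn[m mS]; rewrite -leqNgt => hm; have m0 := Sh _ mS.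
have [c2|c2] := ltnP (4 * m + 4 * r) n.
  apply: nmis_top_pack => //; apply: (@chain_pack m h.+1 (n - 2 * m)) => //.
  - by move: c2; clear; lia.
  - by move=> x /andP[hx _]; apply: inT hx.
  - by move: c2 qr; clear; lia.
have [t tS /andP[tr tm]] : exists2 t, t \in S & (t + r <= h)%N && (t != m).
  move: nid => /exists_inPn /(_ m mS); rewrite hm c2 /= => /forall_inPn[t tS].
  by rewrite negb_imply => ht; exists t.
apply: nmis_top_pack => //; apply: (@two_pack m t h.+1 (n - maxn m t)) => //.
- by rewrite eq_sym.
- by move: tr hm rn; clear; lia.
- by move=> x hx; apply: inT hx.
- by move: tr hm rn qr; clear; lia.
Qed.

End LowSet.
End Top.

(** * Containers on the window below the middle *)

Section Window.
Variables n r : nat.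
Local Notation T := 'I_n.+1.
Local Notation h := (n %/ 2).
Local Notation W := 'I_(8 * r).+1.
Hypotheses (r0 : 0 < r) (rn : 11 * r + 5 <= n).

Definition low (M : {set T}) : {set T} := [set x : T in M | x + r <= h].
Definition window : {set T} := [set x : T | h < x + r & x <= h].

(* Translates the windows (h - r, h] and (2h - 2r, 2h] into [1, 8r], so that sums of two points
   of the first window land in the second. *)
Definition window_img (M : {set T}) : {set W} :=
  [set z : W | (3 * r < z) && (z <= 4 * r) && ((inord (z + h - 4 * r) : T) \in M)
    || (6 * r < z) && ((inord (z + 2 * h - 8 * r) : T) \in M)].

Lemma window_img_sum_free M : sum_free M -> sum_free (window_img M).
Proof.
move=> /sum_freeP sM; apply/sum_freeP => x y z; rewrite !inE => hx hy hz e.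
have := ltn_ord z; rewrite ltnS => zr.
case/orP: hx => /andP[hx xM]; last by case/orP: hy => /andP[]; move: hx r0 zr e; clear; lia.
case/orP: hy => /andP[hy yM]; last by move: hx hy r0 zr e; clear; lia.
case/orP: hz => /andP[hz zM]; first by move: hx hy hz r0 e; clear; lia.
apply: (sM _ _ _ xM yM zM); rewrite !inordK //; by move: hx hy hz rn e zr; clear; lia.
Qed.

Definition tw (x : T) : W := inord (x + 4 * r - h).
Definition yw (y : T) : W := inord (y + 8 * r - 2 * h).

Lemma twE (x : T) : x \in window -> tw x = x + 4 * r - h :> nat.
Proof. by rewrite inE => /andP[h1 h2]; rewrite inordK //; move: h1 h2 rn; clear; lia. Qed.

Lemma ywE (y : T) : 2 * h < y + 2 * r -> y <= 2 * h -> yw y = y + 8 * r - 2 * h :> nat.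
Proof. by move=> h1 h2; rewrite inordK //; move: h1 h2 rn; clear; lia. Qed.

Lemma tw_img (M : {set T}) (x : T) : x \in M -> x \in window -> tw x \in window_img M.
Proof.
move=> xM xw; rewrite inE twE //; move: xw; rewrite inE => /andP[h1 h2].
have -> : x + 4 * r - h + h - 4 * r = x by move: h1 h2 rn; clear; lia.
by rewrite inord_val xM; move: h1 h2 rn; clear; lia.
Qed.

Lemma yw_img (M : {set T}) (y : T) : y \in M -> 2 * h < y + 2 * r -> y <= 2 * h -> yw y \in window_img M.
Proof.
move=> yM h1 h2; rewrite inE ywE //.
have -> : y + 8 * r - 2 * h + 2 * h - 8 * r = y by move: h1 h2 rn; clear; lia.
by rewrite inord_val yM; move: h1 h2 rn; clear; lia.
Qed.

Section Container.
Variables A B : {set W}.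
Hypothesis sB : sum_free B.

(** [wlow] and [wtop] are what the container [A :|: B] admits of the window and of the top half;
    [wmain] is the sum-free share of [wlow]. *)
Definition wlow : {set T} := [set x in window | tw x \in A :|: B].
Definition wmain : {set T} := [set x in window | tw x \in B].
Definition wtop : {set T} :=
  top n :\: [set y : T | [&& 2 * h < y + 2 * r, y <= 2 * h & yw y \notin A :|: B]].

Lemma card_wlow : #|wlow| <= #|A| + #|wmain|.
Proof.
pose WA := [set x in window | tw x \in A].
have WAc : #|WA| <= #|A|.
  rewrite -[leqLHS](@card_in_imset _ _ tw).
    by apply: subset_leq_card; apply/subsetP => _ /imsetP[x xW ->]; move: xW; rewrite inE => /andP[].
  move=> x y; rewrite inE => /andP[xw _]; rewrite inE => /andP[yw' _] /(congr1 (@nat_of_ord _)).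
  rewrite !twE // => e; apply: ord_inj; move: xw yw' e; rewrite !inE; move: rn; clear; lia.
apply: (@leq_trans #|WA :|: wmain|); last first.
  by apply: (leq_trans (leq_card_setU _ _).1); rewrite leq_add2r.
apply: subset_leq_card; apply/subsetP => x; rewrite [x \in wlow]inE => /andP[xw xAB].
rewrite in_setU in_setU in xAB *; rewrite [x \in WA]inE [x \in wmain]inE xw /=.
exact: xAB.
Qed.

(** Adding the least and the greatest element of [wmain] to all its elements yields at least
    [2 |wmain| - 1] points of the top half. As [B] is sum-free they avoid [B], so at most [|A|] of
    them survive in [wtop]. *)
Lemma card_wtop : #|wtop| + 2 * #|wmain| <= #|top n| + #|A| + 1.
Proof.
have [Q0|[z0 z0Q]] := set_0Vmem wmain.
  rewrite Q0 cards0 muln0 addn0 -addnA; apply: (leq_trans _ (leq_addr _ _)).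
  by apply/subset_leq_card/subsetDl.
case: (arg_minnP (fun x : T => nat_of_ord x) z0Q) => a aQ amin.
case: (arg_maxnP (fun x : T => nat_of_ord x) z0Q) => b bQ bmax.
have wQ (x : T) : x \in wmain -> [/\ h < x + r, x <= h & tw x \in B].
  by rewrite inE => /andP[]; rewrite inE => /andP[].
have winQ (x : T) : x \in wmain -> x \in window by rewrite inE => /andP[].
have [[ar ah _] [br bh _]] := (wQ a aQ, wQ b bQ).
have bound (x y : T) : x <= h -> y <= h -> x + y < n.+1.
  by clear; lia.
pose f (x : T) := inord (a + x) : T; pose g (x : T) := inord (b + x) : T.
pose Y := f @: wmain :|: g @: wmain.
have fE x : x \in wmain -> f x = a + x :> nat.
  by move=> /wQ[_ xh _]; rewrite inordK // bound.
have gE x : x \in wmain -> g x = b + x :> nat.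
  by move=> /wQ[_ xh _]; rewrite inordK // bound.
have fc : #|f @: wmain| = #|wmain|.
  apply: card_in_imset => x y xQ yQ /(congr1 (@nat_of_ord _)).
  by rewrite !fE // => e; apply: ord_inj; move: e; clear; lia.
have gc : #|g @: wmain| = #|wmain|.
  apply: card_in_imset => x y xQ yQ /(congr1 (@nat_of_ord _)).
  by rewrite !gE // => e; apply: ord_inj; move: e; clear; lia.
have fg : #|f @: wmain :&: g @: wmain| <= 1.
  rewrite -(cards1 (f b)); apply: subset_leq_card; apply/subsetP => _ /setIP[/imsetP[x xQ ->]].
  move=> /imsetP[y yQ] /(congr1 (@nat_of_ord _)); rewrite fE // gE // => e.
  have := amin y yQ; have := bmax x xQ => /= hb ha; rewrite inE; apply/eqP/ord_inj.
  by rewrite !fE //; move: e ha hb; clear; lia.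
have Yc : 2 * #|wmain| <= #|Y| + 1.
  by have := cardsUI (f @: wmain) (g @: wmain); rewrite fc gc -/Y; move: fg; clear; lia.
have YP (y : T) : y \in Y -> exists u v : T, [/\ u \in wmain, v \in wmain & u + v = y :> nat].
  by case/setUP => /imsetP[x xQ ->]; [exists a, x; rewrite fE|exists b, x; rewrite gE].
have Yw (y : T) : y \in Y -> [/\ 2 * h < y + 2 * r, y <= 2 * h, y \in top n & yw y \notin B].
  move=> /YP[u [v [uQ vQ e]]]; have [ur uh uB] := wQ u uQ; have [vr vh vB] := wQ v vQ.
  have y1 : 2 * h < y + 2 * r by move: e ur vr rn; clear; lia.
  have y2 : y <= 2 * h by move: e uh vh; clear; lia.
  split => //; first by rewrite inE; move: y1 rn; clear; lia.
  apply/negP => yB; apply: (sum_freeP _ sB _ _ _ uB vB yB).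
  rewrite (twE (winQ _ uQ)) (twE (winQ _ vQ)) (ywE y1 y2).
  move: e ur uh vr vh rn; clear; lia.
have ZY : #|wtop :&: Y| <= #|A|.
  rewrite -[leqLHS](@card_in_imset _ _ yw).
    apply: subset_leq_card; apply/subsetP => _ /imsetP[y /setIP[yZ yY] ->].
    have [y1 y2 _ yB] := Yw y yY; move: yZ; rewrite /wtop in_setD => /andP[+ _].
    by rewrite inE y1 y2 /= negbK in_setU (negbTE yB) orbF.
  move=> x y /setIP[_ /Yw[x1 x2 _ _]] /setIP[_ /Yw[y1 y2 _ _]] /(congr1 (@nat_of_ord _)).
  by rewrite !ywE // => e; apply: ord_inj; move: e x1 x2 y1 y2 rn; clear; lia.
have Ytop : #|wtop :|: Y| <= #|top n|.
  apply: subset_leq_card; apply/subsetP => y /setUP[|/Yw[]] //.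
  by rewrite in_setD => /andP[].
have := cardsUI wtop Y; move: ZY Ytop Yc.
move: #|_ :&: _| #|_ :|: _| #|Y| #|wtop| => i u y w; clear; lia.
Qed.

Local Open Scope ring_scope.
Variables (R : realFieldType) (s g : R).
Hypotheses (s0 : 0 < s) (s2 : s ^+ 2 = 2) (sg : s * g = 7 / 5) (g01 : 0 < g < 1).

Lemma pack0 (I : finType) (e : rel I) (V : {set I}) : pack e V 0.
Proof.
by exists (set0 : {set {set I}}); split=> //; [apply/trivIsetP=> X Y; rewrite inE | move=> X; rewrite inE].
Qed.

(* Each point of [X] excludes a further point of the top half, unless the low part alone
   already forces the gain [g ^+ (r %/ 9)]. *)
Lemma window_weight (S0 X : {set T}) : (forall x, x \in S0 -> (x + r <= h)%N) ->
  X \subset wlow -> S0 :|: X \in low_sets n ->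
  (nmis (lk (S0 :|: X)) (wtop :\: excl (S0 :|: X)))%:R
    <= s ^+ #|wtop| * ((s^-1) ^+ #|X| + g ^+ (r %/ 9)).
Proof.
move=> S0h Xw SL; have /andP[g0 g1] := g01; have [Sh sS _] := low_setsP SL.
have Zt : wtop \subset top n by apply: subsetDl.
have Xwin x : x \in X -> (h < x + r)%N && (x <= h)%N.
  by move=> /(subsetP Xw); rewrite inE => /andP[]; rewrite inE.
have inZ (x : T) : (h < x)%N -> (x + 2 * r <= 2 * h)%N -> x \in wtop.
  by move=> x1 x2; rewrite in_setD !inE; move: x1 x2; clear; lia.
have sV0 : 0 <= s^-1 by rewrite invr_ge0 ltW.
(* If [r <= m <= h - 2 r], the points [m + x] with [x] in [X] lie in [wtop] and are excluded. If
   [m < r], a chain of step [m] gives the gain; if nothing lies up to [h - 2 r], isolated points in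
   the middle of the top half do. *)
have [/exists_inP[m mS0 mr]|/exists_inPn no] := boolP [exists m in S0, (m + 2 * r <= h)%N].
  have mS : m \in S0 :|: X by rewrite inE mS0.
  have [mlt|mge] := ltnP m r.
    apply: (@le_trans _ _ (s ^+ #|wtop| * g ^+ (r %/ 9))).
      apply: nmis_top_pack => //; apply: (@chain_pack _ _ SL m h.+1 (2 * h - 2 * r - 2 * m)) => //.
      - by move: mlt rn; clear; lia.
      - by move=> x hx; apply: inZ; move: hx mlt rn; clear; lia.
      - by move: mlt rn; clear; lia.
    apply: ler_wpM2l; first exact/exprn_ge0/ltW.
    by rewrite lerDr exprn_ge0.
  have tf : triangle_free (lk (S0 :|: X)) (wtop :\: excl (S0 :|: X)).
    by apply: triangle_freeS (top_triangle_free SL); apply: subset_trans Zt; apply: subsetDl.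
  apply: (le_trans (hujter_tuza (@lk_sym _ _) (@lk_irr _ _) s0 s2 sg tf (pack0 _ _))).
  rewrite expr0 mulr1.
  apply: (@le_trans _ _ (s ^+ #|wtop| * (s^-1) ^+ #|X|)); last first.
    apply: ler_wpM2l; first exact/exprn_ge0/ltW.
    by rewrite lerDl exprn_ge0 // ltW.
  rewrite exprVn ler_pdivlMr ?exprn_gt0 // -exprD; apply: ler_weXn2l; first exact: (one_le_s s0 s2).
  have mn x : x \in X -> (inord (m + x) : T) = (m + x)%N :> nat.
    by move=> /Xwin/andP[_ xh]; rewrite inordK //; move: xh mr; clear; lia.
  rewrite -[#|X|](@card_in_imset _ _ (fun x : T => inord (m + x) : T)); last first.
    move=> x y xX yX /(congr1 (@nat_of_ord _)); rewrite !mn // => e.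
    by apply: ord_inj; move: e; clear; lia.
  rewrite -[leqRHS](cardsID (excl (S0 :|: X))) addnC leq_add2r; apply: subset_leq_card.
  apply/subsetP => _ /imsetP[x xX ->]; have /andP[x1 x2] := Xwin x xX; rewrite inE; apply/andP; split.
    by apply: inZ; rewrite mn //; move: x1 x2 mr mge rn; clear; lia.
  rewrite inE; apply/blockedP; right; exists m, x; split => //; first by rewrite inE xX orbT.
  by left; rewrite mn.
pose U := [set x : T | (n + 2 * r - h <= x <= 2 * h - 2 * r)%N].
apply: (@le_trans _ _ (s ^+ #|wtop| * (s^-1) ^+ (r %/ 9))).
  apply: (@nmis_top_removed _ _ SL _ _ _ s0 s2 sg wtop U) => //.
  - by apply/subsetP => x; rewrite inE => hx; apply: inZ; move: hx rn r0; clear; lia.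
  - move=> x y xZ; rewrite inE => xU yZ; apply/negP => /(lk_top SL (subsetP Zt _ xZ) (subsetP Zt _ yZ)).
    case=> t tS e; have th : (h < t + 2 * r)%N.
      case/setUP: tS => [/no|/Xwin/andP[]]; first by rewrite -ltnNge.
      by clear; lia.
    have := ltn_ord y; have := subsetP Zt _ yZ; rewrite inE.
    by case: e => e; move: xU e th; clear; lia.
  - by rewrite card_range; move: rn; clear; lia.
apply: ler_wpM2l; first exact/exprn_ge0/ltW.
apply: (@le_trans _ _ (g ^+ (r %/ 9))); last by rewrite lerDr exprn_ge0.
by apply: ler_expn => //; exact: (sV_le_g s0 sg).
Qed.

End Container.
End Window.

Section ContainerCount.
Variables n r : nat.
Local Notation T := 'I_n.+1.
Local Notation h := (n %/ 2).
Local Notation W := 'I_(8 * r).+1.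
Hypotheses (r0 : 0 < r) (rn : 11 * r + 5 <= n).
Variables (A B : {set W}) (S0 : {set T}).
Hypothesis sB : sum_free B.
Hypothesis nid : ~~ ideal S0 r.

Definition top_fiber : {set {set T}} := [set M : {set T} | vmax (top n) M & low r M == S0].

Let MM := [set M in top_fiber | window_img r M \subset A :|: B].

Lemma ideal_extend (X : {set T}) : X \subset window n r -> ~~ ideal (S0 :|: X) r.
Proof.
move=> Xw; apply: contra nid => /exists_inP[m mS /andP[hm /forall_inP u]].
have hX x : x \in X -> (h < x + r)%N by move/(subsetP Xw); rewrite inE => /andP[].
apply/exists_inP; exists m.
  case/setUP: mS => // /hX; move: hm rn; clear; lia.
by rewrite hm; apply/forall_inP => x xS; apply: u; rewrite inE xS.
Qed.

Lemma top_fiberP (M : {set T}) : M \in top_fiber -> [/\ vmax (top n) M, low r M = S0 &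
  M :\: top n = S0 :|: (M :&: window n r)].
Proof.
rewrite inE => /andP[vM /eqP lM]; split => //; apply/setP => x.
rewrite -lM !inE; case: (x \in M); rewrite ?andbF ?andbT //=.
by move: rn; clear; lia.
Qed.

Lemma container_fiber (X : {set T}) : X \subset wlow n A B -> (0 < #|[set M in MM | M :&: window n r == X]|)%N ->
  [/\ S0 :|: X \in low_sets n, forall x, x \in S0 -> x + r <= h,
    (#|[set M in MM | M :&: window n r == X]| <= nmis (lk (S0 :|: X)) (wtop n A B :\: excl (S0 :|: X)))%N &
    (#|[set M in MM | M :&: window n r == X]| <= nmis (lk (S0 :|: X)) (top n :\: excl (S0 :|: X)))%N].
Proof.
move=> Xw; set FX := [set M in MM | _].
have FP M : M \in FX -> [/\ vmax (top n) M, M :\: top n = S0 :|: X & window_img r M \subset A :|: B].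
  rewrite inE => /andP[]; rewrite inE => /andP[/top_fiberP[vM _ e] iM] /eqP eX.
  by split => //; rewrite e eX.
case/card_gt0P => M0 M0F; have [/vmaxP[sM0 _] e0 _] := FP M0 M0F.
have S0h x : x \in S0 -> x + r <= h.
  move: M0F; rewrite inE => /andP[]; rewrite inE => /andP[/top_fiberP[_ <- _] _] _.
  by rewrite inE => /andP[].
have disj : [disjoint S0 :|: X & top n] by rewrite -e0 -setI_eq0 setIDAC setDIl setDv setI0.
have SL : S0 :|: X \in low_sets n.
  rewrite inE -disjoints_subset disj; apply: sum_freeS sM0.
  by rewrite -e0 subsetDl.
have Zt : wtop n A B \subset top n by apply: subsetDl.
split => //; apply: card_vmax.
- exact: sum_freeS Zt (top_sum_free n).
- move=> M /FP[vM e iM]; split; [exact: vmaxS vM | by rewrite -e subsetDl |].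
  apply/subsetP => x xM; rewrite in_setU -e !in_setD xM andbT.
  case: (boolP (x \in top n)) => //= xt; rewrite andbT inE; apply/negP => /and3P[h1 h2].
  by rewrite (subsetP iM) // yw_img.
- by move: disj; rewrite -!setI_eq0 => /eqP d; rewrite -subset0 -d setIS.
- exact: top_sum_free.
- move=> M /FP[vM e iM]; split; [exact: vM | by rewrite -e subsetDl |].
  by rewrite -e setUC -subDset.
- exact: disj.
Qed.

Lemma card_container_fibers : #|MM| =
  \sum_(X in powerset (wlow n A B)) #|[set M in MM | M :&: window n r == X]|.
Proof.
apply: card_fibers_sum => M; rewrite inE => /andP[_ iM]; rewrite inE.
apply/subsetP => x; rewrite in_setI => /andP[xM xw]; rewrite inE xw.
by apply: (subsetP iM); apply: tw_img.
Qed.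

Local Open Scope ring_scope.
Variables (R : realFieldType) (s g : R).
Hypotheses (s0 : 0 < s) (s2 : s ^+ 2 = 2) (sg : s * g = 7 / 5) (g01 : 0 < g < 1).

(** Summing [s^-|X|] over the traces on the window lets each of its points count as [1 + 1/s]
    instead of 2. *)
Lemma container_count1 : #|MM|%:R <= s ^+ #|wtop n A B| *
  ((1 + s^-1) ^+ #|wlow n A B| + 2 ^+ #|wlow n A B| * g ^+ (r %/ 9)).
Proof.
have /andP[g0 g1] := g01.
rewrite card_container_fibers natr_sum -(sum_subsets s^-1).
have -> : 2 ^+ #|wlow n A B| = \sum_(X in powerset (wlow n A B)) (1 : R).
  by rewrite sumr_const card_powerset natrX.
rewrite mulr_suml -big_split mulr_sumr; apply: ler_sum => X; rewrite inE => Xw.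
have nn : 0 <= s ^+ #|wtop n A B| * (s^-1 ^+ #|X| + 1 * g ^+ (r %/ 9)).
  by rewrite mulr_ge0 ?addr_ge0 ?mulr_ge0 ?exprn_ge0 ?invr_ge0 // ltW.
case: (posnP #|[set M in MM | M :&: window n r == X]|) => [-> //|/(container_fiber Xw)[SL S0h le1 _]].
rewrite mul1r; apply: le_trans (window_weight r0 rn s0 s2 sg g01 S0h Xw SL); by rewrite ler_nat.
Qed.

Lemma container_count2 : #|MM|%:R <= 2 ^+ #|wlow n A B| * (s ^+ #|top n| * g ^+ (r %/ 9)).
Proof.
have /andP[g0 g1] := g01.
rewrite card_container_fibers natr_sum -natrX -card_powerset mulr_natl -sumr_const.
apply: ler_sum => X; rewrite inE => Xw.
have nn : 0 <= s ^+ #|top n| * g ^+ (r %/ 9) by rewrite mulr_ge0 ?exprn_ge0 // ltW.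
case: (posnP #|[set M in MM | M :&: window n r == X]|) => [-> //|/(container_fiber Xw)[SL _ _ le2]].
apply: le_trans (_ : (nmis (lk (S0 :|: X)) (top n :\: excl (S0 :|: X)))%:R <= _).
  by rewrite ler_nat.
apply: (nonideal_gain SL s0 s2 sg g01).
- by apply: ideal_extend; apply: (subset_trans Xw); apply/subsetP => x; rewrite inE => /andP[].
- by clear; lia.
- by move: rn r0; clear; lia.
Qed.

End ContainerCount.

Section Scalars.
Local Open Scope ring_scope.
Variable R : archiRealFieldType.
Implicit Types s g w x : R.

(** Losing [2 Q] points of the top half is worth [s^(-2Q) = 2^-Q], against [(1 + 1/s)^Q] for the
    traces; the net factor is [((1 + 1/s) / 2)^Q]. *)
Lemma scale_main s g x (N a Q Z wl k : nat) : 1 <= s -> s ^+ 2 = 2 -> 0 < g ->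
  (wl <= a + Q)%N -> (Z + 2 * Q <= N + a + 1)%N ->
  x <= s ^+ Z * ((1 + s^-1) ^+ wl + 2 ^+ wl * g ^+ k) ->
  x <= s ^+ N * (2 * 4 ^+ a) * (((1 + s^-1) / 2) ^+ Q + g ^+ k).
Proof.
move=> s1 s2 g0 hw hZ hx; have s0 : 0 < s by apply: lt_le_trans s1.
have sle2 : s <= 2 by rewrite -s2 expr2 ler_peMr // ltW.
have sV1 : s^-1 <= 1 by rewrite invf_le1.
have sV0 : 0 < s^-1 by rewrite invr_gt0.
apply: (le_trans hx); have e4 : (4 : R) = 2 * 2 by rewrite -natrM.
have -> : s ^+ N * (2 * 4 ^+ a) * (((1 + s^-1) / 2) ^+ Q + g ^+ k)
   = (s ^+ N * 2 ^+ a * 2 / 2 ^+ Q) * (2 ^+ a * ((1 + s^-1) ^+ Q + 2 ^+ Q * g ^+ k)).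
  rewrite e4 exprMn expr_div_n; have := @expf_neq0 R 2 Q; rewrite pnatr_eq0 => /(_ isT).
  by move: (2 ^+ Q) (2 ^+ a) (s ^+ N) (g ^+ k) ((1 + s^-1) ^+ Q) => p q u v y p0; field.
apply: ler_pM.
- by rewrite exprn_ge0 // ltW.
- by rewrite addr_ge0 ?mulr_ge0 ?exprn_ge0 ?addr_ge0 // ltW.
- rewrite ler_pdivlMr ?exprn_gt0 //; apply: (@le_trans _ _ (s ^+ (N + a + 1))).
    by rewrite -s2 -exprM -exprD; apply: ler_weXn2l.
  rewrite !exprD expr1; apply: ler_pM; rewrite ?mulr_ge0 ?exprn_ge0 ?(ltW s0) //.
  by apply: ler_wpM2l; [rewrite exprn_ge0 // ltW | apply: ler_expn => //; apply: ltW].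
- rewrite mulrDr mulrA -exprD; apply: lerD.
    apply: (@le_trans _ _ ((1 + s^-1) ^+ (a + Q))); first by apply: ler_weXn2l => //; lra.
    rewrite exprD; apply: ler_wpM2r; first by rewrite exprn_ge0 // addr_ge0 // ltW.
    by apply: ler_expn; lra.
  by apply: ler_wpM2r; [rewrite exprn_ge0 // ltW | apply: ler_weXn2l => //; lra].
Qed.

Lemma scale_few s g x (N a Q wl k : nat) : 1 <= s -> 0 < g -> (wl <= a + Q)%N ->
  x <= 2 ^+ wl * (s ^+ N * g ^+ k) -> x <= s ^+ N * (2 * 4 ^+ a) * (2 ^+ Q * g ^+ k).
Proof.
move=> s1 g0 hw hx; have s0 : 0 < s by apply: lt_le_trans s1.
have -> : s ^+ N * (2 * 4 ^+ a) * (2 ^+ Q * g ^+ k) = (2 * 4 ^+ a * 2 ^+ Q) * (s ^+ N * g ^+ k).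
  by move: (s ^+ N) (4 ^+ a) (2 ^+ Q) (g ^+ k) => p q u v; ring.
apply: (le_trans hx); apply: ler_wpM2r; first by rewrite mulr_ge0 ?exprn_ge0 // ltW.
apply: (@le_trans _ _ (2 ^+ (a + Q))); first by apply: ler_weXn2l => //; lra.
rewrite exprD; apply: ler_wpM2r; first by rewrite exprn_ge0.
apply: (@le_trans _ _ (4 ^+ a)); first by apply: ler_expn => //; lra.
by rewrite ler_peMl ?exprn_ge0 //; lra.
Qed.

(** If [Q] is at least a fixed proportion of [k], then [w ^+ Q] is exponentially small in [k];
    otherwise [2 ^+ Q] is at most [g^(-k/2)] and [g ^+ k] prevails. *)
Lemma few_or_many w g : 0 < w < 1 -> 0 < g < 1 -> exists2 t : R, 0 < t < 1 & forall Q k,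
  (w ^+ Q + g ^+ k <= 2 * t ^+ k) \/ (2 ^+ Q * g ^+ k <= 2 * t ^+ k).
Proof.
move=> w01 /andP[g0 g1]; have gV : 1 < g^-1 by rewrite invf_gt1.
have [L L0 hL] := expr_unbounded 2 gV.
have [t1 /andP[t10 t11] ht1] := @power_gap R w (2 * L) w01.
have [t2 /andP[t20 t21] ht2] := @power_gap R g 2 (introT andP (conj g0 g1)).
pose t := Num.max t1 t2; have tt1 : t1 <= t by rewrite le_max lexx.
have tt2 : t2 <= t by rewrite le_max lexx orbT.
exists t; first by rewrite (lt_le_trans t10 tt1) gt_max t11.
have gt k : g ^+ k <= t ^+ k.
  by apply: (le_trans (ht2 k k _)); [clear; lia | apply: ler_expn; rewrite // ltW].
move=> Q k; have [h|h] := ltnP k (2 * L * Q).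
  left; have wt : w ^+ Q <= t ^+ k.
    by apply: (le_trans (ht1 Q k (ltnW h))); apply: ler_expn; rewrite // ltW.
  by have := gt k; move: wt; lra.
right; have LQ : (L * Q <= k)%N by move: h; rewrite -mulnA; clear; lia.
have tk : 0 <= t ^+ k by rewrite exprn_ge0 // (le_trans _ tt2) // ltW.
apply: (@le_trans _ _ (t ^+ k)); last by move: tk; lra.
apply: (@le_trans _ _ (g ^+ (k - L * Q))).
  have -> : g ^+ k = g ^+ (L * Q) * g ^+ (k - L * Q) by rewrite -exprD subnKC.
  rewrite mulrA ler_piMl ?exprn_ge0 ?(ltW g0) // exprM -exprMn exprn_ile1 //.
    by rewrite mulr_ge0 // exprn_ge0 // ltW.
  by rewrite -ler_pdivlMr ?exprn_gt0 // mul1r -exprVn.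
apply: (le_trans (ht2 _ k _)); first by move: h; rewrite -mulnA; clear; lia.
by apply: ler_expn; rewrite // ltW.
Qed.
End Scalars.

Section NonIdeal.
Local Open Scope ring_scope.
Variables (R : archiRealFieldType) (s g : R).
Hypotheses (s1 : 1 < s) (s2 : s ^+ 2 = 2) (sg : s * g = 7 / 5) (g01 : 0 < g < 1).

Lemma container_count : exists2 t : R, 0 < t < 1 & forall n r (A B : {set 'I_(8 * r).+1}) S0,
  (0 < r)%N -> (11 * r + 5 <= n)%N -> sum_free B -> ~~ ideal S0 r ->
  #|[set M in @top_fiber n r S0 | window_img r M \subset A :|: B]|%:R
    <= s ^+ #|top n| * (4 * 4 ^+ #|A|) * t ^+ (r %/ 9).
Proof.
have s0 : 0 < s by apply: lt_trans s1.
have /andP[g0 g1] := g01; have sV0 : 0 < s^-1 by rewrite invr_gt0.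
have sV1 : s^-1 < 1 by rewrite invf_lt1.
have [|t t01 ht] := @few_or_many R ((1 + s^-1) / 2) g _ g01; first by move: sV0 sV1; lra.
exists t => // n r A B S0 r0 rn sB nid; have /andP[t0 t1] := t01.
have e4 : s ^+ #|top n| * (4 * 4 ^+ #|A|) * t ^+ (r %/ 9)
   = s ^+ #|top n| * (2 * 4 ^+ #|A|) * (2 * t ^+ (r %/ 9)).
  by move: (s ^+ _) (4 ^+ _) (t ^+ _) => p q u; ring.
have nn : 0 <= s ^+ #|top n| * (2 * 4 ^+ #|A|) by rewrite !mulr_ge0 ?exprn_ge0 // ltW.
have wl := card_wlow rn A B.
rewrite e4; case: (ht #|wmain n B| (r %/ 9)%N) => h; apply: le_trans (ler_wpM2l nn h).
  have := container_count1 r0 rn A B S0 s0 s2 sg g01.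
  apply: scale_main => //; [exact: ltW | exact: card_wtop].
have := container_count2 r0 rn A B nid s0 s2 sg g01.
by apply: scale_few => //; apply: ltW.
Qed.

Lemma nonideal_count : exists th C : R, [/\ 0 < th < 1, 0 <= C & exists r1, forall n r (S0 : {set 'I_n.+1}),
  (r1 <= r)%N -> (11 * r + 5 <= n)%N -> ~~ ideal S0 r ->
  #|top_fiber r S0|%:R <= C * th ^+ r * s ^+ #|top n|].
Proof.
have [t /andP[t0 t1] ht] := container_count; have s0 : 0 < s by apply: lt_trans s1.
have tV : 1 < t^-1 by rewrite invf_gt1.
(* The number of containers and [4 ^+ #|A|] cost [v^(8r)] each, and [v^r] is to remain as gain, so
   [t ^+ (r %/ 9)] must pay for [v^(17r)]. As [r <= 9 * (r %/ 9) + 8], the exponents 180 and 160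
   suffice: they exceed [17 * 9] and [17 * 8]. *)
have [v v1 hv] := expr_root 180 tV; have v0 : 0 < v by apply: lt_trans v1.
have [q q0 hq] := expr_unbounded 4 v1.
have [n0 dec] := sum_free_decomposition v1 q0.
exists v^-1, (4 * v ^+ 160); split; first by rewrite invr_gt0 v0 invf_lt1.
  by rewrite mulr_ge0 ?exprn_ge0 // ltW.
exists n0.+1 => n r S0 r1 rn nid; have r0 : (0 < r)%N by apply: leq_trans r1.
have [|F [Fc FP Fcov]] := dec (8 * r)%N; first by move: r1; clear; lia.
pose ok (M : {set 'I_n.+1}) (p : {set 'I_(8 * r).+1} * {set 'I_(8 * r).+1}) :=
  window_img r M \subset p.1 :|: p.2.
pose f M := odflt (set0, set0) [pick p in F | ok M p].
have fP M : M \in top_fiber r S0 -> (f M \in F) && ok M (f M).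
  move=> /(top_fiberP rn)[/vmaxP[sM _] _ _].
  have [p pF hp] := Fcov _ (window_img_sum_free r0 rn sM).
  by rewrite /f; case: pickP => [p' //|/(_ p)]; rewrite pF /ok hp.
have bound p : p \in F -> #|[set M in top_fiber r S0 | f M == p]|%:R
    <= s ^+ #|top n| * (4 * v ^+ (8 * r)) * t ^+ (r %/ 9).
  move=> pF; have [pc _ psf] := FP p pF.
  apply: le_trans (_ : #|[set M in top_fiber r S0 | window_img r M \subset p.1 :|: p.2]|%:R <= _).
    rewrite ler_nat; apply: subset_leq_card; apply/subsetP => M; rewrite inE => /andP[MF /eqP fM].
    by rewrite inE MF; have := fP M MF; rewrite fM => /andP[].
  apply: (le_trans (ht n r p.1 p.2 S0 r0 rn psf nid)).
  apply: ler_wpM2r; first by rewrite exprn_ge0 // ltW.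
  apply: ler_wpM2l; first by rewrite exprn_ge0 // ltW.
  apply: ler_wpM2l => //; apply: (@le_trans _ _ ((v ^+ q) ^+ #|p.1|)); first exact: ler_expn.
  by rewrite -exprM; apply: ler_weXn2l; [exact: ltW | rewrite mulnC].
apply: (le_trans (card_fibers (fun M MF => proj1 (andP (fP M MF))) bound)).
have nn : 0 <= s ^+ #|top n| * (4 * v ^+ (8 * r)) * t ^+ (r %/ 9).
  by rewrite !mulr_ge0 ?exprn_ge0 // ltW.
apply: (le_trans (ler_wpM2r nn Fc)).
have key : v ^+ r * (v ^+ (8 * r) * v ^+ (8 * r) * t ^+ (r %/ 9)) <= v ^+ 160.
  rewrite !mulrA -!exprD; apply: (@le_trans _ _ (v ^+ (180 * (r %/ 9) + 160) * t ^+ (r %/ 9))).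
    apply: ler_wpM2r; first by rewrite exprn_ge0 // ltW.
    by apply: ler_weXn2l; [exact: ltW | clear; lia].
  rewrite exprD mulrAC ler_piMl ?exprn_ge0 ?(ltW v0) // exprM -exprMn exprn_ile1 //.
    by rewrite mulr_ge0 ?exprn_ge0 // ltW.
  by rewrite -ler_pdivlMr // mul1r.
have vr : 0 < v ^+ r by rewrite exprn_gt0.
rewrite exprVn; have -> : 4 * v ^+ 160 / v ^+ r * s ^+ #|top n| = s ^+ #|top n| * 4 * (v ^+ 160 / v ^+ r).
  by move: (v ^+ 160) (v ^+ r)^-1 (s ^+ _) => x y z; ring.
have -> : v ^+ (8 * r) * (s ^+ #|top n| * (4 * v ^+ (8 * r)) * t ^+ (r %/ 9)) =
   s ^+ #|top n| * 4 * (v ^+ (8 * r) * v ^+ (8 * r) * t ^+ (r %/ 9)).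
  by move: (v ^+ _) (s ^+ _) (t ^+ _) => x y z; ring.
apply: ler_wpM2l; first by rewrite mulr_ge0 ?exprn_ge0 // ltW.
by rewrite ler_pdivlMr // mulrC.
Qed.

End NonIdeal.

(** * Summation over the levels of [ideal] *)

Section Levels.
Variable n : nat.
Local Notation T := 'I_n.+1.
Local Notation h := (n %/ 2).

Lemma ideal_low (M : {set T}) r : ideal (low r M) r -> ideal M r.
Proof.
move=> /exists_inP[m mM /andP[hm /forall_inP u]]; apply/exists_inP; exists m.
  by move: mM; rewrite inE => /andP[].
rewrite hm; apply/forall_inP => x xM; apply/implyP => xr.
by have := u x; rewrite inE xM xr /=; apply.
Qed.

Definition level r : {set {set T}} :=
  [set M : {set T} | vmax (top n) M & ideal M r.+1 && ~~ ideal M r].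

(** A set that is ideal for [r + 1] has a single element up to [h - r - 1], so up to [h - r] it can
    only have [h - r] in addition. With O(r) possible low parts, a bound for a fixed low part can be
    summed. *)
Definition level_lows r : {set {set T}} :=
  let mid := [set x : T | (n + 3) %/ 4 - r.+1 <= x <= n %/ 4 + r.+1] in
  [set [set x] | x : T in mid] :|: [set [set x; inord (h - r)] | x : T in mid].

Lemma card_level_lows r : 0 < r -> 11 * r + 5 <= n -> #|level_lows r| <= 2 * (2 * r + 3).
Proof.
move=> r0 rn; apply: (leq_trans (leq_card_setU _ _).1); rewrite mul2n -addnn.
apply: leq_add; apply: (leq_trans (leq_imset_card _ _)); rewrite card_range; move: rn r0; clear; lia.
Qed.

Lemma level_low r M : 0 < r -> 11 * r + 5 <= n -> M \in level r -> low r M \in level_lows r.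
Proof.
move=> r0 rn; rewrite inE => /and3P[_ /exists_inP[m mM /andP[/andP[m1 m2] /forall_inP u]] _].
have mmid : (n + 3) %/ 4 - r.+1 <= m <= n %/ 4 + r.+1 by move: m1 m2; clear; lia.
have mh : m + r <= h by move: m1 rn r0; clear; lia.
have mr : (inord (h - r) : T) = h - r :> nat by rewrite inordK //; clear; lia.
rewrite inE; have [iM|iM] := boolP ((inord (h - r) : T) \in M); apply/orP; [right|left];
  apply/imsetP; exists m; rewrite ?inE //; apply/setP => x; rewrite !inE.
  apply/andP/orP => [[xM xh]|[/eqP->|/eqP->]]; rewrite ?mr //.
    case: (leqP (x + r.+1) h) => xh1; [left | right].
      by have := u x xM; rewrite xh1.
    by apply/eqP/ord_inj; rewrite mr; move: xh xh1; clear; lia.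
  by split => //; move: rn; clear; lia.
apply/andP/eqP => [[xM xh]|->] //; case: (leqP (x + r.+1) h) => xh1.
  by apply/eqP; have := u x xM; rewrite xh1.
have xe : x = inord (h - r) by apply: ord_inj; rewrite mr; move: xh xh1; clear; lia.
by move: iM; rewrite -xe xM.
Qed.

End Levels.

Section GammaBound.
Local Open Scope ring_scope.
Variables (R : archiRealFieldType) (a : R).
Hypotheses (a0 : 0 < a) (a4 : a ^+ 4 = 2).
Local Notation s := (a ^+ 2).

(** The largest [r] with [11 r + 5 <= n], as the window estimates require. Moreover [n / 2 - n / 11]
    is about [0.4091 n], just below the [0.41 n] that [dense_sum_free] guarantees. *)
Definition scale (n : nat) : nat := ((n - 5) %/ 11)%N.

Definition bad n q r : {set {set 'I_n.+1}} :=
  [set M : {set 'I_n.+1} | vmax (top n) M & (#|low (scale n) M| * q <= n)%N && ~~ ideal M r].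

Lemma top_weight n : s ^+ #|top n| <= a * a ^+ n.
Proof.
have [_ _ _ _ a1] := base_facts a0 a4.
rewrite card_top -exprM -exprS; apply: ler_weXn2l => //; clear; lia.
Qed.

Lemma one_lt_s : 1 < s.
Proof.
have [s0 s2 _ _ _] := base_facts a0 a4; rewrite ltNge; apply/negP => le.
have : s * s <= 1 * 1 by apply: ler_pM => //; apply: ltW.
by rewrite -expr2 s2 mulr1 lern1.
Qed.

Lemma nonideal_count_base : exists th C : R, [/\ 0 < th < 1, 0 <= C &
  exists r1, forall n r (S0 : {set 'I_n.+1}), (r1 <= r)%N -> (11 * r + 5 <= n)%N ->
    ~~ ideal S0 r -> #|top_fiber r S0|%:R <= C * th ^+ r * (a * a ^+ n)].
Proof.
have [s0 s2 sg g01 _] := base_facts a0 a4.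
have [th [C [th01 C0 [r1 H]]]] := nonideal_count one_lt_s s2 sg g01.
exists th, C; split => //; exists r1 => n r S0 h1 h2 h3; apply: (le_trans (H n r S0 h1 h2 h3)).
apply: ler_wpM2l (top_weight n); rewrite mulr_ge0 ?exprn_ge0 //.
by case/andP: th01 => /ltW.
Qed.

Lemma level_count : exists th C : R, [/\ 0 < th < 1, 0 <= C &
  exists r1, forall n r, (r1 <= r)%N -> (11 * r + 5 <= n)%N ->
    #|level n r|%:R <= C * th ^+ r * a ^+ n].
Proof.
have [th [C [/andP[th0 th1] C0 [r1 H]]]] := nonideal_count_base.
have thV : 1 < th^-1 by rewrite invf_gt1.
have [v v1 hv] := expr_root 2 thV; have v0 : 0 < v by lra.
have [n0 hn0] := nat_le_expr v1.
have vth : v * th < 1.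
  have : v ^+ 2 * th <= 1 by rewrite -ler_pdivlMr // mul1r.
  have : v * th < v ^+ 2 * th by rewrite ltr_pM2r // expr2 ltr_pMr.
  lra.
exists (v * th), (10 * C * a); split; first by rewrite vth mulr_gt0.
  by rewrite !mulr_ge0 // ltW.
exists (r1 + n0).+1 => n r hr rn; have r0 : (0 < r)%N by apply: leq_trans hr.
have nn : 0 <= C * th ^+ r * (a * a ^+ n) by rewrite !mulr_ge0 ?exprn_ge0 // ltW.
pose P := [set S0 in level_lows n r | ~~ ideal S0 r].
have fP M : M \in level n r -> low r M \in P.
  move=> ML; rewrite inE level_low //=.
  by move: ML; rewrite inE => /and3P[_ _]; apply: contra; apply: ideal_low.
have bound S0 : S0 \in P -> #|[set M in level n r | low r M == S0]|%:R <= C * th ^+ r * (a * a ^+ n).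
  rewrite inE => /andP[_ nid]; apply: le_trans (H n r S0 _ rn nid); last by move: hr; clear; lia.
  rewrite ler_nat; apply: subset_leq_card; apply/subsetP => M; rewrite inE => /andP[].
  by rewrite !inE => /and3P[-> _ _] ->.
apply: (le_trans (card_fibers fP bound)).
have cP : #|P|%:R <= 10 * v ^+ r.
  apply: (@le_trans _ _ (10 * r%:R)).
    rewrite -natrM ler_nat; apply: (@leq_trans (2 * (2 * r + 3))); last by move: r0; clear; lia.
    apply: leq_trans (card_level_lows r0 rn); apply: subset_leq_card.
    by apply/subsetP => S0; rewrite inE => /andP[].
  by apply: ler_wpM2l => //; apply: hn0; move: hr; clear; lia.
apply: (le_trans (ler_wpM2r nn cP)); rewrite exprMn.
by move: (v ^+ r) (th ^+ r) (a ^+ n) => x y z; lra.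
Qed.

Lemma levels_count : exists th C : R, [/\ 0 < th < 1, 0 <= C &
  exists r1, forall n r d, (r1 <= r)%N -> (11 * (r + d) + 5 <= n)%N ->
    #|[set M : {set 'I_n.+1} | vmax (top n) M & ideal M (r + d) && ~~ ideal M r]|%:R
      <= C * th ^+ r * a ^+ n].
Proof.
have [th [C [/andP[th0 th1] C0 [r1 H]]]] := level_count.
have e0 : 0 < 1 - th by lra.
exists th, (C / (1 - th)); split; rewrite ?th0 ?divr_ge0 ?(ltW e0) //.
exists r1 => n r d hr; pose F d := [set M : {set 'I_n.+1} | vmax (top n) M & ideal M (r + d) && ~~ ideal M r].
rewrite -/(F d); have an : 0 <= a ^+ n by rewrite exprn_ge0 // ltW.
(* The partial geometric sum is kept exact, so that the induction on [d] closes. *)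
move=> rn; apply: (@le_trans _ _ (C / (1 - th) * (th ^+ r - th ^+ (r + d)) * a ^+ n)); last first.
  apply: ler_wpM2r => //; apply: ler_wpM2l; first by rewrite divr_ge0 // ltW.
  by rewrite gerBl exprn_ge0 // ltW.
elim: d rn => [|d IH] rn.
  rewrite addn0 subrr mulr0 mul0r; have -> : F 0%N = set0.
    by apply/setP => M; rewrite !inE addn0 andbN andbF.
  by rewrite cards0.
have sub : F d.+1 \subset F d :|: level n (r + d).
  apply/subsetP => M; rewrite !inE addnS => /and3P[-> id nid] /=; rewrite id nid andbT.
  by case: (ideal M (r + d)).
have Hd := H n (r + d)%N (leq_trans hr (leq_addr _ _)).
have rn' : (11 * (r + d) + 5 <= n)%N by move: rn; clear; lia.
have step : #|F d.+1|%:R <= #|F d|%:R + #|level n (r + d)|%:R :> R.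
  by rewrite -natrD ler_nat; apply: leq_trans (subset_leq_card sub) (leq_card_setU _ _).1.
apply: (le_trans step); apply: (le_trans (lerD (IH rn') (Hd rn'))).
rewrite addnS exprS; move: (th ^+ (r + d)) (th ^+ r) (a ^+ n) e0 => x y z e0.
rewrite le_eqVlt; apply/orP; left; apply/eqP; field; lra.
Qed.

(** At this scale [th ^+ r] is exponentially small in [n], which allows summation over all low parts
    of at most [n / q] elements. *)
Lemma nonideal_scale_count : exists q0, exists2 t : R, 0 < t < 1 & exists n0, forall q n, (q0 <= q)%N -> (n0 <= n)%N ->
  #|bad n q (scale n)|%:R <= t ^+ n * a ^+ n.
Proof.
have [th [C [/andP[th0 th1] C0 [r1 H]]]] := nonideal_count_base.
have thV : 1 < th^-1 by rewrite invf_gt1.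
(* [33 * scale n] is nearly [3 n]: one factor [u^n] is for the low parts, one is the gain, and one
   absorbs the constants. *)
have [u u1 hu] := expr_root 33 thV; have u0 : 0 < u by lra.
have [q0 q00 sm] := small_sets_bound u1.
have [k k0 hk] := expr_unbounded (C * a) u1.
exists q0, u^-1; first by rewrite invr_gt0 u0 invf_lt1.
exists (11 * r1 + 100 + k)%N => q n hq hn; set r := scale n.
have rn : (11 * r + 5 <= n)%N by move: hn; rewrite /r /scale; clear; lia.
have rr : (r1 <= r)%N by move: hn; rewrite /r /scale; clear; lia.
have nn : 0 <= C * th ^+ r * (a * a ^+ n) by rewrite !mulr_ge0 ?exprn_ge0 // ltW.
pose P : {set {set 'I_n.+1}} := [set S0 in small_sets 'I_n.+1 (n %/ q) | ~~ ideal S0 r].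
have q1 : (0 < q)%N by apply: leq_trans hq.
have fP M : M \in bad n q r -> low r M \in P.
  rewrite inE => /and3P[_ lM nid]; rewrite inE inE leq_divRL // lM /=.
  by apply: contra nid; apply: ideal_low.
have bound S0 : S0 \in P -> #|[set M in bad n q r | low r M == S0]|%:R <= C * th ^+ r * (a * a ^+ n).
  rewrite inE => /andP[_ nid]; apply: le_trans (H n r S0 rr rn nid).
  rewrite ler_nat; apply: subset_leq_card; apply/subsetP => M; rewrite inE => /andP[].
  by rewrite !inE => /and3P[-> _ _] ->.
apply: (le_trans (card_fibers fP bound)).
have cP : #|P|%:R <= u ^+ n.+1.
  apply: (@le_trans _ _ #|small_sets 'I_n.+1 (n %/ q)|%:R).
    by rewrite ler_nat; apply: subset_leq_card; apply/subsetP => S0; rewrite inE => /andP[].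
  rewrite -[in leRHS](card_ord n.+1); apply: sm; rewrite card_ord.
  apply: (@leq_trans (n %/ q * q)); first by rewrite leq_mul2l hq orbT.
  by apply: leqW; apply: leq_divM.
apply: (le_trans (ler_wpM2r nn cP)).
have an : 0 <= a ^+ n by rewrite exprn_ge0 // ltW.
rewrite exprVn [leLHS](_ : _ = u ^+ n.+1 * (C * a) * th ^+ r * a ^+ n); last first.
  by move: (u ^+ n.+1) (th ^+ r) (a ^+ n) => x y z; ring.
apply: ler_wpM2r => //; rewrite -[(u ^+ n)^-1]mul1r ler_pdivlMr ?exprn_gt0 //.
have t0 : 0 <= th ^+ r by rewrite exprn_ge0 // ltW.
apply: (@le_trans _ _ (u ^+ n.+1 * u ^+ k * th ^+ r * u ^+ n)).
  apply: ler_wpM2r; first by rewrite exprn_ge0 // ltW.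
  by apply: ler_wpM2r => //; apply: ler_wpM2l => //; rewrite exprn_ge0 // ltW.
rewrite mulrAC -!exprD; apply: (@le_trans _ _ (u ^+ (33 * r) * th ^+ r)).
  by apply: ler_wpM2r => //; apply: ler_weXn2l; [exact: ltW | move: hn; rewrite /r /scale; clear; lia].
rewrite exprM -exprMn exprn_ile1 //; first by rewrite mulr_ge0 ?exprn_ge0 // ltW.
by rewrite -ler_pdivlMr // mul1r.
Qed.

Lemma gamma_bound : exists th C : R, [/\ 0 < th < 1, 0 <= C & exists r1 q0,
  forall r q, (r1 <= r)%N -> (q0 <= q)%N -> exists n1, forall n, (n1 <= n)%N ->
    #|bad n q r|%:R <= C * th ^+ r * a ^+ n].
Proof.
have [th [C [/andP[th0 th1] C0 [r1 H]]]] := levels_count.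
have [q0 [t /andP[t0 t1] [n0 G]]] := nonideal_scale_count.
exists th, (C + 1); split; rewrite ?th0 ?addr_ge0 //; exists r1, q0 => r q hr hq.
have [|k hk] := @expr_small R t (th ^+ r) _ (exprn_gt0 r th0); first by rewrite (ltW t0).
exists (n0 + k + 11 * r + 100)%N => n hn.
have an : 0 <= a ^+ n by rewrite exprn_ge0 // ltW.
have rs : (r <= scale n)%N by move: hn; rewrite /scale; clear; lia.
have sub : bad n q r \subset bad n q (scale n) :|:
   [set M : {set 'I_n.+1} | vmax (top n) M & ideal M (r + (scale n - r)) && ~~ ideal M r].
  apply/subsetP => M; rewrite !inE subnKC // => /and3P[-> -> ->] /=.
  by case: (ideal M (scale n)).
apply: (@le_trans _ _ (t ^+ n * a ^+ n + C * th ^+ r * a ^+ n)).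
  apply: le_trans (lerD (G q n hq _) (H n r (scale n - r)%N hr _)).
  - rewrite -natrD ler_nat; apply: leq_trans (subset_leq_card sub) (leq_card_setU _ _).1.
  - by move: hn; clear; lia.
  - by rewrite subnKC //; move: hn; rewrite /scale; clear; lia.
rewrite -mulrDl; apply: ler_wpM2r => //; rewrite mulrDl mul1r addrC lerD2l.
apply: le_trans hk; apply: ler_wiXn2l; [exact: ltW | exact: ltW | move: hn; clear; lia].
Qed.

End GammaBound.

(** * The two families cover almost all sets and hardly overlap *)

Section Classify.
Local Open Scope ring_scope.
Variables (R : archiRealFieldType) (a : R).
Hypotheses (a0 : 0 < a) (a4 : a ^+ 4 = 2).

Lemma unclassified_small q : (0 < q)%N -> expsmall a (fun n =>
  #|[set M : {set 'I_n.+1} | max_sum_free M & (M \notin beta_max n q) &&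
      ~~ (#|low (scale n) M| * q <= n)%N]|).
Proof.
move=> q0; have [t t01 gap] := moon_moser_gap a0 a4.
apply: (expsmall_sub t01) => u u1; have [v v1 hv] := expr_root 2 u1.
have v0 : 0 < v by apply: lt_trans v1.
have [q1 q10 hq1] := expr_unbounded 2 v1.
have qq0 : (0 < q + q1)%N by move: q0; clear; lia.
have [n0 dec] := sum_free_decomposition v1 qq0.
exists (n0 + 3000)%N => n nn; have [|F [Fc FP Fcov]] := dec n; first by move: nn; clear; lia.
set A := [set M : {set 'I_n.+1} | _ & _].
pose f (M : {set 'I_n.+1}) := odflt (set0, set0) [pick p in F | M \subset p.1 :|: p.2].
have fP M : M \in A -> (f M \in F) && (M \subset (f M).1 :|: (f M).2).
  rewrite inE max_sum_freeE => /andP[/vmaxP[sM _] _].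
  have [p pF hp] := Fcov M sM.
  by rewrite /f; case: pickP => [p' //|/(_ p)]; rewrite pF hp.
have t0 : 0 < t by case/andP: t01.
have bound p : p \in F -> #|[set M in A | f M == p]|%:R <= v ^+ n * (t * a) ^+ n.
  move=> pF; have [pc _ psf] := FP p pF.
  have nn0 : 0 <= v ^+ n * (t * a) ^+ n by rewrite !mulr_ge0 ?exprn_ge0 ?mulr_ge0 // ltW.
  have pcq : (#|p.1| * q <= n)%N by apply: leq_trans pc; rewrite leq_mul2l leq_addr orbT.
  have pcq1 : (#|p.1| * q1 <= n)%N by apply: leq_trans pc; rewrite leq_mul2l leq_addl orbT.
  case: (posnP #|[set M in A | f M == p]|) => [-> //|].
  case/card_gt0P => M; rewrite inE => /andP[MA /eqP fM].
  have := fP M MA; rewrite fM => /andP[_ /subsetP Mp].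
  have [dense|sparse] := leqP (47 * n) (100 * #|p.2|).
    exfalso; move: MA; rewrite !inE => /and3P[mM nb nl].
    have [|odd_B|big_B] := dense_sum_free psf dense; first by move: nn; clear; lia.
      case/negP: nb; rewrite mM /=; apply: leq_trans pcq; rewrite leq_mul2r; apply/orP; right.
      apply: subset_leq_card; apply/subsetP => x; rewrite !inE => /andP[xe /Mp].
      by rewrite inE => /orP[//|/odd_B]; rewrite (negbTE xe).
    case/negP: nl; apply: leq_trans pcq; rewrite leq_mul2r; apply/orP; right.
    apply: subset_leq_card; apply/subsetP => x; rewrite inE => /andP[/Mp + xl].
    (* Here [x] is at least [0.41 n - 1], while [x + scale n <= n / 2] bounds it by about
       [0.4091 n]; the gap is narrow, which explains the 3000. *)
    rewrite inE => /orP[//|/big_B h]; exfalso; move: h dense xl nn; rewrite /scale; clear; lia.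
  apply: le_trans (_ : #|[set M : {set 'I_n.+1} | max_sum_free M & M \subset p.1 :|: p.2]|%:R <= _).
    rewrite ler_nat; apply: subset_leq_card; apply/subsetP => M'; rewrite inE => /andP[M'A /eqP fM'].
    have := fP M' M'A; rewrite fM' => /andP[_ sub]; rewrite inE sub andbT.
    by move: M'A; rewrite inE => /andP[].
  apply: (le_trans (card_max_in_container _ (@moon_moser_base R) psf)).
  apply: ler_pM => //; try by apply: exprn_ge0; lra.
    apply: (@le_trans _ _ ((v ^+ q1) ^+ #|p.1|)); first exact: ler_expn.
    by rewrite -exprM; apply: ler_weXn2l; [exact: ltW | rewrite mulnC].
  by apply: gap; apply: ltnW.
apply: (le_trans (card_fibers (fun M MA => proj1 (andP (fP M MA))) bound)).
have nn0 : 0 <= v ^+ n * (t * a) ^+ n by rewrite !mulr_ge0 ?exprn_ge0 ?mulr_ge0 // ltW.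
apply: (le_trans (ler_wpM2r nn0 Fc)); rewrite mulrA -exprD addnn -mul2n exprM.
apply: ler_wpM2r; first by rewrite exprn_ge0 ?mulr_ge0 // ltW.
by apply: ler_expn => //; rewrite exprn_ge0 // ltW.
Qed.

(** Up to a negligible family the even part is a single [s], and [M] is determined by its trace on
    the odd numbers below [s / 2]. Being ideal leaves for this trace only [m] and the points of (h -
    r, h], so it has at most [r + 1] elements. *)
Lemma beta_ideal_small : exists2 q0, (0 < q0)%N & forall q r, (q0 <= q)%N ->
  expsmall a (fun n => #|[set M in beta_max n q | ideal M r]|).
Proof.
have [q0 q00 hrest] := beta_rest a0 a4; exists q0 => // q r hq.
have [_ _ _ _ a1] := base_facts a0 a4.
have a1' : 1 < a.
  by rewrite lt_neqAle a1 andbT; apply/eqP => e; have := a4; rewrite -e expr1n; lra.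
have inv : 0 < (a^-1 : R) < 1 by rewrite invr_gt0 a0 invf_lt1.
pose g n := (n.+1 * #|small_sets 'I_n.+1 (r.+1)|)%N.
have gs : expsmall a g.
  apply: expsmall_muln => //; apply: (expsmall_sub inv) => u u1.
  have [v v1 hv] := expr_root 2 u1; have [k k0 hk] := small_sets_bound v1.
  exists (r.+1 * k).+1 => n hn; rewrite mulVf ?lt0r_neq0 // expr1n mulr1.
  have := hk 'I_n.+1 r.+1; rewrite card_ord => h; apply: (le_trans (h _)).
    by move: hn; clear; lia.
  apply: (@le_trans _ _ (v ^+ (2 * n))); last first.
    by rewrite exprM; apply: ler_expn => //; rewrite exprn_ge0 // (le_trans _ (ltW v1)).
  by apply: ler_weXn2l; [exact: ltW | move: hn; clear; lia].
apply: (expsmall_le _ (expsmall_add a0 (hrest q hq) gs)).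
exists 0%N => n _; set X := [set M in beta_max n q | M :\: odds n \notin main_sets n].
pose Y := [set M in beta_max n q | (M :\: odds n \in main_sets n) && ideal M r].
apply: (@leq_trans #|X :|: Y|).
  apply: subset_leq_card; apply/subsetP => M; rewrite inE => /andP[MB id].
  by rewrite in_setU [M \in X]inE [M \in Y]inE MB id andbT /= orNb.
apply: (leq_trans (leq_card_setU _ _).1); rewrite leq_add2l.
have YP M : M \in Y -> exists2 s : 'I_n.+1, main s & M :\: odds n = [set s].
  by rewrite inE => /and3P[_ /imsetP[s ms ->] _]; exists s.
pose f M := odflt ord0 [pick s : 'I_n.+1 | M :\: odds n == [set s]].
have fE M : M \in Y -> main (f M) /\ M :\: odds n = [set f M].
  move=> /YP[s ms e]; rewrite /f; case: pickP => [s' /eqP e'|/(_ s)]; last by rewrite e eqxx.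
  by split => //; have/set1_inj -> : [set s'] = [set s] by rewrite -e -e'.
have key s : s \in [set: 'I_n.+1] -> (#|[set M in Y | f M == s]| <= #|small_sets 'I_n.+1 r.+1|)%N.
  move=> _; pose Q := [set x : 'I_n.+1 | odd x && (x < s %/ 2)%N].
  rewrite -[leqLHS](@card_in_imset _ _ (fun M => M :&: Q)).
    apply: subset_leq_card; apply/subsetP => _ /imsetP[M + ->]; rewrite inE => /andP[MY _].
    rewrite inE; move: MY; rewrite inE => /and3P[_ _ /exists_inP[m _ /andP[_ /forall_inP u]]].
    apply: (@leq_trans #|m |: [set x : 'I_n.+1 | ((n %/ 2 - r).+1 <= x <= n %/ 2)%N]|).
      apply: subset_leq_card; apply/subsetP => x; rewrite !inE => /andP[xM /andP[ox xs]].
      have [h|h] := leqP (x + r) (n %/ 2); first by rewrite (implyP (u x xM) h).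
      by rewrite orbC; have := ltn_ord s; move: h xs ox; clear; lia.
    rewrite cardsU1 card_range; last by clear; lia.
    by case: (m \notin _); clear; lia.
  have MP M : M \in [set M in Y | f M == s] -> [/\ main s, M :\: odds n = [set s] &
      mis (lk [set s]) (odds n :\: excl [set s]) (M :&: odds n)].
    rewrite inE => /andP[MY /eqP fs]; have [ms e] := fE M MY; rewrite fs in ms e.
    split => //; move: MY; rewrite inE => /andP[+ _]; rewrite inE max_sum_freeE => /andP[vM _].
    apply: vmax_mis; first exact: odds_sum_free.
    - by rewrite -e subsetDl.
    - by rewrite -e setUC -subDset.
    - by apply: vmaxS vM; apply/sum_free_interval/odds_sum_free.
  move=> M M' /MP[ms e1 m1] /MP[_ e2 m2] eQ.
  have [h1 h2 h3 _] := mainP ms.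
  rewrite -(setID M (odds n)) -(setID M' (odds n)) e1 e2; congr (_ :|: _).
  apply: (mis_single_inj h1 h2 h3 m1 m2); apply/setP => x; have /setP/(_ x) := eQ.
  by rewrite !inE; case: (odd x); rewrite ?andbF //= !andbT.
rewrite (@card_fibers_sum _ _ Y [set: 'I_n.+1] f) //.
apply: (@leq_trans (\sum_(s in [set: 'I_n.+1]) #|small_sets 'I_n.+1 r.+1|)); first exact: leq_sum.
by rewrite sum_nat_const cardsT card_ord.
Qed.

End Classify.

(** * The exact recurrence *)

Section Shift.
Variables h n m r : nat.
Hypotheses (h1 : 2 * h <= n) (h2 : n <= 2 * h + 1).
Hypotheses (m1 : 4 * m <= n + 4 * r) (m2 : n <= 4 * m + 4 * r) (nr : 100 * r + 100 <= n).
Local Notation w := (2 * r + 1).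

(* Schur triples inside {m} u (h - r, n] have one of the forms (m, m, 2m), (m, b, b + m) and (a, b, a + b)
   with a, b near h; the cut points are chosen so that [shift] preserves each form. *)
Definition shift x := if x + r <= h then x + 1 else if x <= h + w then x + 2
  else if x <= h + w + m then x + 3 else x + 4.

Definition in_core x := (x == m) || ((h < x + r) && (x <= n)).

Lemma shiftP x : in_core x ->
  [\/ x = m /\ shift x = m + 1, [/\ h < x + r, x <= h + w & shift x = x + 2],
      [/\ h + w < x, x <= h + w + m & shift x = x + 3] | [/\ h + w + m < x, x <= n & shift x = x + 4]].
Proof.
rewrite /in_core /shift => /orP[/eqP->|/andP[x1 x2]].
  by apply: Or41; split => //; case: leqP => //; move: m1 h1 h2 nr; clear; lia.
case: leqP => e1; first by move: e1 x1; clear; lia.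
case: leqP => e2; first by apply: Or42.
by case: leqP => e3; [apply: Or43 | apply: Or44].
Qed.

Lemma shift_triple x y z : in_core x -> in_core y -> in_core z ->
  (shift x + shift y == shift z) = (x + y == z).
Proof.
move=> /shiftP hx /shiftP hy /shiftP hz; apply/eqP/eqP;
case: hx => [[-> ->]|[a1 a2 ->]|[a1 a2 ->]|[a1 a2 ->]];
case: hy => [[-> ->]|[b1 b2 ->]|[b1 b2 ->]|[b1 b2 ->]];
case: hz => [[-> ->]|[c1 c2 ->]|[c1 c2 ->]|[c1 c2 ->]]; move: h1 h2 m1 m2 nr; try (move: a1 a2); try (move: b1 b2); try (move: c1 c2); clear; lia.
Qed.

Lemma shift_bound x : in_core x -> shift x <= n + 4.
Proof.
move=> /shiftP hx; case: hx => [[-> ->]|[a1 a2 ->]|[a1 a2 ->]|[a1 a2 ->]];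
move: h1 h2 m1 m2 nr; try (move: a1 a2); clear; lia.
Qed.

Lemma shift_inj x y : in_core x -> in_core y -> shift x = shift y -> x = y.
Proof.
move=> /shiftP hx /shiftP hy;
case: hx => [[-> ->]|[a1 a2 ->]|[a1 a2 ->]|[a1 a2 ->]];
case: hy => [[-> ->]|[b1 b2 ->]|[b1 b2 ->]|[b1 b2 ->]];
move: h1 h2 m1 m2 nr; try (move: a1 a2); try (move: b1 b2); clear; lia.
Qed.

End Shift.

Section NewPoints.
Variables h n m r : nat.
Hypotheses (h1 : 2 * h <= n) (h2 : n <= 2 * h + 1).
Hypotheses (m1 : 4 * m <= n + 4 * r) (m2 : n <= 4 * m + 4 * r) (nr : 100 * r + 100 <= n).
Local Notation w := (2 * r + 1).
Local Notation p := (h + w + 3).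
Local Notation p' := (h + w + m + 4).

Lemma shift_core x : in_core h n m r x ->
  [/\ in_core (h + 2) (n + 4) (m + 1) r (shift h m r x), shift h m r x <> p & shift h m r x <> p'].
Proof.
move=> /(shiftP h1 h2 m1 nr) hx;
case: hx => [[-> ->]|[a1 a2 ->]|[a1 a2 ->]|[a1 a2 ->]];
rewrite /in_core; split; move: h1 h2 m1 m2 nr; try (move: a1 a2); clear; lia.
Qed.

(** The shift skips [p], where its step changes from 2 to 3, and [p'], where it changes from 3 to
    4. *)
Lemma shift_surj y : in_core (h + 2) (n + 4) (m + 1) r y -> y <> p -> y <> p' ->
  exists2 x, in_core h n m r x & shift h m r x = y.
Proof.
rewrite /in_core => hy y1 y2.
case: (leqP (y + r) (h + 2)) => b1.
  by exists (y - 1); rewrite /shift; [|do ![case: leqP => ?]]; lia.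
case: (leqP y (h + w + 2)) => b2.
  by exists (y - 2); rewrite /shift; [|do ![case: leqP => ?]]; lia.
case: (leqP y (h + w + m + 3)) => b3.
  by exists (y - 3); rewrite /shift; [|do ![case: leqP => ?]]; lia.
by exists (y - 4); rewrite /shift; [|do ![case: leqP => ?]]; lia.
Qed.

(* The new points are [p] and [p'] = [p + (m + 1)]. *)
Lemma new_triple x y z : in_core (h + 2) (n + 4) (m + 1) r x ->
  in_core (h + 2) (n + 4) (m + 1) r y -> in_core (h + 2) (n + 4) (m + 1) r z ->
  x + y = z -> [|| x == p, x == p', y == p, y == p', z == p | z == p'] ->
  z = p' /\ (x = p \/ y = p).
Proof.
rewrite /in_core => /orP[/eqP->|/andP[x1 x2]] /orP[/eqP->|/andP[y1 y2]] /orP[/eqP->|/andP[z1 z2]];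
move: h1 h2 m1 m2 nr; try (move: x1 x2); try (move: y1 y2); try (move: z1 z2); clear; lia.
Qed.

End NewPoints.

Definition core n m r : {set 'I_n.+1} := [set x : 'I_n.+1 | in_core (n %/ 2) n m r x].

(** The low element is prescribed and maximality is tested only within the core, so no other point
    up to [h - r] enters. *)
Definition fam n m r : {set {set 'I_n.+1}} :=
  [set M : {set 'I_n.+1} | [&& (inord m : 'I_n.+1) \in M, M \subset core n m r, sum_free M &
     [forall x in core n m r, sum_free (x |: M) ==> (x \in M)]]].

Lemma famP n m r (M : {set 'I_n.+1}) : reflect [/\ (inord m : 'I_n.+1) \in M, M \subset core n m r, sum_free M &
   forall x, x \in core n m r -> sum_free (x |: M) -> x \in M] (M \in fam n m r).
Proof.
rewrite inE; apply: (iffP and4P) => -[h1 h2 h3 h4]; split => //.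
  by move=> x xc; have /forall_inP/(_ x xc)/implyP := h4.
by apply/forall_inP => x xc; apply/implyP; apply: h4.
Qed.

Section Recurrence.
Variables n m r : nat.
Hypotheses (m1 : 4 * m <= n + 4 * r) (m2 : n <= 4 * m + 4 * r) (nr : 100 * r + 100 <= n).
Local Notation h := (n %/ 2).
Local Notation w := (2 * r + 1).
Local Notation T := 'I_n.+1.
Local Notation T' := 'I_(n + 4).+1.
Local Notation C := (core n m r).
Local Notation C' := (core (n + 4) (m + 1) r).

Let h1 : 2 * h <= n. Proof. by clear; lia. Qed.
Let h2 : n <= 2 * h + 1. Proof. by clear; lia. Qed.
Let hh : (n + 4) %/ 2 = h + 2. Proof. by clear; lia. Qed.

Let sh (x : T) : T' := inord (shift h m r x).
Let p : T' := inord (h + w + 3).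
Let p' : T' := inord (h + w + m + 4).
Let mu : T := inord m.

Let muE : mu = m :> nat. Proof. by rewrite inordK //; move: m1 nr; clear; lia. Qed.
Let pE : p = h + w + 3 :> nat. Proof. by rewrite inordK //; move: nr; clear; lia. Qed.
Let p'E : p' = h + w + m + 4 :> nat. Proof. by rewrite inordK //; move: m1 nr; clear; lia. Qed.

Let shE (x : T) : x \in C -> sh x = shift h m r x :> nat.
Proof. by rewrite inE => xc; rewrite inordK // ltnS (shift_bound h1 h2 m1 m2 nr). Qed.

Let sh_inj : {in C &, injective sh}.
Proof.
move=> x y xC yC /(congr1 (@nat_of_ord _)); rewrite !shE // => e; apply: ord_inj.
by move: xC yC; rewrite !inE => xC yC; apply: (shift_inj h1 h2 m1 m2 nr xC yC e).
Qed.

Let sh_core (x : T) : x \in C -> [/\ sh x \in C', sh x != p & sh x != p'].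
Proof.
move=> xC; have xC' := xC; rewrite inE in xC'.
have [c1 c2 c3] := shift_core h1 h2 m1 m2 nr xC'.
by split; [rewrite inE hh shE | apply/eqP => e; apply: c2; rewrite -shE // e pE
  | apply/eqP => e; apply: c3; rewrite -shE // e p'E].
Qed.

Let pC : p \in C'. Proof. by rewrite inE hh pE /in_core; apply/orP; right; move: nr; clear; lia. Qed.
Let p'C : p' \in C'.
Proof. by rewrite inE hh p'E /in_core; apply/orP; right; move: nr m1; clear; lia. Qed.
Let pp' : p != p'. Proof. by apply/eqP => /(congr1 (@nat_of_ord _)); rewrite pE p'E; lia. Qed.
Let muC : mu \in C. Proof. by rewrite inE muE /in_core eqxx. Qed.
Let sh_mu : sh mu = inord (m + 1).
Proof.
apply: ord_inj; rewrite shE // muE inordK; last by move: m1 nr; clear; lia.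
by rewrite /shift; case: leqP => //; move: m1 nr; clear; lia.
Qed.

Let core_split (y : T') : y \in C' -> [\/ y = p, y = p' | exists2 x, x \in C & sh x = y].
Proof.
move=> yC; have [->|yp] := eqVneq y p; first by apply: Or31.
have [->|yp'] := eqVneq y p'; first by apply: Or32.
apply: Or33; move: yC; rewrite inE hh => yC.
have [||x xC e] := shift_surj h1 h2 m1 m2 nr yC.
- by move=> e; case/eqP: yp; apply: ord_inj; rewrite pE.
- by move=> e; case/eqP: yp'; apply: ord_inj; rewrite p'E.
have xn : x < n.+1 by move: xC; rewrite /in_core; move: m1 nr; clear; lia.
exists (inord x); first by rewrite inE inordK.
by apply: ord_inj; rewrite shE ?inE inordK.
Qed.

Let new_points : [set p; p'] \subset C'.
Proof. by apply/subsetP => y /set2P[->|->]. Qed.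

(** By [new_triple] the only Schur triple through a new point is [(m + 1) + p = p'], up to order, so
    the new points matter only through whether both are present. *)
Let sum_free_shift (A : {set T}) (P : {set T'}) : A \subset C -> mu \in A -> P \subset [set p; p'] ->
  sum_free (sh @: A :|: P) = sum_free A && ~~ ((p \in P) && (p' \in P)).
Proof.
move=> AC muA PP; have AC' := subsetP AC.
apply/idP/andP => [/sum_freeP sf|[/sum_freeP sA nP]].
  split.
    apply/sum_freeP => x y z xA yA zA e.
    apply: (sf (sh x) (sh y) (sh z)); rewrite ?inE ?imset_f //.
    rewrite !shE ?AC' //; apply/eqP; rewrite (shift_triple h1 h2 m1 m2 nr) ?e //.
    - by have := AC' _ xA; rewrite inE.
    - by have := AC' _ yA; rewrite inE.
    - by have := AC' _ zA; rewrite inE.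
  apply/negP => /andP[pP p'P]; apply: (sf (sh mu) p p'); rewrite ?inE ?imset_f ?pP ?p'P ?orbT //.
  by rewrite sh_mu pE p'E inordK; move: m1 nr; clear; lia.
have inC' (y : T') : y \in sh @: A :|: P -> y \in C'.
  case/setUP => [/imsetP[x xA ->]|yP]; first by have [] := sh_core (AC' _ xA).
  exact: (subsetP new_points) (subsetP PP _ yP).
have inP (y : T') : y \in sh @: A :|: P -> y = p \/ y = p' -> y \in P.
  case/setUP => // /imsetP[x xA ->]; have [_ /eqP n1 /eqP n2] := sh_core (AC' _ xA).
  by case.
apply/sum_freeP => x y z xU yU zU e.
have [new|] := boolP [|| x == p, x == p', y == p, y == p', z == p | z == p'].
  have := inC' _ zU; have := inC' _ yU; have := inC' _ xU; rewrite !inE hh => cx cy cz.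
  have nE (u : T') : ((u : nat) == h + w + 3) = (u == p) by rewrite -pE.
  have nE' (u : T') : ((u : nat) == h + w + m + 4) = (u == p') by rewrite -p'E.
  have := new_triple h1 h2 m1 m2 nr cx cy cz e; rewrite !nE !nE' => /(_ new)[ez exy].
  have zP : z \in P by apply: inP => //; right; apply: ord_inj; rewrite p'E.
  have zp : z = p' by apply: ord_inj; rewrite p'E.
  case/negP: nP; rewrite -zp zP andbT; case: exy => exy.
    have xp : x = p by apply: ord_inj; rewrite pE.
    by rewrite -xp; apply: inP => //; left.
  have yp : y = p by apply: ord_inj; rewrite pE.
  by rewrite -yp; apply: inP => //; left.
rewrite !negb_or => /and5P[x1 x2 y1 y2 /andP[z1 z2]].
have old (u : T') : u \in sh @: A :|: P -> u != p -> u != p' -> exists2 v, v \in A & u = sh v.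
  case/setUP => [/imsetP[v vA ->]|/(subsetP PP)/set2P[->|->]]; rewrite ?eqxx //.
  by exists v.
have [x' x'A ex] := old x xU x1 x2; have [y' y'A ey] := old y yU y1 y2.
have [z' z'A ez] := old z zU z1 z2.
apply: (sA x' y' z') => //; apply/eqP; rewrite -(shift_triple h1 h2 m1 m2 nr).
- by rewrite -!shE ?AC' // -ex -ey -ez e.
- by have := AC' _ x'A; rewrite inE.
- by have := AC' _ y'A; rewrite inE.
- by have := AC' _ z'A; rewrite inE.
Qed.

Let fam_extend (M : {set T}) (q : T') : M \in fam n m r -> q \in [set p; p'] ->
  sh @: M :|: [set q] \in fam (n + 4) (m + 1) r.
Proof.
move=> /famP[muM MC sM mM] qP; have qP1 : [set q] \subset [set p; p'] by rewrite sub1set.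
have two (y : T') : y \in [set p; p'] -> y != q -> (p \in [set y; q]) && (p' \in [set y; q]).
  by case/set2P => ->; case/set2P: qP => ->; rewrite ?eqxx // !inE !eqxx ?orbT.
apply/famP; split.
- by rewrite -sh_mu inE imset_f.
- apply/subsetP => y /setUP[/imsetP[x xM ->]|/set1P->]; first by have [] := sh_core (subsetP MC _ xM).
  exact: (subsetP new_points).
- rewrite sum_free_shift // sM /=; apply/negP => /andP[/set1P e1 /set1P e2].
  by move: pp'; rewrite e1 e2 eqxx.
- move=> y yC sy; have [e|yq] := eqVneq y q; first by rewrite e !inE eqxx orbT.
  have old : y \in [set p; p'] -> y \in sh @: M :|: [set q].
    move=> yP; move: sy; rewrite setUCA sum_free_shift ?two ?andbF //.
    by apply/subsetP => u /set2P[] ->.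
  case: (core_split yC) => [e|e|[x xC e]]; [by apply: old; rewrite e !inE eqxx | by apply: old; rewrite e !inE eqxx orbT|].
  have eU : y |: (sh @: M :|: [set q]) = sh @: (x |: M) :|: [set q].
    by rewrite imsetU1 e setUA.
  rewrite eU sum_free_shift // ?inE ?muM ?orbT // in sy; last by rewrite subUset sub1set xC.
  by case/andP: sy => sx _; rewrite -e inE imset_f // mM.
Qed.

Let fam_restrict (M' : {set T'}) : M' \in fam (n + 4) (m + 1) r ->
  exists M q, [/\ M \in fam n m r, q \in [set p; p'] & M' = sh @: M :|: [set q]].
Proof.
move=> /famP[muM MC sM mM]; pose A := [set x in C | sh x \in M']; pose P := M' :&: [set p; p'].
have PP : P \subset [set p; p'] by apply: subsetIr.
have AC : A \subset C by apply/subsetP => x; rewrite inE => /andP[].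
have ME : M' = sh @: A :|: P.
  apply/setP => y; apply/idP/setUP => [yM|[/imsetP[x xA ->]|/setIP[]//]]; last first.
    by move: xA; rewrite inE => /andP[].
  case: (core_split (subsetP MC _ yM)) => [e|e|[x xC e]].
  - by right; rewrite inE yM e !inE eqxx.
  - by right; rewrite inE yM e !inE eqxx orbT.
  - by left; rewrite -e imset_f // inE xC e.
have muA : mu \in A by rewrite inE muC sh_mu.
have := sM; rewrite {1}ME sum_free_shift // => /andP[sA nP].
have add (y : T') : y \in [set p; p'] -> P = set0 -> y \in M'.
  move=> yP P0; apply: mM; first exact: (subsetP new_points).
  rewrite setUC ME P0 setU0 sum_free_shift ?sub1set // sA /=.
  apply/negP => /andP[/set1P e1 /set1P e2].
  by move: pp'; rewrite e1 e2 eqxx.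
have [q qP Pq] : exists2 q, q \in [set p; p'] & P = [set q].
  have [P0|[q qP]] := set_0Vmem P.
    have pM : p \in M' by apply: add => //; rewrite !inE eqxx.
    by have : p \in P; [rewrite in_setI pM !inE eqxx | rewrite P0 in_set0].
  exists q; first exact: (subsetP PP).
  apply/eqP; rewrite eqEsubset sub1set qP andbT; apply/subsetP => u uP; rewrite inE.
  apply: contraT => uq; case/negP: nP.
  case/set2P: (subsetP PP _ uP) => eu; case/set2P: (subsetP PP _ qP) => eq;
  by move: uq uP qP; rewrite eu eq ?eqxx // => _ -> ->.
exists A, q; split => //; last by rewrite -Pq.
apply/famP; split => // x xC sx; rewrite inE xC mM //; first by have [] := sh_core xC.
have eU : sh x |: M' = sh @: (x |: A) :|: P by rewrite imsetU1 {1}ME setUA.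
rewrite eU sum_free_shift // ?sx //; first by rewrite subUset sub1set xC.
by rewrite inE muA orbT.
Qed.

(** [p] and [p'] exclude each other because [m + 1] is present, and if both were absent either could
    be added; nothing else distinguishes them. *)
Lemma card_fam_double : #|fam (n + 4) (m + 1) r| = 2 * #|fam n m r|.
Proof.
pose ext q (M : {set T}) := sh @: M :|: [set q].
have inj q : q \in [set p; p'] -> {in fam n m r &, injective (ext q)}.
  move=> qP M1 M2 /famP[_ C1 _ _] /famP[_ C2 _ _] e; apply/setP => x.
  have mem (M : {set T}) : M \subset C -> x \in C -> (sh x \in ext q M) = (x \in M).
    move=> MC xC; rewrite inE in_set1; have [_ n1 n2] := sh_core xC.
    have -> : (sh x == q) = false by apply/negbTE; case/set2P: qP => ->.
    rewrite orbF; apply/imsetP/idP => [[y yM /sh_inj]|xM]; last by exists x.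
    by move=> /(_ xC (subsetP MC _ yM)) ->.
  have [xC|xC] := boolP (x \in C); first by rewrite -(mem M1) // e mem.
  by apply/idP/idP => [/(subsetP C1)|/(subsetP C2)]; rewrite (negbTE xC).
have pP : p \in [set p; p'] by rewrite !inE eqxx.
have p'P : p' \in [set p; p'] by rewrite !inE eqxx orbT.
have -> : fam (n + 4) (m + 1) r = ext p @: fam n m r :|: ext p' @: fam n m r.
  apply/setP => M'; apply/idP/setUP => [/fam_restrict[M [q [MF qP ->]]]|].
    by case/set2P: qP => ->; [left|right]; apply: imset_f.
  by case=> /imsetP[M MF ->]; apply: fam_extend.
rewrite cardsU (card_in_imset (inj _ pP)) (card_in_imset (inj _ p'P)).
rewrite (_ : _ :&: _ = set0) ?cards0 ?subn0 ?mul2n ?addnn //.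
apply/setP => M'; rewrite in_set0; apply/negP => /setIP[/imsetP[M MF ->] /imsetP[M2 M2F e]].
have : p \in ext p M by rewrite !inE eqxx orbT.
rewrite e => /setUP[/imsetP[x xM e2]|/set1P e2]; last by move: pp'; rewrite e2 eqxx.
case/famP: M2F => _ MC _ _; have [_] := sh_core (subsetP MC _ xM).
by rewrite -e2 eqxx.
Qed.

End Recurrence.

(** * Summing the families over the low element *)

Section Cal.
Variables n r : nat.
Hypothesis nr : 100 * r + 100 <= n.
Local Notation T := 'I_n.+1.
Local Notation h := (n %/ 2).

Definition upper : {set T} := [set x : T | h < x + r].
(** Testing maximality only above [h - r] makes the count double exactly; [cal_max_ideal] bounds
    what this weakening adds. *)
Definition cal : {set {set T}} := [set M : {set T} | vmax upper M & ideal M r].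

Definition mid_range m := (4 * m <= n + 4 * r) && (n <= 4 * m + 4 * r).

Lemma fam_cal (m : T) (M : {set T}) : mid_range m -> M \in fam n m r ->
  [/\ M \in cal, m \in M & forall x, x \in M -> x + r <= h -> x = m].
Proof.
move=> mr /famP[mM MC sM mM']; rewrite inord_val in mM.
have low (x : T) : x \in M -> x + r <= h -> x = m.
  move=> /(subsetP MC); rewrite inE => /orP[/eqP/ord_inj //|/andP[]].
  by clear; lia.
split => //; rewrite inE; apply/andP; split.
  apply/vmaxP; split => // x; rewrite inE => hx xM; apply: contraT => nb.
  case/negP: xM; apply: mM'; first by rewrite inE; apply/orP; right; rewrite hx; have := ltn_ord x; clear; lia.
  by apply: sum_free_add => //; move: hx nr; clear; lia.
apply/exists_inP; exists m => //; move: mr; rewrite /mid_range => ->; apply/forall_inP => x xM.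
by apply/implyP => xr; apply/eqP/low.
Qed.

Lemma cal_fam (M : {set T}) : M \in cal -> exists2 m : T, mid_range m & M \in fam n m r.
Proof.
rewrite inE => /andP[/vmaxP[sM mx] /exists_inP[m mM /andP[mr /forall_inP u]]]; exists m => //.
apply/famP; rewrite inord_val; split => //.
  apply/subsetP => x xM; rewrite inE /in_core; have := ltn_ord x; rewrite ltnS => ->.
  rewrite andbT; have := u x xM; case: leqP => [_ /eqP ->|_ _]; rewrite ?eqxx ?orbT //.
move=> x; rewrite inE => /orP[/eqP/ord_inj -> //|/andP[hx _] sx]; apply: contraT => xM.
have := mx x; rewrite inE hx => /(_ isT xM) /(blockedS (subsetUr [set x] M)).
by apply/contraLR => _; apply: sum_free_not_blocked; rewrite // !inE eqxx.
Qed.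

Lemma card_cal : #|cal| = \sum_(0 <= m < n.+1 | mid_range m) #|fam n m r|.
Proof.
pose f (M : {set T}) : T := odflt ord0 [pick m in M | m + r <= h].
have fE (m : T) (M : {set T}) : mid_range m -> M \in fam n m r -> f M = m.
  move=> mr MF; have [_ mM low] := fam_cal mr MF; rewrite /f.
  case: pickP => [x /andP[xM xr]|/(_ m)]; first exact: low.
  by rewrite mM /= => /negbT; move: mr; rewrite /mid_range; move: nr; clear; lia.
rewrite big_mkord (@card_fibers_sum _ _ cal [set m : T | mid_range m] f); last first.
  by move=> M /cal_fam[m mr /(fE _ _ mr) ->]; rewrite inE.
apply: eq_big => [m|m]; rewrite inE // => mr; apply: eq_card => M; rewrite inE.
apply/andP/idP => [[/cal_fam[m' mr' MF] /eqP <-]|MF]; first by rewrite (fE m' M).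
by have [-> _ _] := fam_cal mr MF; rewrite (fE m M).
Qed.

End Cal.

(** The admissible [m] for [n + 4] are those for [n], increased by 1. *)
Lemma cal_recurrence n r : 100 * r + 100 <= n -> #|cal (n + 4) r| = 2 * #|cal n r|.
Proof.
move=> nr; rewrite !card_cal //; last by move: nr; clear; lia.
rewrite big_mkcond big_nat_recl //= {1}/mid_range.
have -> : (4 * 0 <= n + 4 + 4 * r) && (n + 4 <= 4 * 0 + 4 * r) = false.
  by move: nr; clear; lia.
rewrite add0n (@big_cat_nat _ _ _ n.+1) //=; last by clear; lia.
rewrite [X in _ + X = _]big_nat_cond [X in _ + X = _]big1 => [|i].
  rewrite addn0 -big_mkcond big_distrr /=; apply: eq_big => [i|i mr].
    by rewrite /mid_range; clear; lia.
  move: mr; rewrite /mid_range => mr; have /andP[m1 m2] : (4 * i <= n + 4 * r) && (n <= 4 * i + 4 * r).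
    by move: mr; clear; lia.
  by rewrite -(card_fam_double m1 m2 nr) (addn1 i).
by rewrite andbT => hi; case: ifP => //; rewrite /mid_range; move: nr hi; clear; lia.
Qed.

(** * The limit along a residue class *)

Lemma card_fibers_le (I J : finType) (A : {set I}) (P : {set J}) (f : I -> J) k :
  (forall x, x \in A -> f x \in P /\ #|[set y in A | f y == f x]| <= k) -> #|A| <= k * #|P|.
Proof.
move=> h; rewrite (@card_fibers_sum _ _ A P f) => [|x /h[]//].
rewrite mulnC -sum_nat_const; apply: leq_sum => y _.
case: (set_0Vmem [set x in A | f x == y]) => [->|[x]]; first by rewrite cards0.
by rewrite inE => /andP[xA /eqP <-]; have [_] := h x xA.
Qed.

Section MaxCal.
Variables n r q : nat.
Hypotheses (nr : 100 * r + 100 <= n) (nq : 2 * q <= n).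
Local Notation T := 'I_n.+1.
Local Notation h := (n %/ 2).

Definition max_ideal : {set {set T}} := [set M : {set T} | max_sum_free M & ideal M r].

Lemma max_ideal_cal : max_ideal \subset cal n r.
Proof.
apply/subsetP => M; rewrite !inE max_sum_freeE => /andP[vM ->]; rewrite andbT.
by apply: vmaxS vM; apply/subsetP => x; rewrite !inE; move: nr; clear; lia.
Qed.

Let addable (M : {set T}) := odflt ord0
  [pick x : T | [&& x + r <= h, x \notin M, 0 < x & sum_free (x |: M)]].

Let addableP M : M \in cal n r :\: max_ideal -> let x := addable M in
  [/\ x + r <= h, x \notin M, sum_free (x |: M) & exists2 m : T, m != x & low r (x |: M) = [set x; m]].
Proof.
rewrite inE => /andP[nM MC] /=.
have [x xr [xM x0 sx]] : exists2 x : T, x + r <= h & [/\ x \notin M, 0 < x & sum_free (x |: M)].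
  move: (MC) nM; rewrite inE => /andP[/vmaxP[sM mx] iM].
  rewrite inE iM andbT max_sum_freeE /vmax sM /= => /forall_inPn[x xI].
  rewrite negb_imply => /andP[xM nb]; exists x.
    by rewrite leqNgt; apply: contra nb => hx; apply: mx; rewrite // inE.
  by rewrite inE in xI; split => //; apply: sum_free_add.
rewrite /addable; case: pickP => [{x xr xM x0 sx}x /= /and4P[xr xM x0 sx]|/(_ x)]; last first.
  by rewrite xr xM x0 sx.
split => //; have [m mr MF] := cal_fam MC; have [_ mM mlow] := fam_cal nr mr MF.
exists m; first by apply: contra xM => /eqP <-.
apply/setP => y; rewrite !inE; apply/andP/orP => [[/orP[->|yM] yr]|[/eqP->|/eqP->]]; [by left| |by rewrite eqxx|].
  by right; apply/eqP/mlow.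
by rewrite mM orbT; split => //; move: mr; rewrite /mid_range; move: nr; clear; lia.
Qed.

(** A set of [cal] that is not maximal accepts some [x <= h - r]; it then has two elements there, is
    no longer ideal, and lies in [bad]. The map is at most two-to-one because [x] is one of the two
    low elements of the image. *)
Lemma cal_max_ideal : #|cal n r| <= #|max_ideal| + 2 * #|bad n q r|.
Proof.
rewrite -(cardsID max_ideal) (setIidPr max_ideal_cal) leq_add2l.
apply: (@card_fibers_le _ _ _ _ (fun M => addable M |: M)) => M MA.
have [xr xM sx [m mx lE]] := addableP MA; set x := addable M in xr xM sx mx lE *.
have [mM mr] : m \in M /\ m + r <= h.
  have : m \in low r (x |: M) by rewrite lE !inE eqxx orbT.
  by rewrite !inE (negbTE mx) => /andP[].
split.
  rewrite inE; apply/and3P; split.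
  - apply/vmaxP; split => // y yt; rewrite inE negb_or => /andP[_ yM].
    move: MA; rewrite inE => /andP[_]; rewrite inE => /andP[/vmaxP[_ mx'] _].
    apply: (blockedS (subsetUr [set x] M)); apply: mx' => //.
    by move: yt; rewrite !inE; clear; lia.
  - apply: leq_trans nq; rewrite leq_mul2r; apply/orP; right.
    apply: (@leq_trans #|low r (x |: M)|); last by rewrite lE cards2; case: (x != m).
    apply: subset_leq_card; apply/subsetP => y; rewrite !inE => /andP[->] /=.
    by rewrite /scale; move: nr; clear; lia.
  - apply/exists_inPn => z _; apply/negP => /andP[_ /forall_inP u].
    have := u x; rewrite !inE eqxx xr => /(_ isT)/eqP xz.
    have := u m; rewrite !inE mM orbT mr -xz => /(_ isT)/eqP mx2.
    by move: mx; rewrite mx2 eqxx.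
apply: (@leq_trans #|[set (x |: M) :\ y | y in low r (x |: M)]|).
  apply: subset_leq_card; apply/subsetP => M2; rewrite inE => /andP[M2A /eqP e].
  have [xr2 xM2 _ _] := addableP M2A; rewrite -e.
  apply/imsetP; exists (addable M2); first by rewrite !inE eqxx.
  by rewrite setU1K.
by apply: (leq_trans (leq_imset_card _ _)); rewrite lE cards2; case: (x != m).
Qed.

Lemma card_max_bounds :
  [/\ num_max_sum_free n <= #|cal n r| + #|beta_max n q| + #|bad n q r| +
    #|[set M : {set T} | max_sum_free M & (M \notin beta_max n q) &&
      ~~ (#|low (scale n) M| * q <= n)]| &
   #|cal n r| + #|beta_max n q| <= num_max_sum_free n + 2 * #|bad n q r| +
    #|[set M in beta_max n q | ideal M r]|].
Proof.
set un := [set M : {set T} | _ & _]; set bi := [set M in beta_max n q | _].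
pose nid := [set M : {set T} | max_sum_free M & ~~ ideal M r].
have tot : num_max_sum_free n = #|max_ideal| + #|nid|.
  rewrite /num_max_sum_free -(cardsID [set M : {set T} | ideal M r]).
  by congr (_ + _); apply: eq_card => M; rewrite !inE // andbC.
have n1 : #|nid| <= #|beta_max n q| + #|bad n q r| + #|un|.
  apply: (@leq_trans #|beta_max n q :|: bad n q r :|: un|).
    apply: subset_leq_card; apply/subsetP => M; rewrite inE => /andP[mM nM].
    rewrite !in_setU [M \in un]inE [M \in bad _ _ _]inE mM nM andbT /=.
    have -> : vmax (top n) M.
      move: mM; rewrite max_sum_freeE; apply: vmaxS.
      exact/sum_free_interval/top_sum_free.
    by case: (M \in _); case: (_ <= n).
  apply: (leq_trans (leq_card_setU _ _).1); rewrite leq_add2r.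
  exact: (leq_card_setU _ _).1.
have n2 : #|beta_max n q| <= #|nid| + #|bi|.
  apply: (@leq_trans #|nid :|: bi|); last exact: (leq_card_setU _ _).1.
  apply: subset_leq_card; apply/subsetP => M MB; rewrite in_setU [M \in nid]inE [M \in bi]inE MB.
  by move: MB; rewrite inE => /andP[-> _]; rewrite orbC orbN.
have n3 : #|max_ideal| <= #|cal n r| by apply/subset_leq_card/max_ideal_cal.
have n4 := cal_max_ideal.
rewrite tot; split; move: n1 n2 n3 n4; clear; lia.
Qed.

End MaxCal.

(** The summand doubles when [s > 0] grows by 4; the 3 comes from [s = 2] and [s = 4]. *)
Lemma evsum_rec n : evsum (n + 4) = 2 * evsum n + 3.
Proof.
pose F s := if ~~ odd s && (0 < s) then 2 ^ (s %/ 2 %/ 2) else 0.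
have FE k : evsum k = \sum_(s < k.+1) F s by rewrite /evsum big_mkcond.
have F4 k : F (k.+1 + 4) = 2 * F k.+1.
  rewrite /F oddD addbF addSn /=; case: (odd k) => //=.
  by rewrite -expnS; congr (_ ^ _); clear; lia.
rewrite !FE; elim: n => [|n IH]; first by rewrite !big_ord_recr !big_ord0.
by rewrite addSn big_ord_recr IH [in RHS]big_ord_recr /= -addSn F4 mulnDr addnAC.
Qed.

Section Asymptotic.
Local Open Scope ring_scope.
Variables (R : archiRealFieldType) (a : R).
Hypotheses (a0 : 0 < a) (a4 : a ^+ 4 = 2).

Lemma expsmall_eventually f (e : R) : 0 < e -> expsmall a f ->
  exists n0, forall n, (n0 <= n)%N -> (f n)%:R <= e * a ^+ n.
Proof.
move=> e0 [t [/andP[t0 t1] [n0 hn]]]; have [|k hk] := @expr_small R t e _ e0; first by rewrite (ltW t0).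
exists (n0 + k)%N => n nn; apply: (le_trans (hn n _)); first by move: nn; clear; lia.
rewrite exprMn; apply: ler_wpM2r; first by rewrite exprn_ge0 // ltW.
by apply: le_trans hk; apply: ler_wiXn2l; [exact: ltW | exact: ltW | move: nn; clear; lia].
Qed.

Lemma combine_bounds (m c v b d un bi : nat) (e A : R) :
  (m <= c + b + d + un)%N -> (c + b <= m + 2 * d + bi)%N ->
  d%:R <= e / 10 * A -> un%:R <= e / 10 * A -> bi%:R <= e / 10 * A ->
  (b - v)%:R <= e / 10 * A -> (v - b)%:R <= e / 10 * A ->
  `|m%:R - (c + v)%:R| <= e * A.
Proof.
move=> U L.
have {}U : (m <= c + v + (b - v) + d + un)%N by move: U; clear; lia.
have {}L : (c + v <= m + 2 * d + bi + (v - b))%N by move: L; clear; lia.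
move: (b - v)%N (v - b)%N U L => y z; rewrite -!(ler_nat R) !natrD => U L H1 H2 H3 H4 H5.
have d0 : 0 <= d%:R :> R by [].
have E : e * A = 10 * (e / 10 * A) by field.
by rewrite E ler_norml; apply/andP; split; lra.
Qed.

(** First [r] is chosen with [C * th ^+ r <= e / 10]; only then is [n] taken large, which makes the
    exponentially small errors negligible. *)
Lemma count_approx (e : R) : 0 < e -> exists r n1, forall n, (n1 <= n)%N ->
  `|(num_max_sum_free n)%:R - (#|cal n r| + evsum n)%:R| <= e * a ^+ n.
Proof.
move=> e0.
have [qb qb0 Hb] := beta_count a0 a4; have [qi qi0 Hi] := beta_ideal_small a0 a4.
have [th [C [/andP[th0 th1] C0 [r1 [qg Hg]]]]] := gamma_bound a0 a4.
pose q := (qb + qi + qg)%N.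
have e7 : 0 < e / 10 by lra.
have [|k hk] := @expr_small R th (e / 10 / (C + 1)) _ (divr_gt0 e7 (ltr_wpDl C0 ltr01)).
  by rewrite (ltW th0).
pose r := (r1 + k)%N; exists r.
have hr : C * th ^+ r <= e / 10.
  apply: (@le_trans _ _ ((C + 1) * th ^+ k)); last by rewrite -ler_pdivlMl ?ltr_wpDl // mulrC.
  apply: ler_pM => //; [by rewrite exprn_ge0 // ltW | by rewrite lerDl |].
  by apply: ler_wiXn2l; [exact: ltW | exact: ltW | apply: leq_addl].
have [||n1 H1] := Hg r q; [exact: leq_addr | exact: leq_addl |].
have [|B1 B2] := Hb q; first by rewrite /q; clear; lia.
have [n2 H2] := expsmall_eventually e7 B1; have [n3 H3] := expsmall_eventually e7 B2.
have [|n4 H4] := expsmall_eventually e7 (Hi q r _); first by rewrite /q; clear; lia.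
have [|n5 H5] := expsmall_eventually e7 (@unclassified_small _ a a0 a4 q _); first by rewrite /q; move: qb0; clear; lia.
exists (n1 + n2 + n3 + n4 + n5 + 2 * q + 100 * r + 100)%N => n nn.
have {}H1 : #|bad n q r|%:R <= e / 10 * a ^+ n.
  apply: le_trans (H1 n _) _; first by move: nn; clear; lia.
  by apply: ler_wpM2r => //; rewrite exprn_ge0 // ltW.
have {}H2 := H2 n ltac:(move: nn; clear; lia).
have {}H3 := H3 n ltac:(move: nn; clear; lia).
have {}H4 := H4 n ltac:(move: nn; clear; lia).
have {}H5 := H5 n ltac:(move: nn; clear; lia).
have [||U L] := @card_max_bounds n r q; [by move: nn; clear; lia | by move: nn; clear; lia |].
exact: (combine_bounds U L H1 H5 H4 H2 H3).
Qed.

End Asymptotic.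

(** [L] depends on [e] through [r], so this is a Cauchy property and not yet convergence to a known
    limit. *)
Lemma class_cauchy (R : archiRealFieldType) (a e : R) j : (0 < a -> a ^+ 4 = 2 -> 0 < e ->
  exists L K, forall k, (K <= k)%N ->
    `|(num_max_sum_free (j + 4 * k))%:R / a ^+ (j + 4 * k) - L| <= e)%R.
Proof.
move=> a0 a4 e0; have e2 : (0 < e / 2)%R by lra.
have [r [n1 H]] := count_approx a0 a4 e2.
have [_ _ _ _ a1] := base_facts a0 a4.
have a1' : (1 < a)%R.
  by rewrite lt_neqAle a1 andbT; apply/eqP => ea; have := a4; rewrite -ea expr1n; lra.
(* Ensures [3 <= e / 2 * a ^+ n], which absorbs the 3 in [E]. *)
have [k0 _ hk] := expr_unbounded (6 / e)%R a1'.
(* The 3 turns the affine recurrence of [evsum] into exact doubling, so [E n / a ^+ n] is constant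
   along the class from [K] on; this constant is [L]. *)
pose E n := (#|cal n r| + evsum n + 3)%N.
have Erec n : 100 * r + 100 <= n -> E (n + 4) = 2 * E n.
  by move=> nr; rewrite /E cal_recurrence // evsum_rec; clear; lia.
pose K := n1 + k0 + 100 * r + 100.
exists ((E (j + 4 * K)%N)%:R / a ^+ (j + 4 * K))%R, K => k Kk.
have an n : (0 < a ^+ n)%R by rewrite exprn_gt0.
have <- : ((E (j + 4 * k)%N)%:R / a ^+ (j + 4 * k) = (E (j + 4 * K)%N)%:R / a ^+ (j + 4 * K))%R.
  rewrite -(subnKC Kk); elim: (k - K) => [|d IH]; first by rewrite addn0.
  rewrite -IH (_ : j + 4 * (K + d.+1) = j + 4 * (K + d) + 4); last by clear; lia.
  rewrite Erec; last by rewrite /K; clear; lia.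
  rewrite exprD a4 natrM; have /lt0r_neq0 := an (j + 4 * (K + d)).
  by move: (a ^+ _)%R ((E _)%:R)%R => x y x0; field.
have nk : n1 + k0 <= j + 4 * k by move: Kk; rewrite /K; clear; lia.
move: (j + 4 * k) nk => n nk; have an0 := an n; rewrite -mulrBl normrM normfV (gtr0_norm an0).
rewrite ler_pdivrMr //; have := H n (leq_trans (leq_addr _ _) nk).
have big : (6 / e <= a ^+ n)%R.
  by apply: (le_trans hk); apply: ler_weXn2l => //; move: nk; clear; lia.
have {}big : (6 <= a ^+ n * e)%R by rewrite -ler_pdivrMr.
move=> Hn; rewrite /E natrD opprD addrA; apply: (le_trans (ler_normB _ _)).
by rewrite (ger0_norm (_ : 0 <= 3)%R) //; move: Hn big; rewrite mulrC; move: (`|_|)%R (a ^+ n)%R => x y; lra.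
Qed.

From mathcomp Require Import all_classical all_reals all_analysis.

Import numFieldNormedType.Exports.

Local Open Scope classical_set_scope.
Local Open Scope ring_scope.

Theorem theorem1p1 (R : realType) (i : nat) (hi : (1 <= i <= 4)%N) :
  exists (C : R) (err : nat -> R),
    (err n @[n --> within [set n : nat | n = i %[mod 4]] \oo] --> (0 : R)) /\
    (forall n : nat, (0 < n)%N -> n = i %[mod 4] ->
       (num_max_sum_free n)%:R = (C + err n) * 2 `^ (n%:R / 4)).
Proof.
pose a : R := 2 `^ 4^-1; have a0 : 0 < a by apply: powR_gt0.
have aE n : a ^+ n = 2 `^ (n%:R / 4) :> R.
  by rewrite -powR_mulrn ?(ltW a0) // -powRrM mulrC.
have a4 : a ^+ 4 = 2 by rewrite aE divff ?powRr1 // pnatr_eq0.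
(* For [i = 4] the class starts at 0. *)
pose j := (i %% 4)%N.
pose u k : R := (num_max_sum_free (j + 4 * k))%:R / a ^+ (j + 4 * k).
have cu : cvgn u.
  apply: R_complete; apply: cauchy_exP => e e0.
  have [L [K HK]] := class_cauchy j a0 a4 (divr_gt0 e0 (ltr0n _ 2)).
  exists L; exists K => // k /= /HK; rewrite /ball /= distrC => h.
  by apply: (le_lt_trans h); rewrite ltr_pdivrMr // ltr_pMr // ltr1n.
(* The error is the exact remainder, so the identity holds for every [n], and only its convergence
   refers to the residue class. *)
exists (limn u), (fun n => (num_max_sum_free n)%:R / 2 `^ (n%:R / 4) - limn u); split; last first.
  by move=> n _ _; rewrite addrC subrK divfK // -aE expf_neq0 // lt0r_neq0.
apply/cvgrPdist_le => e e0; rewrite near_withinE.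
have /cvgrPdist_le/(_ e e0)[K _ HK] := cu.
exists (4 * K + 4)%N => // n /= nK ni; rewrite sub0r opprB -aE.
have nE : n = (j + 4 * (n %/ 4))%N by rewrite /j -ni addnC mulnC -divn_eq.
by have := HK (n %/ 4)%N; rewrite /u -nE; apply; rewrite /= leq_divRL // mulnC; lia.
Qed.
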